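(* Let $\kappa>1$ be a constant. For any $d\in\mathbb{N}$, $R>0$, any sufficiently small $\alpha,\varepsilon>0$ and all $m\in\mathbb{N}$, \[ n_m^{\mathrm{Gauss}(R,d,\kappa;\alpha)}(\varepsilon,\delta=0)=\tilde{\Theta}_\kappa\left(\frac{d^2}{\varepsilon}+\frac{d^2}{\alpha\varepsilon\sqrt{m}}+\frac{d^2}{\alpha^2 m}\right). \]
   Context: User-level DP: there are $n$ users each holding $m$ examples from a domain $\mathcal{Z}$; two inputs in $\mathcal{Z}^{nm}$ are user-level neighbors if they differ only in one user's $m$ examples; an algorithm is $(\varepsilon,\delta)$-user-level DP if $\Pr[\mathbf{A}(\mathbf{x})\in S]\le e^\varepsilon\Pr[\mathbf{A}(\mathbf{x}')\in S]+\delta$ for all neighbors and all output sets $S$. For a task with correct-answer sets $\Psi(\mathcal{D})$, $n_m(\varepsilon,\delta)$ is the smallest $n$ such that some $(\varepsilon,\delta)$-user-level DP algorithm, given $nm$ i.i.d. samples from $\mathcal{D}$ grouped into $n$ users, outputs an element of $\Psi(\mathcal{D})$ with probability at least $2/3$ for every valid $\mathcal{D}$. The task $\mathrm{Gauss}(R,d,\kappa;\alpha)$: $\mathcal{Z}=\mathbb{R}^d$, the valid distributions are Gaussians $\mathcal{N}(\mu,\Sigma)$ with $\|\mu\|\le R$ and $I\preceq\Sigma\preceq\kappa I$, and a correct output is a distribution $\mathcal{Q}$ with $d_{\mathrm{TV}}(\mathcal{Q},\mathcal{D})\le\alpha$. $\tilde{\Theta}_\kappa$ hides factors depending on $\kappa$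 and factors polylogarithmic in $1/\alpha$, $d$, $R$, $\kappa$. *)

(* Defs.v *)
From HB Require Import structures.
From mathcomp Require Import all_boot all_order all_algebra.
From mathcomp Require Import all_classical all_reals all_analysis.

Set Implicit Arguments.
Unset Strict Implicit.
Unset Printing Implicit Defensive.

Import Order.TTheory GRing.Theory Num.Theory.
Import numFieldNormedType.Exports.

Local Open Scope classical_set_scope.
Local Open Scope ring_scope.

Section iid.
Context {R : realType} {d : measure_display} {T : measurableType d}.

Definition tuple_cons n (p : T * n.-tuple T) : n.+1.-tuple T :=
  [tuple of p.1 :: p.2].

Lemma measurable_tuple_cons n : measurable_fun [set: _] (@tuple_cons n).
Proof. exact: measurable_cons. Qed.

HB.instance Definition _ n := @isMeasurableFun.Build _ _ _ _
  (@tuple_cons n) (@measurable_tuple_cons n).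

(* The joint law of n independent samples from P: the n-fold product of P. *)
Fixpoint iid (P : probability T R) (n : nat) : probability (n.-tuple T) R :=
  if n is n'.+1 then distribution (P \x iid P n')%E (@tuple_cons n')
  else \d_[tuple].

End iid.

Section user_level_privacy.
Context {R : realType} {dZ dO : measure_display}.
Context {Z : measurableType dZ} {O : measurableType dO}.

(* The inputs, n users holding m examples each, are of type
   n.-tuple (m.-tuple Z). *)
Definition user_neighbors n m (x x' : n.-tuple (m.-tuple Z)) : Prop :=
  exists i : 'I_n, forall j : 'I_n, j != i -> tnth x j = tnth x' j.

(* A randomized algorithm is a probability kernel; A x is the law of its
   output on the input x. *)
Definition user_level_dp n m (eps delta : R)
    (A : R.-pker n.-tuple (m.-tuple Z) ~> O) : Prop :=
  forall x x', user_neighbors x x' -> forall S : set O, measurable S ->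
    (A x S <= (expR eps)%:E * A x' S + delta%:E)%E.

Record task := Task {
  valid : set (probability Z R) ;
  correct : probability Z R -> set O }.

Definition solves (t : task) n m (A : R.-pker n.-tuple (m.-tuple Z) ~> O) :
    Prop :=
  forall D, valid t D ->
    ((2 / 3)%:E <= \int[iid (iid D m) n]_x A x (correct t D))%E.

Definition achievable (t : task) m (eps delta : R) (n : nat) : Prop :=
  exists2 A : R.-pker n.-tuple (m.-tuple Z) ~> O,
    user_level_dp eps delta A & solves t A.

(* n = n_m(eps, delta) *)
Definition is_user_complexity (t : task) m (eps delta : R) (n : nat) : Prop :=
  achievable t m eps delta n /\
  forall k, achievable t m eps delta k -> (n <= k)%N.

End user_level_privacy.

Definition tv_dist {R : realType} {d : measure_display} {T : measurableType d}
    (P Q : probability T R) : \bar R :=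
  ereal_sup [set `|P A - Q A|%E | A in [set A : set T | measurable A]].

Section gauss.
Context {R : realType}.

(* The norm of the library on 'cV_d is the maximum norm. *)
Definition norm2 d (v : 'cV[R]_d) : R := Num.sqrt (\sum_i v i 0 ^+ 2).

Definition psd d (M : 'M[R]_d) : Prop :=
  M^T = M /\ forall v : 'cV[R]_d, 0 <= (v^T *m M *m v) 0 0.

Definition loewner_le d (M N : 'M[R]_d) : Prop := psd (N - M).

(* R^d, with the product of the Borel sigma-algebras. *)
Definition Rd d : measurableType _ := d.-tuple (measurableTypeR R).

Definition affine_map d (mu : 'cV[R]_d) (M : 'M[R]_d) (z : Rd d) : Rd d :=
  [tuple mu i 0 + \sum_j M i j * tnth z j | i < d].

(* D = N(mu, Sigma), the law of mu + M g for g a vector of d independent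
   standard normal variables and M M^T = Sigma. *)
Definition is_gaussian d (mu : 'cV[R]_d) (Sigma : 'M[R]_d)
    (D : probability (Rd d) R) : Prop :=
  exists2 M : 'M[R]_d, M *m M^T = Sigma &
    forall B : set (Rd d), measurable B ->
      D B = iid (normal_prob (0 : R) 1) d (affine_map mu M @^-1` B).

(* The output space is the set of all distributions on R^d, with the
   sigma-algebra generated by the evaluations Q |-> Q B, B Borel. Total
   variation balls are measurable for it, because the Borel sigma-algebra is
   countably generated. *)
Definition Gauss (r : R) (d : nat) (kappa alpha : R) :
    @task R _ _ (Rd d) (pprobability (Rd d) R) :=
  Task
    [set D | exists mu Sigma, [/\ norm2 mu <= r,
       loewner_le 1%:M Sigma, loewner_le Sigma kappa%:M
       & is_gaussian mu Sigma D]]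
    (fun D => [set Q : pprobability (Rd d) R | (tv_dist Q D <= alpha%:E)%E]).

Definition gauss_rate (d m : nat) (alpha eps : R) : R :=
  d%:R ^+ 2 / eps + d%:R ^+ 2 / (alpha * eps * Num.sqrt m%:R)
  + d%:R ^+ 2 / (alpha ^+ 2 * m%:R).

(* Every polylogarithmic factor in 1/alpha, d, r, kappa is at most a constant
   times a power of this one, which is at least 1. *)
Definition log_factor (r : R) (d : nat) (kappa alpha : R) : R :=
  1 + ln (1 + alpha^-1) + ln (1 + d%:R) + ln (1 + r) + ln (1 + kappa).

End gauss.

(* Main.v *)
(* Lower bound. Perturbing the covariance by a d/2 x d/2 block of entries taken
   from a grid of width about alpha / d gives exp(c d^2) Gaussians that are
   pairwise alpha-far in total variation, while each has chi-square divergence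
   O(alpha^2) from a common reference Gaussian Q; for d = 1 the scale of the
   Gaussian plays this role. Group privacy turns a correct answer under P into
   one under Q at a cost (1 + t (exp eps - 1))^n, where t <= min(1, alpha sqrt m)
   bounds the total variation distance between the laws of one user, and the
   answers under Q cannot be correct for many P at once: this gives the first
   two terms of the rate. The third is the usual information bound, obtained
   here from the second moment of the density.

   Upper bound. Take a grid net of exp(O(d^2 log)) Gaussians. A pair of net
   points which are far apart is compared by the event separating them: every
   user votes with the empirical frequency of the event, centred between the two
   probabilities and clipped at tau = alpha + O(log / sqrt m). Net points are
   then sampled with probability inversely proportional to the sum of
   exp (- lam * score) over all rivals, which is private because a user moves
   each score by at most 2 tau, and concentrates on the points close to the
   truth by a moment generating function bound for one user. *)

From HB Require Import structures.
From mathcomp Require Import all_boot all_order all_algebra.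
From mathcomp Require Import all_classical all_reals all_analysis.
From mathcomp Require Import measurable_realfun ring lra zify.
Require Import Defs.

Set Implicit Arguments.
Unset Strict Implicit.
Unset Printing Implicit Defensive.

Import Order.TTheory GRing.Theory Num.Theory.
Import numFieldNormedType.Exports.

Local Open Scope classical_set_scope.
Local Open Scope ring_scope.

(** * Product laws and densities *)

(** The obstacle is to compare Gaussians in total variation without determinants, from below for the
    packing and from above for the net. From below: the block perturbation adds to half of the
    coordinates a linear function [W u] of the others, so the map is unipotent and its density
    relative to the reference is the exponential of an explicit quadratic polynomial. For two blocks
    [W] and [W'] the bilinear form of [D = W - W'] is the test function. Its means under the two
    laws differ by about [|D|^2] (Frobenius), while its typical size is about [|D|]; second moments
    of the densities and a fourth moment of the form turn this into a separation of order [|D|].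
    From above: two affine images of the same Gaussian vector are joined by a chain of maps that
    each change one coordinate, and every link is a one-dimensional comparison. This loses powers of
    [d], which enter the size of the net only through a logarithm. In the upper bound one logarithm
    comes from the size of the net and two from [tau ^+ 2], whence the exponent 3; the lower bound
    has no logarithm. *)

Section density.
Context {R : realType} {d : measure_display} {T : measurableType d}.
Local Open Scope ereal_scope.

Import HBNNSimple.

Lemma ge0_integral_density (mu nu : {measure set T -> \bar R}) (g : T -> R)
    (f : T -> \bar R) :
  measurable_fun [set: T] g -> (forall x, (0 <= g x)%R) ->
  (forall A, measurable A -> nu A = \int[mu]_(x in A) (g x)%:E) ->
  measurable_fun [set: T] f -> (forall x, 0 <= f x) ->
  \int[nu]_x f x = \int[mu]_x (f x * (g x)%:E).
Proof.
move=> mg g0 nuE mf f0; pose f_ := nnsfun_approx measurableT mf.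
have mEg : measurable_fun [set: T] (fun x => (g x)%:E) by exact/measurable_EFinP.
have Efg : (fun x => f x * (g x)%:E) =
    (fun x => limn (fun n => (f_ n x)%:E * (g x)%:E)).
  apply/funext => x; apply/esym/cvg_lim => //; apply: cvgeZr => //.
  by apply: cvg_nnsfun_approx.
transitivity (limn (fun n => \int[nu]_x (f_ n x)%:E)).
  rewrite -monotone_convergence//.
  - by apply: eq_integral => x _; apply/esym/cvg_lim => //; exact: cvg_nnsfun_approx.
  - by move=> n; exact/measurable_EFinP/measurable_funTS.
  - by move=> *; rewrite lee_fin.
  - by move=> x _ m n mn; rewrite lee_fin; exact/lefP/nd_nnsfun_approx.
rewrite Efg monotone_convergence//.
- congr (limn _); apply/funext => n.
  under eq_integral do rewrite fimfunE// -fsumEFin//.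
  rewrite ge0_integral_fsum//.
  + under [RHS]eq_integral => x _.
      rewrite fimfunE// -fsumEFin// ge0_mule_fsuml; last first.
        by move=> r; rewrite nnfun_muleindic_ge0.
      over.
    rewrite ge0_integral_fsum//.
    * apply: eq_fsbigr => r _.
      rewrite integralZl_indic_nnsfun// integral_indic// setIT nuE//.
      have [r0|r0] := leP 0%R r.
        under [RHS]eq_integral do rewrite EFinM -muleA.
        rewrite ge0_integralZl//=.
        - by rewrite integral_mkcond; congr (_ * _); apply: eq_integral => x _;
            rewrite epatch_indic muleC.
        - by apply: emeasurable_funM => //; exact/measurable_EFinP.
        - by move=> x _; rewrite mule_ge0 ?lee_fin.
      have E0 : (f_ n @^-1` [set r]) = set0.
        apply/seteqP; split => // x /= fr; move: r0; rewrite -fr ltNge.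
        by rewrite fun_ge0.
      rewrite E0 integral_set0 mule0; apply/esym; rewrite integral0_eq// => x _.
      by rewrite indic0 mulr0 mul0e.
    * move=> r; apply: emeasurable_funM => //; apply/measurable_EFinP.
      exact: measurable_funM.
    * by move=> r x _; rewrite mule_ge0 ?EFinM ?nnfun_muleindic_ge0 ?lee_fin.
  + by move=> r; exact/measurable_EFinP/measurableT_comp.
  + by move=> r x _; rewrite nnfun_muleindic_ge0.
- by move=> n; apply: emeasurable_funM => //; exact/measurable_EFinP.
- by move=> n x _; rewrite mule_ge0 ?lee_fin.
- move=> x _ m n mn; rewrite lee_pmul ?lee_fin//.
  exact/lefP/nd_nnsfun_approx.
Qed.

(** The integral form, rather than a formula for the measure of sets, chains directly through
    products and changes of variable. *)
Definition has_density (P Q : probability T R) (p : T -> R) : Prop :=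
  [/\ measurable_fun [set: T] p, (forall x, (0 <= p x)%R) &
   forall f : T -> \bar R, measurable_fun [set: T] f -> (forall x, 0 <= f x) ->
     \int[P]_x f x = \int[Q]_x (f x * (p x)%:E)].

Lemma density_integral1 (P Q : probability T R) p : has_density P Q p ->
  \int[Q]_x (p x)%:E = 1.
Proof.
move=> [mp p0 PQ].
have <- : \int[P]_x cst 1 x = 1.
  by rewrite integral_cst//= probability_setT mule1.
by rewrite PQ//; apply: eq_integral => x _; rewrite mul1e.
Qed.

End density.

(** * Integration over i.i.d. tuples *)

Section iid_integral.
Context {R : realType} {d : measure_display} {T : measurableType d}.
Local Open Scope ereal_scope.
Variable P : probability T R.

Lemma integral_iid0 (f : 0.-tuple T -> \bar R) :
  measurable_fun [set: _] f -> \int[iid P 0]_x f x = f [tuple].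
Proof. by move=> mf; rewrite /= integral_dirac// diracT mul1e. Qed.

Lemma integral_iidS n (f : n.+1.-tuple T -> \bar R) :
  measurable_fun [set: _] f -> (forall x, 0 <= f x) ->
  \int[iid P n.+1]_x f x = \int[P]_x \int[iid P n]_t f (tuple_cons (x, t)).
Proof.
move=> mf f0 /=; rewrite ge0_integral_distribution//.
have mfc : measurable_fun [set: _] (fun z : T * n.-tuple T => f (tuple_cons z)).
  by apply: measurableT_comp => //; exact: measurable_tuple_cons.
by rewrite fubini_tonelli1 => [//|//|x]; exact: f0.
Qed.

Lemma measurable_iid_inner n (f : n.+1.-tuple T -> \bar R) :
  measurable_fun [set: _] f -> (forall x, 0 <= f x) ->
  measurable_fun [set: T] (fun x => \int[iid P n]_t f (tuple_cons (x, t))).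
Proof.
move=> mf f0.
apply: (measurable_fun_fubini_tonelli_F (fun z : T * n.-tuple T => f (tuple_cons z))) => //.
by apply: measurableT_comp => //; exact: measurable_tuple_cons.
Qed.

Lemma measurable_tuple_consr n (x : T) :
  measurable_fun [set: n.-tuple T] (fun t => tuple_cons (x, t)).
Proof. exact: (@measurable_cons _ _ _ _ (cst x) n id). Qed.

Lemma measurable_tuple_consl n (t : n.-tuple T) :
  measurable_fun [set: T] (fun x => tuple_cons (x, t)).
Proof. exact: (@measurable_cons _ _ _ _ id n (cst t)). Qed.

Lemma tnth_cons0 n (x : T) (t : n.-tuple T) : tnth (tuple_cons (x, t)) ord0 = x.
Proof. by []. Qed.

Lemma tnth_consS n (x : T) (t : n.-tuple T) i :
  tnth (tuple_cons (x, t)) (lift ord0 i) = tnth t i.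
Proof. by rewrite /tuple_cons tnthS. Qed.

Definition upd n (x : n.-tuple T) (i : 'I_n) (t : T) : n.-tuple T :=
  [tuple if j == i then t else tnth x j | j < n].

Lemma tnth_upd n (x : n.-tuple T) i t j :
  tnth (upd x i t) j = if j == i then t else tnth x j.
Proof. by rewrite tnth_mktuple. Qed.

Lemma upd_cons0 n (x : T) (t : n.-tuple T) s :
  upd (tuple_cons (x, t)) ord0 s = tuple_cons (s, t).
Proof.
apply: eq_from_tnth => j; rewrite tnth_upd.
by case: (unliftP ord0 j) => [k|] ->; rewrite ?eqxx ?tnth_cons0 //= !tnth_consS.
Qed.

Lemma upd_consS n (x : T) (t : n.-tuple T) i s :
  upd (tuple_cons (x, t)) (lift ord0 i) s = tuple_cons (x, upd t i s).
Proof.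
apply: eq_from_tnth => j; rewrite tnth_upd.
case: (unliftP ord0 j) => [k|] ->; last by rewrite !tnth_cons0.
by rewrite (inj_eq lift_inj) !tnth_consS tnth_upd.
Qed.

Lemma measurable_upd n (i : 'I_n) :
  measurable_fun [set: _] (fun z : n.-tuple T * T => upd z.1 i z.2).
Proof.
apply/measurable_fun_tnthP => j /=.
rewrite (_ : _ \o _ = fun z : n.-tuple T * T => if j == i then z.2 else tnth z.1 j).
  case: (j == i); first exact: measurable_snd.
  exact: ((measurable_fun_tnthP (fun z : n.-tuple T * T => z.1)).1 measurable_fst j).
by apply/funext => z /=; rewrite tnth_upd.
Qed.

Lemma measurable_updr n (x : n.-tuple T) (i : 'I_n) :
  measurable_fun [set: _] (upd x i).
Proof.
apply/measurable_fun_tnthP => j /=.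
rewrite (_ : _ \o _ = fun t => if j == i then t else tnth x j).
  by case: (j == i).
by apply/funext => t /=; rewrite tnth_upd.
Qed.

Lemma measurable_upd_inner n (i : 'I_n) (f : n.-tuple T -> \bar R) :
  measurable_fun [set: _] f -> (forall x, 0 <= f x) ->
  measurable_fun [set: _] (fun x => \int[P]_t f (upd x i t)).
Proof.
move=> mf f0.
apply: (measurable_fun_fubini_tonelli_F
  (fun z : n.-tuple T * T => f (upd z.1 i z.2))) => //.
by apply: measurableT_comp => //; exact: measurable_upd.
Qed.

(** For the first coordinate this is Tonelli and a dummy integral; the others follow by peeling. It
    lets a one-dimensional identity act on a chosen coordinate while the rest is frozen. *)
Lemma integral_iid_resample n (i : 'I_n) (f : n.-tuple T -> \bar R) :
  measurable_fun [set: _] f -> (forall x, 0 <= f x) ->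
  \int[iid P n]_x f x = \int[iid P n]_x \int[P]_t f (upd x i t).
Proof.
elim: n i f => [[]//|n IH] i f mf f0.
have mI := measurable_upd_inner i mf f0.
have I0 x : 0 <= \int[P]_t f (upd x i t) by apply: integral_ge0.
rewrite (integral_iidS mf f0) [RHS](integral_iidS mI I0).
case: (unliftP ord0 i) => [j|] Ei.
  apply: eq_integral => x _.
  have mfx : measurable_fun [set: n.-tuple T] (fun t => f (tuple_cons (x, t))).
    by apply: (measurableT_comp mf); exact: measurable_tuple_consr.
  rewrite (IH j _ mfx (fun t => f0 _)).
  apply: eq_integral => t _; apply: eq_integral => s _.
  by rewrite Ei upd_consS.
transitivity (\int[P]_x \int[iid P n]_t \int[P]_s f (tuple_cons (s, t))); last first.
  apply: eq_integral => x _; apply: eq_integral => t _; apply: eq_integral => s _.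
  by rewrite Ei upd_cons0.
rewrite [RHS]integral_cst//= probability_setT mule1.
rewrite (fubini_tonelli (fun z : T * n.-tuple T => f (tuple_cons z)))//.
by apply: measurableT_comp => //; exact: measurable_tuple_cons.
Qed.

Lemma measurable_prod_tnth n (g : T -> R) : measurable_fun [set: T] g ->
  measurable_fun [set: n.-tuple T] (fun x => (\prod_i g (tnth x i))%R).
Proof.
move=> mg; apply: measurable_prod => i _.
by apply: measurableT_comp => //; exact: measurable_tnth.
Qed.

Lemma prod_tnth_cons n (g : T -> R) x (t : n.-tuple T) :
  (\prod_i g (tnth (tuple_cons (x, t)) i) = g x * \prod_i g (tnth t i))%R.
Proof.
rewrite big_ord_recl tnth_cons0; congr (_ * _)%R.
by apply: eq_bigr => i _; rewrite tnth_consS.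
Qed.

Lemma integral_iid_prod_le n (g : T -> R) (c : R) : measurable_fun [set: T] g ->
  (forall x, (0 <= g x)%R) -> (0 <= c)%R -> \int[P]_x (g x)%:E <= c%:E ->
  \int[iid P n]_x (\prod_i g (tnth x i))%:E <= (c ^+ n)%:E.
Proof.
move=> mg g0 c0 gc; elim: n => [|n IH].
  rewrite integral_iid0; last by apply/measurable_EFinP; exact: measurable_prod_tnth.
  by rewrite big_ord0.
have mgn k := @measurable_prod_tnth k g mg.
have g0n k (x : k.-tuple T) : (0 <= \prod_i g (tnth x i))%R by apply: prodr_ge0.
rewrite integral_iidS//; last 2 first.
- by apply/measurable_EFinP; exact: measurable_prod_tnth.
- by move=> x; rewrite lee_fin.
under eq_integral => x _.
  under eq_integral => t _ do rewrite prod_tnth_cons EFinM.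
  rewrite ge0_integralZl//; last 3 first.
  - by apply/measurable_EFinP; exact: measurable_prod_tnth.
  - by move=> t _; rewrite lee_fin.
  - by rewrite lee_fin.
  rewrite muleC; over.
rewrite ge0_integralZl//; last 3 first.
- exact/measurable_EFinP.
- by move=> t _; rewrite lee_fin.
- by apply: integral_ge0 => t _; rewrite lee_fin.
rewrite exprS EFinM muleC lee_pmul//.
- by apply: integral_ge0 => t _; rewrite lee_fin.
- by apply: integral_ge0 => t _; rewrite lee_fin.
Qed.

End iid_integral.

Section iid_density.
Context {R : realType} {d : measure_display} {T : measurableType d}.
Local Open Scope ereal_scope.

Lemma has_density_iid (P Q : probability T R) p n : has_density P Q p ->
  has_density (iid P n) (iid Q n) (fun x => (\prod_i p (tnth x i))%R).
Proof.
move=> [mp p0 PQ]; split.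
- exact: measurable_prod_tnth.
- by move=> x; apply: prodr_ge0.
elim: n => [|n IH] f mf f0.
  rewrite !integral_iid0 ?big_ord0 ?mule1//.
  apply: emeasurable_funM => //; by apply/measurable_EFinP; exact: measurable_prod_tnth.
have mfp : measurable_fun [set: n.+1.-tuple T]
    (fun x => f x * (\prod_i p (tnth x i))%:E).
  by apply: emeasurable_funM => //; by apply/measurable_EFinP; exact: measurable_prod_tnth.
have fp0 k (x : k.-tuple T) : 0 <= (\prod_i p (tnth x i))%:E.
  by rewrite lee_fin; apply: prodr_ge0.
rewrite integral_iidS// [RHS]integral_iidS//; last first.
  by move=> x; rewrite mule_ge0.
have mfc x : measurable_fun [set: n.-tuple T] (fun t => f (tuple_cons (x, t))).
  by apply: measurableT_comp => //; exact: measurable_tuple_consr.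
rewrite PQ; last 2 first.
- exact: measurable_iid_inner.
- by move=> x; apply: integral_ge0.
apply: eq_integral => x _.
rewrite IH// -ge0_integralZr//; last 3 first.
- by apply: emeasurable_funM => //; by apply/measurable_EFinP; exact: measurable_prod_tnth.
- by move=> t _; rewrite mule_ge0.
- by rewrite lee_fin.
apply: eq_integral => t _.
by rewrite prod_tnth_cons EFinM -muleA; congr (_ * _); rewrite muleC.
Qed.

End iid_density.

(** * The standard normal law *)

Lemma measurable_fun_expR {R : realType} {d} {T : measurableType d} (f : T -> R) :
  measurable_fun [set: T] f -> measurable_fun [set: T] (fun x => expR (f x)).
Proof. by move=> mf; apply: measurableT_comp. Qed.

Lemma measurable_fun_normr {R : realType} {d} {T : measurableType d} (f : T -> R) :
  measurable_fun [set: T] f -> measurable_fun [set: T] (fun x => `|f x|).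
Proof. by move=> mf; apply: measurableT_comp. Qed.

Lemma measurable_fun_oppr {R : realType} {d} {T : measurableType d} (f : T -> R) :
  measurable_fun [set: T] f -> measurable_fun [set: T] (fun x => - f x).
Proof. by move=> mf; apply: measurableT_comp. Qed.

Ltac meas :=
  repeat first
    [ by []
    | exact: measurable_cst
    | exact: measurable_id
    | apply: measurable_funD
    | apply: measurable_funB
    | apply: measurable_funM
    | apply: measurable_funX
    | apply: measurable_fun_expR
    | apply: measurable_fun_normr
    | apply: measurable_fun_oppr
    | exact: measurable_tnth
    | apply: measurable_sum => ? ].

Ltac nneg := move=> *; repeat first
  [ by [] | exact: sqr_ge0 | exact: expR_ge0 | exact: normr_ge0
  | apply: addr_ge0 | apply: mulr_ge0 | apply: prodr_ge0 | apply: sumr_ge0 => * ].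

Ltac side := try solve [ by [] | by meas | by nneg ].

Section real_integral.
Context {R : realType} {d : measure_display} {T : measurableType d}.
Variable P : probability T R.
Local Open Scope ereal_scope.

Lemma le_integralr (f g : T -> R) :
  measurable_fun [set: T] f -> measurable_fun [set: T] g ->
  (forall x, (0 <= f x)%R) -> (forall x, (f x <= g x)%R) ->
  \int[P]_x (f x)%:E <= \int[P]_x (g x)%:E.
Proof.
move=> mf mg f0 fg; apply: ge0_le_integral => //.
- by move=> x _; rewrite lee_fin.
- exact/measurable_EFinP.
- exact/measurable_EFinP.
- by move=> x _; rewrite lee_fin.
Qed.

Lemma integralDr (f g : T -> R) :
  measurable_fun [set: T] f -> measurable_fun [set: T] g ->
  (forall x, (0 <= f x)%R) -> (forall x, (0 <= g x)%R) ->
  \int[P]_x (f x + g x)%:E = \int[P]_x (f x)%:E + \int[P]_x (g x)%:E.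
Proof.
move=> mf mg f0 g0; under eq_integral do rewrite EFinD.
rewrite ge0_integralD//.
- by move=> x _; rewrite lee_fin.
- exact/measurable_EFinP.
- by move=> x _; rewrite lee_fin.
- exact/measurable_EFinP.
Qed.

Lemma integralZr_nneg (c : R) (f : T -> R) :
  measurable_fun [set: T] f -> (0 <= c)%R -> (forall x, (0 <= f x)%R) ->
  \int[P]_x (c * f x)%:E = c%:E * \int[P]_x (f x)%:E.
Proof.
move=> mf c0 f0; under eq_integral do rewrite EFinM.
rewrite ge0_integralZl//; first exact/measurable_EFinP.
by move=> x _; rewrite lee_fin.
Qed.

Lemma integral_cstr (c : R) : \int[P]_x c%:E = c%:E.
Proof. by rewrite integral_cst//= probability_setT mule1. Qed.

Lemma integralr_ge0 (f : T -> R) : (forall x, (0 <= f x)%R) ->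
  0 <= \int[P]_x (f x)%:E.
Proof. by move=> f0; apply: integral_ge0 => x _; rewrite lee_fin. Qed.

End real_integral.

Section gauss1.
Context {R : realType}.
Local Notation gam := (normal_prob (0 : R) 1).
Local Notation leb := (@lebesgue_measure R).
Local Open Scope ereal_scope.

Lemma measurable_affine (s t : R) :
  measurable_fun [set: measurableTypeR R] (fun x : R => (s * x + t)%R : measurableTypeR R).
Proof. by apply: measurable_funD => //; apply: measurable_funM. Qed.

(** The push-forward of Lebesgue measure under the affine map, times [s], agrees with Lebesgue
    measure on half-open intervals, and these determine it. *)
Lemma lebesgue_measure_affine (s t : R) (A : set R) : (0 < s)%R ->
  measurable A ->
  leb A = s%:E * leb [set x | A (s * x + t)%R].
Proof.
move=> s0 mA.
pose phi : measurableTypeR R -> measurableTypeR R := fun x => (s * x + t)%R.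
have mphi : measurable_fun [set: measurableTypeR R] phi by exact: measurable_affine.
pose nu := pushforward leb phi.
pose HBm := measure_function_pushforward__canonical__measure_function_Measure leb mphi.
have s0' : (0 <= s)%R by exact: ltW.
pose mu' := mscale (NngNum s0') HBm.
have := @lebesgue_measure_unique R mu' _ A mA.
rewrite /mu' /mscale/= /pushforward; apply=> X [[a b]] _ <-.
rewrite /mscale/= /pushforward.
have -> : phi @^-1` `]a, b] = `]((a - t) / s)%R, ((b - t) / s)%R]%classic.
  apply/seteqP; split => x /=; rewrite !in_itv/= /phi.
    by rewrite ltr_pdivrMr// ler_pdivlMr// ltrBlDr lerBrDr [(x * s)%R]mulrC.
  by rewrite ltr_pdivrMr// ler_pdivlMr// ltrBlDr lerBrDr [(x * s)%R]mulrC.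
rewrite !lebesgue_measure_itv/= !lte_fin ltr_pM2r ?invr_gt0// ltrD2r.
case: ifPn => _; rewrite ?mule0// -!EFinB -EFinM; congr EFin.
by rewrite -mulrBl mulrCA divff ?gt_eqF// mulr1; ring.
Qed.

Lemma ge0_integral_lebesgue_affine (s t : R) (f : R -> \bar R) : (0 < s)%R ->
  measurable_fun [set: R] f -> (forall x, 0 <= f x) ->
  \int[leb]_x f x = s%:E * \int[leb]_x f (s * x + t)%R.
Proof.
move=> s0 mf f0.
pose phi : measurableTypeR R -> measurableTypeR R := fun x => (s * x + t)%R.
have mphi : measurable_fun [set: measurableTypeR R] phi by exact: measurable_affine.
pose HBm := measure_function_pushforward__canonical__measure_function_Measure leb mphi.
have s0' : (0 <= s)%R by exact: ltW.
rewrite (eq_measure_integral (mscale (NngNum s0') HBm)); last first.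
  move=> A mA _; rewrite /= /mscale/= /pushforward.
  exact: lebesgue_measure_affine.
rewrite ge0_integral_mscale//=.
by rewrite ge0_integral_pushforward.
Qed.

Lemma ge0_integral_normal (f : R -> \bar R) :
  measurable_fun [set: R] f -> (forall x, 0 <= f x) ->
  \int[gam]_x f x = \int[leb]_x (f x * (normal_pdf 0 1 x)%:E).
Proof.
move=> mf f0; apply: ge0_integral_density => //.
- exact: measurable_normal_pdf.
- by move=> x; exact: normal_pdf_ge0.
Qed.

(** Substitution in the Lebesgue integral. The extra factor is the density of [s g + t] relative to
    the law of [g] itself. *)
Lemma gauss_affine (s t : R) (f : R -> \bar R) : (0 < s)%R ->
  measurable_fun [set: R] f -> (forall x, 0 <= f x) ->
  \int[gam]_x f (s * x + t)%R =
  \int[gam]_x (f x * (s^-1 * expR (x ^+ 2 / 2 - ((x - t) / s) ^+ 2 / 2))%:E).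
Proof.
move=> s0 mf f0.
have sN0 : s != 0%R by rewrite gt_eqF.
rewrite ge0_integral_normal//; last first.
  by apply: (measurableT_comp mf); exact: measurable_affine.
have mp : measurable_fun [set: R] (fun x : R =>
    (s^-1 * expR (x ^+ 2 / 2 - ((x - t) / s) ^+ 2 / 2))%R) by meas.
have p0 (x : R) : (0 <= s^-1 * expR (x ^+ 2 / 2 - ((x - t) / s) ^+ 2 / 2))%R.
  by rewrite mulr_ge0 ?invr_ge0 ?expR_ge0// ltW.
have mpdf := measurable_normal_pdf (0 : R) (1 : R).
have pdf0 := @normal_pdf_ge0 R (0 : R) (1 : R).
rewrite ge0_integral_normal//; last 2 first.
- by apply: emeasurable_funM => //; exact/measurable_EFinP.
- by move=> x; rewrite mule_ge0 ?lee_fin.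
rewrite [RHS](ge0_integral_lebesgue_affine t s0)//; last 2 first.
- by apply: emeasurable_funM; [apply: emeasurable_funM => //|]; exact/measurable_EFinP.
- by move=> x; rewrite !mule_ge0 ?lee_fin.
rewrite -ge0_integralZl//; last 3 first.
- apply: emeasurable_funM; [apply: emeasurable_funM|].
  + by apply: (measurableT_comp mf); exact: measurable_affine.
  + by apply/measurable_EFinP; apply: (measurableT_comp mp); exact: measurable_affine.
  + by apply/measurable_EFinP; apply: (measurableT_comp mpdf); exact: measurable_affine.
- by move=> x _; rewrite !mule_ge0 ?lee_fin.
- by rewrite lee_fin ltW.
apply: eq_integral => x _.
rewrite -!muleA [RHS]muleCA; congr (_ * _); rewrite -!EFinM; congr EFin.
rewrite !normal_pdfE ?oner_eq0// /normal_fun !subr0 expr1n.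
rewrite (_ : (s * x + t - t) / s = x)%R; last by rewrite addrK mulrC mulKf.
rewrite -!mulrA mulVKf// [RHS]mulrCA; congr (_ * _)%R.
by rewrite -expRD; congr expR; field.
Qed.

(** The density of [gauss_affine] for [s = 1], [t = a] has total mass 1, and its exponent is
    [a x - a^2 / 2]. The case [t = 0] gives [gauss_sq_mgf] in the same way. *)
Lemma gauss_mgf (a : R) : \int[gam]_x (expR (a * x))%:E = (expR (a ^+ 2 / 2))%:E.
Proof.
have := @gauss_affine 1 a (fun=> 1) ltr01 _ _.
move=> /(_ (measurable_cst _) (fun=> lee01)).
rewrite integral_cst//= probability_setT mule1 => E.
rewrite -[RHS]mule1 [X in _ * X]E -ge0_integralZl; [|by []| | |]; last 3 first.
- by apply: emeasurable_funM => //; apply/measurable_EFinP; meas.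
- by move=> x _; rewrite mul1e lee_fin mulr_ge0 ?expR_ge0// invr_ge0.
- by rewrite lee_fin expR_ge0.
apply: eq_integral => x _; rewrite mul1e -EFinM; congr EFin.
by rewrite invr1 mul1r -expRD; congr expR; field.
Qed.

Lemma gauss_sq_mgf (s : R) : (0 < s)%R ->
  \int[gam]_x (expR ((1 - s ^- 2) / 2 * x ^+ 2))%:E = s%:E.
Proof.
move=> s0; have := @gauss_affine s 0 (fun=> 1) s0 _ _.
move=> /(_ (measurable_cst _) (fun=> lee01)).
rewrite integral_cst//= probability_setT mule1 => E.
rewrite -[RHS]mule1 [X in _ * X]E -ge0_integralZl//=; last 3 first.
- by apply: emeasurable_funM => //; apply/measurable_EFinP; meas.
- by move=> x _; rewrite mul1e lee_fin mulr_ge0 ?expR_ge0// invr_ge0 ltW.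
- by rewrite lee_fin ltW.
apply: eq_integral => x _; rewrite mul1e -EFinM; congr EFin.
rewrite mulVKf ?gt_eqF//; congr expR; rewrite subr0.
by field; rewrite gt_eqF.
Qed.

(** Since [1 + y <= e^y], the choice [q^2 = 2] in [gauss_sq_mgf] gives [x^2 + 4 <= 4 e^(x^2 / 4)],
    whose right-hand side has integral [4 q <= 6]. *)
Lemma gauss_sq_moment_le : \int[gam]_x (x ^+ 2)%:E <= 2%:E.
Proof.
pose q : R := Num.sqrt 2.
have q2 : (q ^+ 2 = 2)%R by rewrite sqr_sqrtr.
have q0 : (0 < q)%R by rewrite sqrtr_gt0.
have q32 : (q <= 3/2)%R by rewrite -ler_sqr ?nnegrE ?ltW// q2; lra.
have E := gauss_sq_mgf q0.
have h x : (x ^+ 2 + 4 <= 4 * expR ((1 - q ^- 2) / 2 * x ^+ 2))%R.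
  have := expR_ge1Dx ((1 - q ^- 2) / 2 * x ^+ 2).
  by rewrite -exprVn exprVn q2; lra.
have : \int[gam]_x (x ^+ 2 + 4)%:E <= 6%:E.
  apply: (@le_trans _ _ (\int[gam]_x (4 * expR ((1 - q ^- 2) / 2 * x ^+ 2))%:E)).
    apply: le_integralr; side.
  rewrite integralZr_nneg; side.
  by rewrite E -EFinM lee_fin; lra.
rewrite integralDr; side.
rewrite integral_cstr.
have : 0 <= \int[gam]_x (x ^+ 2)%:E.
  by apply: integralr_ge0 => x; exact: sqr_ge0.
case: (\int[gam]_x _) => [r| |]//=; rewrite -?EFinD ?lee_fin//.
by move=> *; lra.
Qed.

(** Here [q^2 = 1/2], so that [2 <= x^2 + 2 e^(- x^2 / 2)], where the exponential contributes
    [2 q <= 3/2]. *)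
Lemma gauss_sq_moment_ge : (2^-1)%:E <= \int[gam]_x (x ^+ 2)%:E.
Proof.
pose q : R := ((Num.sqrt 2)^-1)%R.
have q2 : (q ^+ 2 = 2^-1)%R by rewrite exprVn sqr_sqrtr.
have q0 : (0 < q)%R by rewrite invr_gt0 sqrtr_gt0.
have q32 : (q <= 3/4)%R by rewrite -ler_sqr ?nnegrE ?ltW// q2; lra.
have E := gauss_sq_mgf q0.
have h x : (2 <= x ^+ 2 + 2 * expR ((1 - q ^- 2) / 2 * x ^+ 2))%R.
  have := expR_ge1Dx ((1 - q ^- 2) / 2 * x ^+ 2).
  by rewrite q2 invrK; lra.
have : 2%:E <= \int[gam]_x (x ^+ 2 + 2 * expR ((1 - q ^- 2) / 2 * x ^+ 2))%:E.
  by rewrite -(integral_cstr gam); apply: le_integralr => //; meas.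
rewrite integralDr; side.
rewrite integralZr_nneg; side.
rewrite E; case: (\int[gam]_x _) => [r| |]//=; rewrite -?EFinM -?EFinD ?lee_fin//.
  by move=> *; lra.
by move=> _; rewrite leey.
Qed.

Lemma gauss_abs_moment_le : \int[gam]_x (`|x|)%:E <= (3 / 2)%:E.
Proof.
apply: (@le_trans _ _ (\int[gam]_x (2^-1 + 2^-1 * x ^+ 2)%:E)).
  apply: le_integralr; side.
  move=> y; suff h (x : R) : (`|x| <= 2^-1 + 2^-1 * x ^+ 2)%R by exact: h.
  have := sqr_ge0 (`|x| - 1)%R; rewrite -[(x ^+ 2)%R]real_normK ?num_real// => h.
  by nra.
rewrite integralDr; side.
rewrite integral_cstr integralZr_nneg; side.
rewrite (_ : (3 / 2)%:E = (2^-1)%:E + (2^-1)%:E * 2%:E); last first.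
  by rewrite -EFinM -EFinD; congr EFin; lra.
by rewrite leeD2l// lee_wpmul2l ?gauss_sq_moment_le// lee_fin.
Qed.

(* The total variation distance is at most the mean of the absolute value of
   the log-density, since [1 - e^q <= |q|]. *)
Lemma gauss_affine_tv (s t : R) (f : R -> R) : (2^-1 <= s <= 2)%R ->
  measurable_fun [set: R] f -> (forall x, (0 <= f x <= 1)%R) ->
  \int[gam]_x (f x)%:E <=
  \int[gam]_x (f (s * x + t)%R)%:E + (14 * `|s - 1| + 8 * `|t|)%:E.
Proof.
move=> /andP[s1 s2] mf f01.
have s0 : (0 < s)%R by lra.
have f0 x : (0 <= f x)%R by case/andP: (f01 x).
have f1 x : (f x <= 1)%R by case/andP: (f01 x).
(* For [|t| >= 1] the error term exceeds 1. In the other case [t^2 <= |t|], which is used to bound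
   [q]. *)
have [t1|t1] := leP 1%R `|t|%R.
  apply: (@le_trans _ _ 1).
    by rewrite -(integral_cstr gam); apply: le_integralr.
  apply: (@le_trans _ _ (14 * `|s - 1| + 8 * `|t|)%:E).
    by rewrite lee_fin; have := normr_ge0 (s - 1)%R; lra.
  by rewrite leeDr//; apply: integralr_ge0.
rewrite (@gauss_affine s t (fun x => (f x)%:E))//; last exact/measurable_EFinP.
pose q (x : R) : R := (x ^+ 2 / 2 - ((x - t) / s) ^+ 2 / 2 - ln s)%R.
pose b (x : R) : R := (2 * `|s - 1| + 6 * `|s - 1| * x ^+ 2 + 4 * `|t| * `|x| + 2 * `|t|)%R.
have sV : (s^-1 <= 2)%R by rewrite invf_ple ?posrE// ltr0n.
have sV0 : (0 < s^-1)%R by rewrite invr_gt0.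
have lns : (`|ln s| <= 2 * `|s - 1|)%R.
  have h1 : (ln s <= s - 1)%R by have := le_ln1Dx (x := s - 1)%R; rewrite addrCA subrr addr0; apply; lra.
  have h2 : (- ln s <= s^-1 - 1)%R.
    rewrite -lnV ?posrE//.
    by have := le_ln1Dx (x := s^-1 - 1)%R; rewrite addrCA subrr addr0; apply; lra.
  have h3 : (s^-1 - 1 = (1 - s) * s^-1)%R by rewrite mulrBl mul1r divff ?gt_eqF.
  have : (`|s^-1 - 1| <= 2 * `|s - 1|)%R.
    rewrite h3 normrM distrC mulrC ler_wpM2r// gtr0_norm//.
  have := ler_norm (s - 1); have := ler_norm (s^-1 - 1)%R.
  by move=> *; rewrite ler_norml; apply/andP; split; lra.
have qb x : (`|q x| <= b x)%R.
  have -> : (q x = (1 - s^-1 ^+ 2) / 2 * x ^+ 2 + t * x * s^-1 ^+ 2 - (t * s^-1) ^+ 2 / 2 - ln s)%R.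
    by rewrite /q; field; rewrite gt_eqF.
  have a1 : (`|1 - s^-1 ^+ 2| <= 12 * `|s - 1|)%R.
    have -> : (1 - s^-1 ^+ 2 = (s - 1) * ((s + 1) * s^-1 ^+ 2))%R by field; rewrite gt_eqF.
    rewrite normrM mulrC ler_wpM2r// ger0_norm; last by rewrite mulr_ge0 ?sqr_ge0//; lra.
    have : (s^-1 ^+ 2 <= 4)%R by rewrite expr2; nra.
    by have := sqr_ge0 s^-1; nra.
  have a2 : (s^-1 ^+ 2 <= 4)%R by rewrite expr2; nra.
  have a2' := sqr_ge0 s^-1.
  have a3 : (`|t * x * s^-1 ^+ 2| <= 4 * `|t| * `|x|)%R.
    rewrite normrM (ger0_norm a2') normrM.
    by have := mulr_ge0 (normr_ge0 t) (normr_ge0 x); nra.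
  have a4 : (`|(t * s^-1) ^+ 2 / 2| <= 2 * `|t|)%R.
    rewrite ger0_norm; last by rewrite mulr_ge0 ?sqr_ge0.
    rewrite exprMn -[(t ^+ 2)%R]real_normK ?num_real//.
    have : (`|t| ^+ 2 <= `|t|)%R by rewrite expr2 ler_piMr// ltW.
    have := sqr_ge0 `|t|%R; nra.
  have a5 : (`|(1 - s^-1 ^+ 2) / 2 * x ^+ 2| <= 6 * `|s - 1| * x ^+ 2)%R.
    rewrite normrM (ger0_norm (sqr_ge0 x)) ler_wpM2r ?sqr_ge0//.
    by rewrite normrM (ger0_norm (x := 2^-1)) ?invr_ge0//; lra.
  rewrite /b; apply: le_trans (ler_normB _ _) _.
  apply: le_trans (lerD (ler_normB _ _) (lexx _)) _.
  apply: le_trans (lerD (lerD (ler_normD _ _) (lexx _)) (lexx _)) _.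
  by lra.
have pE x : (s^-1 * expR (x ^+ 2 / 2 - ((x - t) / s) ^+ 2 / 2) = expR (q x))%R.
  by rewrite /q [in RHS]expRD expRN lnK ?posrE// mulrC.
have mq : measurable_fun [set: R] q by rewrite /q; meas.
have mb : measurable_fun [set: R] b by rewrite /b; meas.
have b0 x : (0 <= b x)%R by exact: le_trans (normr_ge0 _) (qb x).
(* The constants are [14 = 2 + 6 * 2] and [8 = 4 * 3/2 + 2], from the moment bounds 2 for [x^2] and
   3/2 for [|x|]. *)
have bI : \int[gam]_x (b x)%:E <= (14 * `|s - 1| + 8 * `|t|)%:E.
  have -> : \int[gam]_x (b x)%:E = (2 * `|s - 1|)%:E + (6 * `|s - 1|)%:E * \int[gam]_x (x ^+ 2)%:E
     + (4 * `|t|)%:E * \int[gam]_x (`|x|)%:E + (2 * `|t|)%:E.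
    rewrite /b integralDr; side. rewrite integralDr; side. rewrite integralDr; side.
    by rewrite !integral_cstr integralZr_nneg; side; rewrite integralZr_nneg; side.
  apply: (@le_trans _ _ ((2 * `|s - 1|)%:E + (6 * `|s - 1|)%:E * 2%:E + (4 * `|t|)%:E * (3/2)%:E + (2 * `|t|)%:E)).
    rewrite leeD2r// leeD//; last by rewrite lee_wpmul2l ?gauss_abs_moment_le// lee_fin mulr_ge0.
    by rewrite leeD2l// lee_wpmul2l ?gauss_sq_moment_le// lee_fin mulr_ge0.
  by rewrite -!EFinM -!EFinD lee_fin; lra.
apply: (@le_trans _ _ (\int[gam]_x (f x * expR (q x) + b x)%:E)).
  apply: le_integralr => //; first by meas.
  move=> x; have h := expR_ge1Dx (q x); have := qb x; rewrite ler_norml => /andP[h1 h2].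
  have := expR_ge0 (q x); have := f0 x; have := f1 x; have := b0 x.
  move=> ? ? ? ?; have [h3|h3] := leP 1%R (expR (q x)); first by nra.
  by nra.
rewrite integralDr; side.
rewrite leeD//; apply: le_integralr; side.
by move=> x; rewrite pE.
Qed.

End gauss1.

(** * Lower bounds from a family of distributions *)

Section dp_transport.
Context {R : realType} {dY : measure_display} {Y : measurableType dY}.
Variables (P Q : probability Y R) (p : Y -> R) (e t : R) (y0 : Y).
Hypotheses (PQ : has_density P Q p) (e1 : 1 <= e) (t0 : 0 <= t).
Hypothesis pt : (\int[Q]_x (Num.max (p x - 1) 0)%:E <= t%:E)%E.
Local Open Scope ereal_scope.

(* With [a = inf f], pointwise [f p + a <= f + a p + (e - 1) a (p - 1)^+]. *)
Lemma dp_step (f : Y -> R) : measurable_fun [set: Y] f ->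
  (forall y, (0 <= f y)%R) -> (forall y y', (f y <= e * f y')%R) ->
  \int[P]_y (f y)%:E <= (1 + t * (e - 1))%:E * \int[Q]_y (f y)%:E.
Proof.
move=> mf f0 fe; have [mp p0 ->] := PQ; last 2 first.
- exact/measurable_EFinP.
- by move=> y; rewrite lee_fin.
pose a := inf (range f).
have lbf : has_lbound (range f) by exists 0%R => _ [y _ <-].
have af y : (a <= f y)%R by apply: ge_inf => //; exists y.
have a0 : (0 <= a)%R by apply: lb_le_inf; [by exists (f y0), y0|move=> _ [y _ <-]].
have e0 : (0 < e)%R by exact: lt_le_trans e1.
have fa y : (f y <= e * a)%R.
  rewrite mulrC -ler_pdivrMr//; apply: lb_le_inf; first by exists (f y0), y0.
  by move=> _ [y' _ <-]; rewrite ler_pdivrMr// mulrC.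
have mmx : measurable_fun [set: Y] (fun x => Num.max (p x - 1) 0)%R.
  by apply: measurable_maxr; meas.
have mx0 x : (0 <= Num.max (p x - 1) 0)%R by rewrite le_max lexx orbT.
have H : \int[Q]_y (f y * p y + a)%:E <=
    \int[Q]_y (f y + (a * p y + (e - 1) * a * Num.max (p y - 1) 0))%:E.
  apply: le_integralr; side.
  move=> y; have := af y; have := fa y; have := p0 y.
  by case: (leP (p y - 1)%R 0%R) => ? ? ? ?; nra.
have e10 : (0 <= (e - 1) * a)%R by rewrite mulr_ge0 ?subr_ge0.
move: H; rewrite integralDr; side.
rewrite integralDr; side.
rewrite integralDr; side.
rewrite integral_cstr integralZr_nneg; side.
rewrite integralZr_nneg; side.
rewrite (density_integral1 PQ) mule1 addeCA [_ + a%:E]addeC leeD2lE// => H.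
under eq_integral do rewrite -EFinM.
apply: (le_trans H); rewrite EFinD ge0_muleDl ?lee_fin ?mulr_ge0 ?subr_ge0//.
rewrite mul1e leeD2l//.
apply: (@le_trans _ _ (((e - 1) * a)%:E * t%:E)).
  by rewrite lee_wpmul2l// lee_fin.
rewrite -EFinM (_ : (e - 1) * a * t = t * (e - 1) * a)%R; last by ring.
rewrite EFinM lee_wpmul2l ?lee_fin ?mulr_ge0 ?subr_ge0//.
by rewrite -(integral_cstr Q a); apply: le_integralr.
Qed.

(** The users are exchanged one at a time, each by [dp_step] with the others fixed. For [t = 1] the
    factor is [e^n], ordinary group privacy; smaller values of [t] improve it, and this is the
    origin of the second term of the rate. *)
Lemma dp_transport n (f : n.-tuple Y -> R) : measurable_fun [set: _] f ->
  (forall y, (0 <= f y)%R) ->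
  (forall x x' : n.-tuple Y,
     (exists i : 'I_n, forall j, j != i -> tnth x j = tnth x' j) ->
     (f x <= e * f x')%R) ->
  \int[iid P n]_x (f x)%:E <= ((1 + t * (e - 1)) ^+ n)%:E * \int[iid Q n]_x (f x)%:E.
Proof.
set c := (1 + t * (e - 1))%R; have c0 : (0 <= c)%R.
  by rewrite addr_ge0// mulr_ge0// subr_ge0.
elim: n f => [|n IH] f mf f0 fe.
  by rewrite expr0 mul1e !integral_iid0//; exact/measurable_EFinP.
have mE : measurable_fun [set: _] (EFin \o f) by exact/measurable_EFinP.
have E0 x : 0 <= (EFin \o f) x by rewrite lee_fin.
rewrite !(@integral_iidS _ _ _ _ n (EFin \o f))//=.
have mfc : measurable_fun [set: Y * n.-tuple Y] (fun z => (f (tuple_cons z))%:E).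
  by apply/measurable_EFinP/(measurableT_comp mf); exact: measurable_tuple_cons.
apply: (@le_trans _ _ (\int[P]_x ((c ^+ n)%:E * \int[iid Q n]_t0 (f (tuple_cons (x, t0)))%:E))).
  apply: ge0_le_integral => //.
  - by move=> x _; apply: integralr_ge0.
  - exact: (measurable_iid_inner P mE E0).
  - by apply: emeasurable_funM => //; exact: (measurable_iid_inner Q mE E0).
  move=> x _; apply: IH => //.
    by apply: (measurableT_comp mf); exact: measurable_tuple_consr.
  move=> u v [i uv]; apply: fe; exists (lift ord0 i) => j.
  case: (unliftP ord0 j) => [k|] ->; rewrite ?tnth_cons0// !tnth_consS.
  by rewrite (inj_eq lift_inj) => /uv.
rewrite ge0_integralZl//; last 3 first.
- exact: (measurable_iid_inner Q mE E0).
- by move=> x _; apply: integralr_ge0.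
- by rewrite lee_fin exprn_ge0.
rewrite exprSr EFinM -muleA lee_wpmul2l ?lee_fin ?exprn_ge0//.
(* Tonelli moves the first user to the inner integral, so that [dp_step] acts on it for each fixed
   choice of the others. *)
rewrite (fubini_tonelli (fun z => (f (tuple_cons z))%:E))//; last first.
  by move=> z; rewrite lee_fin.
rewrite [X in _ <= _ * X](fubini_tonelli (fun z => (f (tuple_cons z))%:E))//; last first.
  by move=> z; rewrite lee_fin.
have mG (M : probability Y R) : measurable_fun [set: n.-tuple Y]
    (fun s => \int[M]_x (f (tuple_cons (x, s)))%:E).
  apply: (measurable_fun_fubini_tonelli_G (fun z => (f (tuple_cons z))%:E)) => //.
  by move=> z; rewrite lee_fin.
rewrite -ge0_integralZl//; last 2 first.
- exact: mG.
- by move=> x _; apply: integralr_ge0.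
apply: ge0_le_integral => //.
- by move=> x _; apply: integralr_ge0.
- exact: mG.
- by apply: emeasurable_funM => //; exact: mG.
move=> s _; apply: dp_step => //.
  by apply: (measurableT_comp mf); exact: measurable_tuple_consl.
move=> y y'; apply: fe; exists ord0 => j.
by case: (unliftP ord0 j) => [k|] ->; rewrite ?eqxx// !tnth_consS.
Qed.

End dp_transport.

Section second_moment.
Context {R : realType} {dY : measure_display} {Y : measurableType dY}.
Variables (P Q : probability Y R) (p : Y -> R).
Hypothesis PQ : has_density P Q p.
Local Open Scope ereal_scope.

Lemma density_pos_part_le1 : \int[Q]_x (Num.max (p x - 1) 0)%:E <= 1.
Proof.
have [mp p0 _] := PQ; rewrite -(density_integral1 PQ); apply: le_integralr => //.
- by apply: measurable_maxr; meas.
- by move=> x; rewrite le_max lexx orbT.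
- by move=> x; rewrite ge_max p0 andbT; lra.
Qed.

Lemma density_sq_dev (X : R) : \int[Q]_x (p x ^+ 2)%:E <= X%:E ->
  \int[Q]_x ((p x - 1) ^+ 2)%:E <= (X - 1)%:E.
Proof.
have [mp p0 _] := PQ => pX.
have : \int[Q]_x ((p x - 1) ^+ 2 + 2 * p x)%:E <= (X + 1)%:E.
  have -> : \int[Q]_x ((p x - 1) ^+ 2 + 2 * p x)%:E = \int[Q]_x (p x ^+ 2 + 1)%:E.
    by apply: eq_integral => x _; congr EFin; ring.
  rewrite integralDr; side.
  by rewrite integral_cstr EFinD leeD2r.
rewrite integralDr; side.
rewrite integralZr_nneg; side.
rewrite (density_integral1 PQ) mule1.
have : 0 <= \int[Q]_x ((p x - 1) ^+ 2)%:E by apply: integralr_ge0; nneg.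
case: (\int[Q]_x _) => [r| |]//=; rewrite -?EFinD ?lee_fin//.
by move=> *; lra.
Qed.

(** Cauchy-Schwarz written pointwise: [(p - 1)^+ <= l / 2 + (p - 1)^2 / (2 l)], with the optimal
    [l = sqrt (X - 1)]. *)
Lemma density_pos_part_le_sqrt (X : R) : (1 < X)%R ->
  \int[Q]_x (p x ^+ 2)%:E <= X%:E ->
  \int[Q]_x (Num.max (p x - 1) 0)%:E <= (Num.sqrt (X - 1))%:E.
Proof.
have [mp p0 _] := PQ => X1 /density_sq_dev pX.
pose l := Num.sqrt (X - 1); have l0 : (0 < l)%R by rewrite sqrtr_gt0 subr_gt0.
have l2 : (l ^+ 2 = X - 1)%R by rewrite sqr_sqrtr// subr_ge0 ltW.
apply: (@le_trans _ _ (\int[Q]_x (l / 2 + (2 * l)^-1 * (p x - 1) ^+ 2)%:E)).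
  apply: le_integralr; side.
  - by apply: measurable_maxr; meas.
  - by move=> x; rewrite le_max lexx orbT.
  move=> x; have -> : (l / 2 + (2 * l)^-1 * (p x - 1) ^+ 2 =
     (p x - 1) + (2 * l)^-1 * (p x - 1 - l) ^+ 2)%R by field; rewrite gt_eqF.
  have h : (0 <= (2 * l)^-1)%R by rewrite invr_ge0 mulr_ge0// ltW.
  have := sqr_ge0 (p x - 1 - l)%R => h'.
  rewrite ge_max; apply/andP; split; first by rewrite lerDl mulr_ge0.
  have -> : ((p x - 1) + (2 * l)^-1 * (p x - 1 - l) ^+ 2 =
     l / 2 + (2 * l)^-1 * (p x - 1) ^+ 2)%R by field; rewrite gt_eqF.
  by apply: addr_ge0; [rewrite divr_ge0// ltW|rewrite mulr_ge0// sqr_ge0].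
have h : (0 <= (2 * l)^-1)%R by rewrite invr_ge0 mulr_ge0// ltW.
have hl : (0 <= l / 2)%R by rewrite divr_ge0// ltW.
rewrite integralDr; side.
rewrite integral_cstr integralZr_nneg; side.
apply: (@le_trans _ _ ((l / 2)%:E + ((2 * l)^-1)%:E * (X - 1)%:E)).
  by rewrite leeD2l// lee_wpmul2l// lee_fin.
rewrite -EFinM -EFinD lee_fin -/l -l2 le_eqVlt; apply/orP; left; apply/eqP.
by field; rewrite gt_eqF.
Qed.

(** Pointwise [f p <= l f^2 / 2 + p^2 / (2 l)], and [f^2 <= f]. Leaving [l] free keeps the bound
    linear in [f], so that it can be summed over a family. *)
Lemma density_amgm (X l : R) (f : Y -> R) : (0 < l)%R ->
  measurable_fun [set: Y] f -> (forall y, (0 <= f y <= 1)%R) ->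
  \int[Q]_x (p x ^+ 2)%:E <= X%:E ->
  \int[P]_x (f x)%:E <= (l / 2)%:E * \int[Q]_x (f x)%:E + (X / (2 * l))%:E.
Proof.
have [mp p0 PQf] := PQ => l0 mf f01 pX.
have f0 x : (0 <= f x)%R by case/andP: (f01 x).
rewrite PQf; last 2 first.
- exact/measurable_EFinP.
- by move=> y; rewrite lee_fin.
under eq_integral do rewrite -EFinM.
have h : (0 <= (2 * l)^-1)%R by rewrite invr_ge0 mulr_ge0// ltW.
have hl : (0 <= l / 2)%R by rewrite divr_ge0// ltW.
apply: (@le_trans _ _ (\int[Q]_x (l / 2 * f x + (2 * l)^-1 * p x ^+ 2)%:E)).
  apply: le_integralr; side.
  move=> x; case/andP: (f01 x) => f0x f1x.
  apply: (@le_trans _ _ (l / 2 * f x ^+ 2 + (2 * l)^-1 * p x ^+ 2)%R).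
    rewrite -subr_ge0 (_ : _ - _ = (2 * l)^-1 * (l * f x - p x) ^+ 2)%R; last first.
      by field; rewrite gt_eqF.
    by rewrite mulr_ge0 ?sqr_ge0.
  by rewrite lerD2r ler_wpM2l// expr2 ler_piMr.
rewrite integralDr; side.
rewrite integralZr_nneg; side.
rewrite integralZr_nneg; side.
by rewrite leeD2l// (mulrC X) EFinM lee_wpmul2l// lee_fin.
Qed.

Lemma density_iid_second_moment (X : R) n : (0 <= X)%R ->
  \int[Q]_x (p x ^+ 2)%:E <= X%:E ->
  \int[iid Q n]_x ((\prod_i p (tnth x i)) ^+ 2)%:E <= (X ^+ n)%:E.
Proof.
have [mp p0 _] := PQ => X0 pX.
under eq_integral do rewrite -prodrXl.
apply: (@integral_iid_prod_le _ _ _ Q n (fun y => p y ^+ 2)%R) => //; first by meas.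
by move=> x; exact: sqr_ge0.
Qed.

End second_moment.

(** * One algorithm against many hypotheses *)

Section family.
Context {R : realType} {dZ dO : measure_display}.
Context {Z : measurableType dZ} {O : measurableType dO}.
Variables (I : finType) (P : I -> probability Z R) (Q : probability Z R).
Variables (p : I -> Z -> R) (X : R) (z0 : Z).
Hypotheses (PQ : forall i, has_density (P i) Q (p i)) (X1 : 1 < X).
Hypothesis pX : forall i, (\int[Q]_x (p i x ^+ 2)%:E <= X%:E)%E.
Variables (n m : nat) (eps : R) (A : R.-pker n.-tuple (m.-tuple Z) ~> O).
Variables (G : I -> set O) (V : nat).
Hypothesis mG : forall i, measurable (G i).
Hypothesis GV : forall o, (\sum_(i : I) (o \in G i) <= V)%N.
Hypothesis AG : forall i,
  ((2 / 3)%:E <= \int[iid (iid (P i) m) n]_x A x (G i))%E.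
Local Open Scope ereal_scope.

Let f i x := fine (A x (G i)).

Let A_le1 x S : measurable S -> A x S <= 1.
Proof.
by move=> mS; have <- := prob_kernel (s:=A) x; apply: (@le_measure _ _ _ (A x)); rewrite ?inE.
Qed.

Let fE i x : A x (G i) = (f i x)%:E.
Proof.
rewrite fineK// ge0_fin_numE//; apply: (le_lt_trans (A_le1 x (mG i))).
exact: ltry.
Qed.

Let f01 i x : (0 <= f i x <= 1)%R.
Proof. by rewrite -!lee_fin -fE A_le1// measure_ge0. Qed.

Let mf i : measurable_fun [set: _] (f i).
Proof.
apply/measurable_EFinP; rewrite (_ : EFin \o _ = (fun x => A x (G i))).
  exact: measurable_kernel.
by apply/funext => x /=; rewrite fE.
Qed.

Let sumA x : (\sum_i f i x <= V%:R)%R.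
Proof.
rewrite -lee_fin -sumEFin.
under eq_bigr do rewrite -fE.
have -> : \sum_i A x (G i) = \int[A x]_o (\sum_i ((\1_(G i) o : R))%:E).
  rewrite ge0_integral_sum//.
  - by apply: eq_bigr => i _; rewrite integral_indic// setIT.
  - by move=> i; apply/measurable_EFinP.
have <- : \int[A x]_o (V%:R)%:E = (V%:R)%:E.
  by rewrite integral_cst//= prob_kernel mule1.
apply: ge0_le_integral => //.
- by move=> o _; rewrite sume_ge0// => i _; rewrite lee_fin.
- by apply: emeasurable_sum => i; apply/measurable_EFinP.
- move=> o _; rewrite sumEFin lee_fin.
  under eq_bigr do rewrite indicE.
  by rewrite -natr_sum ler_nat.
Qed.

Let sumQ (M : probability _ R) : \sum_i \int[M]_x (f i x)%:E <= (V%:R)%:E.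
Proof.
rewrite -ge0_integral_sum//; last 2 first.
- by move=> i; apply/measurable_EFinP.
- by move=> i x _; rewrite lee_fin; case/andP: (f01 i x).
under eq_integral do rewrite sumEFin.
rewrite -(integral_cstr M); apply: le_integralr => //.
- by apply: measurable_sum => i.
- by move=> x; apply: sumr_ge0 => i _; case/andP: (f01 i x).
Qed.

Let Qm := iid Q m.

(** Under the common reference the success probabilities of all members add up to at most [V], by
    [sumQ]; moving each one from [P i] to [Q] costs the factor of [dp_transport]. A coordinate there
    is a whole user, that is, [m] examples. *)
Lemma family_dp_bound : (0 < m)%N -> (0 <= eps)%R -> user_level_dp eps 0 A ->
  (#|I|%:R * (2 / 3) <=
   V%:R * (1 + Num.min 1 (Num.sqrt (X ^+ m - 1)) * (expR eps - 1)) ^+ n)%R.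
Proof.
move=> m0 eps0 Adp; set t := Num.min _ _; set c := (1 + _)%R.
have Xm : (1 < X ^+ m)%R by rewrite exprn_egt1// -lt0n.
have t0 : (0 <= t)%R by rewrite le_min ler01 sqrtr_ge0.
have e1 : (1 <= expR eps)%R by rewrite -[1%R]expR0 ler_expR.
have c0 : (0 <= c)%R by rewrite addr_ge0// mulr_ge0// subr_ge0.
have H i : (2 / 3)%:E <= (c ^+ n)%:E * \int[iid Qm n]_x (f i x)%:E.
  apply: (le_trans (AG i)).
  have -> : \int[iid (iid (P i) m) n]_x A x (G i) = \int[iid (iid (P i) m) n]_x (f i x)%:E.
    by apply: eq_integral => x _; rewrite fE.
  have D := has_density_iid m (PQ i).
  have S : \int[Qm]_x ((\prod_j p i (tnth x j)) ^+ 2)%:E <= (X ^+ m)%:E.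
    by apply: (density_iid_second_moment (PQ i)) => //; exact: ltW (lt_trans ltr01 X1).
  apply: (dp_transport [tuple z0 | j < m] D e1 t0) => //.
  - rewrite /t; case: (leP 1%R (Num.sqrt (X ^+ m - 1))) => _.
      exact: (density_pos_part_le1 D).
    exact: (density_pos_part_le_sqrt D Xm S).
  - by move=> y; case/andP: (f01 i y).
  - move=> x x' xx'; rewrite -lee_fin EFinM -!fE.
    by have := Adp x x' xx' (G i) (mG i); rewrite adde0.
have : \sum_(i : I) (2 / 3)%:E <= \sum_(i : I) ((c ^+ n)%:E * \int[iid Qm n]_x (f i x)%:E).
  by apply: lee_sum => i _; exact: H.
rewrite -ge0_sume_distrr; last by move=> i _; apply: integralr_ge0 => x; case/andP: (f01 i x).
move=> K; have {}K := le_trans K (lee_wpmul2l _ (sumQ (iid Qm n))).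
move: K; rewrite lee_fin exprn_ge0// => /(_ isT).
by rewrite -EFinM sumEFin lee_fin sumr_const [(#|I|%:R * _)%R]mulr_natl [(V%:R * _)%R]mulrC.
Qed.

(** The same averaging, with the change from [P i] to [Q] paid by the second moment of the density
    of all [n m] examples instead of by privacy. *)
Lemma family_amgm_bound (l : R) : (0 < l)%R ->
  (#|I|%:R * (2 / 3) <= l / 2 * V%:R + #|I|%:R * (X ^+ m ^+ n / (2 * l)))%R.
Proof.
move=> l0.
have X0 : (0 <= X)%R by exact: ltW (lt_trans ltr01 X1).
have H i : (2 / 3)%:E <= (l / 2)%:E * \int[iid Qm n]_x (f i x)%:E + (X ^+ m ^+ n / (2 * l))%:E.
  apply: (le_trans (AG i)).
  have -> : \int[iid (iid (P i) m) n]_x A x (G i) = \int[iid (iid (P i) m) n]_x (f i x)%:E.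
    by apply: eq_integral => x _; rewrite fE.
  have D := has_density_iid m (PQ i).
  have S := density_iid_second_moment (PQ i) m X0 (pX i).
  have S2 := density_iid_second_moment D n (exprn_ge0 m X0) S.
  exact: (density_amgm (has_density_iid n D) l0 (mf i) (f01 i) S2).
have : \sum_(i : I) (2 / 3)%:E <= \sum_(i : I) ((l / 2)%:E * \int[iid Qm n]_x (f i x)%:E + (X ^+ m ^+ n / (2 * l))%:E).
  by apply: lee_sum => i _; exact: H.
rewrite big_split/= -ge0_sume_distrr; last by move=> i _; apply: integralr_ge0 => x; case/andP: (f01 i x).
have l20 : (0 <= l / 2)%R by rewrite divr_ge0// ltW.
move=> K; have {}K := le_trans K (leeD (lee_wpmul2l _ (sumQ (iid Qm n))) (lexx _)).
move: K; rewrite lee_fin l20 => /(_ isT).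
by rewrite -EFinM !sumEFin -EFinD lee_fin !sumr_const -[(2 / 3 *+ _)%R]mulr_natl -[(X ^+ m ^+ n / (2 * l) *+ _)%R]mulr_natl.
Qed.

End family.

(** * Gaussian vectors *)

Section gauss_neg.
Context {R : realType}.
Local Notation gam := (normal_prob (0 : R) 1).
Local Open Scope ereal_scope.

Lemma ge0_integral_lebesgueN (f : R -> \bar R) : measurable_fun [set: R] f ->
  (forall x, 0 <= f x) ->
  \int[lebesgue_measure]_x f x = \int[lebesgue_measure]_x f (- x)%R.
Proof.
move=> mf f0.
have mN : measurable_fun [set: measurableTypeR R] (-%R : measurableTypeR R -> measurableTypeR R).
  exact: oppr_measurable.
rewrite (eq_measure_integral (measure_function_pushforward__canonical__measure_function_Measure lebesgue_measure mN)); last first.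
  by move=> A mA _; rewrite /= lebesgue_measureN.
by rewrite ge0_integral_pushforward.
Qed.

Lemma gauss_neg (f : R -> \bar R) : measurable_fun [set: R] f ->
  (forall x, 0 <= f x) -> \int[gam]_x f (- x)%R = \int[gam]_x f x.
Proof.
move=> mf f0.
have mpdf := measurable_normal_pdf (0 : R) (1 : R).
have pdf0 := @normal_pdf_ge0 R (0 : R) (1 : R).
have mfN : measurable_fun [set: R] (fun x => f (- x)%R).
  by apply: (measurableT_comp mf); exact: oppr_measurable.
rewrite (ge0_integral_normal mf f0) (ge0_integral_normal mfN (fun x => f0 (- x)%R)).
rewrite [RHS]ge0_integral_lebesgueN; last 2 first.
- by apply: emeasurable_funM => //; exact/measurable_EFinP.
- by move=> x; rewrite mule_ge0// lee_fin.
apply: eq_integral => x _ /=; congr (_ * _); congr EFin.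
by rewrite !normal_pdfE ?oner_eq0// /normal_fun !subr0 sqrrN.
Qed.

End gauss_neg.

Section gauss_law.
Context {R : realType} {d : nat}.

Lemma measurable_affine_map (mu : 'cV[R]_d) (M : 'M[R]_d) :
  measurable_fun [set: Rd d] (affine_map mu M).
Proof.
apply/measurable_fun_tnthP => i /=.
rewrite (_ : _ \o _ = fun z : Rd d => mu i 0 + \sum_j M i j * (tnth z j : R)).
  apply: measurable_funD => //; apply: measurable_sum => j.
  by apply: measurable_funM => //; exact: measurable_tnth.
by apply/funext => z /=; rewrite tnth_mktuple.
Qed.

HB.instance Definition _ mu M := @isMeasurableFun.Build _ _ _ _
  (affine_map mu M) (@measurable_affine_map mu M).

Definition gauss_law (mu : 'cV[R]_d) (M : 'M[R]_d) : probability (Rd d) R :=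
  distribution (iid (normal_prob (0 : R) 1) d) (affine_map mu M).

Lemma gauss_lawP mu M : is_gaussian mu (M *m M^T) (gauss_law mu M).
Proof. by exists M. Qed.

Lemma integral_gauss_law mu M (f : Rd d -> \bar R) :
  measurable_fun [set: _] f -> (forall y, 0 <= f y)%E ->
  (\int[gauss_law mu M]_y f y =
   \int[iid (normal_prob (0 : R) 1) d]_x f (affine_map mu M x))%E.
Proof. by move=> mf f0; rewrite ge0_integral_distribution. Qed.

End gauss_law.

Section coordinates.
Context {R : realType} {d : nat}.
Local Notation gam := (normal_prob (0 : R) 1).
Local Notation g := (iid gam d).

(** Reads a coordinate in [R] instead of [measurableTypeR R], so that it can be used in ring
    expressions. *)
Definition cd (x : Rd d) (i : 'I_d) : R := tnth x i.

Lemma cd_upd (x : Rd d) i (t : R) j :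
  cd (upd x i t) j = if j == i then t else cd x j.
Proof. by rewrite /cd tnth_upd. Qed.

Lemma measurable_cd i : measurable_fun [set: Rd d] (cd^~ i).
Proof. exact: measurable_tnth. Qed.

Lemma upd_upd (x : Rd d) i (s t : R) : upd (upd x i s) i t = upd x i t.
Proof.
by apply: eq_from_tnth => j; rewrite !tnth_upd; case: eqP.
Qed.

Local Open Scope ereal_scope.

Lemma integral_gauss_coord (l : 'I_d) (f : R -> \bar R) :
  measurable_fun [set: R] f -> (forall x, 0 <= f x) ->
  \int[g]_x f (cd x l) = \int[gam]_t f t.
Proof.
move=> mf f0; rewrite (@integral_iid_resample _ _ _ gam d l)//; last first.
  by apply: (measurableT_comp mf); exact: measurable_cd.
under eq_integral => x _.
  under eq_integral => t _ do rewrite cd_upd eqxx.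
  over.
by rewrite integral_cst//= probability_setT mule1.
Qed.

Lemma integral_gauss_reflect (l : 'I_d) (f : Rd d -> \bar R) :
  measurable_fun [set: _] f -> (forall x, 0 <= f x) ->
  \int[g]_x f (upd x l (- cd x l)%R) = \int[g]_x f x.
Proof.
move=> mf f0.
have mu : measurable_fun [set: Rd d] (fun x => upd x l (- cd x l)%R : Rd d).
  apply/measurable_fun_tnthP => j /=.
  rewrite (_ : _ \o _ = fun x => if j == l then (- cd x l)%R else cd x j).
    by case: (j == l); [apply: measurable_fun_oppr|]; exact: measurable_cd.
  by apply/funext => x /=; rewrite tnth_upd.
rewrite [RHS](integral_iid_resample gam l mf f0).
have mfu : measurable_fun [set: Rd d] (fun x => f (upd x l (- cd x l)%R)).
  exact: (measurableT_comp mf mu).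
rewrite (integral_iid_resample gam l mfu (fun x => f0 _)).
apply: eq_integral => x _.
have mfx : measurable_fun [set: R] (fun t => f (upd x l t)).
  by apply: (measurableT_comp mf); exact: measurable_updr.
rewrite -(gauss_neg mfx (fun t => f0 _)).
by apply: eq_integral => t _; rewrite upd_upd cd_upd eqxx.
Qed.

(** The second moment of the standard normal law, kept symbolic; [m2_ge] is what [chaos_tv_lower]
    takes from it. *)
Definition m2 : R := fine (\int[gam]_t (t ^+ 2)%:E).

Lemma m2E : \int[gam]_t (t ^+ 2)%:E = m2%:E.
Proof.
rewrite fineK// ge0_fin_numE; last by apply: integralr_ge0; nneg.
by apply: (le_lt_trans (@gauss_sq_moment_le R)); exact: ltry.
Qed.

Lemma m2_ge : (2^-1 <= m2)%R.
Proof. by rewrite -lee_fin -m2E; exact: gauss_sq_moment_ge. Qed.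

Let integral_sq a : \int[g]_x (cd x a ^+ 2)%:E = m2%:E.
Proof.
rewrite (@integral_gauss_coord a (fun t => (t ^+ 2)%:E)) ?m2E//.
- by apply/measurable_EFinP; meas.
- by move=> x; rewrite lee_fin sqr_ge0.
Qed.

Let mcd := measurable_cd.

Lemma integrable_cd2 a b : g.-integrable setT (fun x => (cd x a * cd x b)%:E).
Proof.
apply/integrableP; split; first by apply/measurable_EFinP; meas.
apply: (@le_lt_trans _ _ (\int[g]_x (cd x a ^+ 2 + cd x b ^+ 2)%:E)).
  under eq_integral do rewrite abse_EFin.
  apply: le_integralr; side.
  move=> x; rewrite normrM -[(cd x a ^+ 2)%R]real_normK ?num_real//.
  rewrite -[(cd x b ^+ 2)%R]real_normK ?num_real//.
  have := sqr_ge0 (`|cd x a| - `|cd x b|)%R.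
  have := normr_ge0 (cd x a); have := normr_ge0 (cd x b) => ? ? ?; nra.
by rewrite integralDr ?integral_sq ?ltry; side.
Qed.

Lemma integral_cd2 a b :
  \int[g]_x (cd x a * cd x b)%:E = (if a == b then m2 else 0)%:E.
Proof.
case: (eqVneq a b) => [<-|ab].
  by rewrite -(integral_sq a); apply: eq_integral => x _; rewrite expr2.
rewrite integralE.
have mf : measurable_fun [set: Rd d] (fun x => (cd x a * cd x b)%:E).
  by apply/measurable_EFinP; meas.
(* Reflecting coordinate [a] exchanges the positive and the negative part of the product, so their
   integrals agree. *)
have -> : \int[g]_x (fun x => (cd x a * cd x b)%:E)^\- x =
    \int[g]_x (fun x => (cd x a * cd x b)%:E)^\+ x.
  rewrite -(integral_gauss_reflect a)//; last exact: measurable_funeneg.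
  apply: eq_integral => x _.
  by rewrite funenegE funeposE !cd_upd eqxx [b == a]eq_sym (negbTE ab) mulNr EFinN oppeK.
rewrite subee// ge0_fin_numE; last by apply: integral_ge0 => x _; rewrite funepos_ge0.
have /integrableP[_] := integrable_funepos measurableT (integrable_cd2 a b).
by under eq_integral do rewrite gee0_abs ?funepos_ge0//.
Qed.

(** * Integrating out and shifting a group of coordinates *)

Section mgf_out.
Variables (k : nat) (l : 'I_k -> 'I_d) (a : 'I_k -> @Rd R d -> R).
Hypotheses (l_inj : injective l) (ma : forall i, measurable_fun [set: _] (a i)).
Hypothesis a_upd : forall i x j t, a i (upd x (l j) t) = a i x.

(** By [a_upd] the coefficients ignore all coordinates [l j], so redrawing the coordinate [l i]
    leaves a one-dimensional exponential moment with a constant coefficient. The factor it produces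
    is put into [G], which is why the induction is over all [G]. *)
Lemma gauss_mgf_out_seq (s : seq 'I_k) (G : @Rd R d -> R) : uniq s ->
  measurable_fun [set: _] G -> (forall x, (0 <= G x)%R) ->
  (forall x j t, G (upd x (l j) t) = G x) ->
  \int[g]_x (expR (\sum_(i <- s) cd x (l i) * a i x) * G x)%:E =
  \int[g]_x (expR (\sum_(i <- s) a i x ^+ 2 / 2) * G x)%:E.
Proof.
elim: s G => [|i s IH] G /=.
  by move=> _ mG G0 Gu; apply: eq_integral => x _; rewrite !big_nil.
move=> /andP[si us] mG G0 Gu.
have ms (r : seq 'I_k) : measurable_fun [set: Rd d] (fun x => \sum_(i <- r) cd x (l i) * a i x)%R.
  by apply: measurable_sum => j; meas.
rewrite (@integral_iid_resample _ _ _ gam d (l i)); last 2 first.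
- by apply/measurable_EFinP; meas.
- by move=> x; rewrite lee_fin mulr_ge0 ?expR_ge0.
transitivity (\int[g]_x (expR (\sum_(j <- s) cd x (l j) * a j x) *
    (expR (a i x ^+ 2 / 2) * G x))%:E).
  apply: eq_integral => x _.
  have E (t : R) : (expR (\sum_(i0 <- i :: s) cd (upd x (l i) t) (l i0) * a i0 (upd x (l i) t)) * G (upd x (l i) t)
     = expR (\sum_(j <- s) cd x (l j) * a j x) * G x * expR (a i x * t))%R.
    rewrite big_cons cd_upd eqxx a_upd Gu expRD.
    rewrite (eq_big_seq (fun j => cd x (l j) * a j x)%R); last first.
      move=> j js; rewrite a_upd cd_upd (inj_eq l_inj).
      by case: eqP => [ji|//]; rewrite -ji js in si.
    by rewrite (mulrC t); ring.
  under eq_integral do rewrite E.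
  rewrite integralZr_nneg; side.
  by rewrite gauss_mgf -EFinM; congr EFin; ring.
rewrite IH//; last 3 first.
- by meas.
- by move=> x; rewrite mulr_ge0 ?expR_ge0.
- by move=> x j t; rewrite a_upd Gu.
by apply: eq_integral => x _; rewrite big_cons expRD; congr EFin; ring.
Qed.

Lemma gauss_mgf_out (G : @Rd R d -> R) :
  measurable_fun [set: _] G -> (forall x, (0 <= G x)%R) ->
  (forall x j t, G (upd x (l j) t) = G x) ->
  \int[g]_x (expR (\sum_i cd x (l i) * a i x) * G x)%:E =
  \int[g]_x (expR (\sum_i a i x ^+ 2 / 2) * G x)%:E.
Proof. by move=> mG G0 Gu; apply: gauss_mgf_out_seq => //; exact: index_enum_uniq. Qed.

(** Sequential for the sake of induction; by [a_shifts] and [cd_shifts] the effect is that of a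
    simultaneous shift. *)
Fixpoint shifts (s : seq 'I_k) (x : Rd d) : Rd d :=
  if s is i :: s' then shifts s' (upd x (l i) (cd x (l i) + a i x)%R) else x.

Lemma a_shifts i s x : a i (shifts s x) = a i x.
Proof. by elim: s x => //= j s IH x; rewrite IH a_upd. Qed.

Lemma cd_shifts s x j : uniq s ->
  cd (shifts s x) j = (cd x j + \sum_(i <- s | l i == j) a i x)%R.
Proof.
elim: s x => [|i s IH] x /=; first by rewrite big_nil addr0.
move=> /andP[si us]; rewrite IH// cd_upd big_cons.
have -> : (\sum_(i0 <- s | l i0 == j) a i0 (upd x (l i) (cd x (l i) + a i x)%R) =
    \sum_(i0 <- s | l i0 == j) a i0 x)%R by apply: eq_bigr => i0 _; rewrite a_upd.
rewrite [l i == j]eq_sym; case: (eqVneq j (l i)) => [->|]//.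
by rewrite addrA.
Qed.

Lemma measurable_shifts s : measurable_fun [set: Rd d] (shifts s).
Proof.
elim: s => [|i s IH] /=; first exact: measurable_id.
apply: (measurableT_comp IH); apply/measurable_fun_tnthP => j /=.
rewrite (_ : _ \o _ = fun x => if j == l i then (cd x (l i) + a i x)%R else cd x j).
  by case: (j == l i); [apply: measurable_funD => //|]; exact: measurable_cd.
by apply/funext => x /=; rewrite tnth_upd.
Qed.

(** A Cameron-Martin formula for shifts that are random but do not depend on the shifted
    coordinates: given the other coordinates they are translations, so no Jacobian appears. *)
Lemma gauss_shifts (s : seq 'I_k) (F : @Rd R d -> \bar R) : uniq s ->
  measurable_fun [set: _] F -> (forall x, 0 <= F x) ->
  \int[g]_x F (shifts s x) =
  \int[g]_x (F x * (expR (\sum_(i <- s) (cd x (l i) * a i x - a i x ^+ 2 / 2)))%:E).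
Proof.
elim: s F => [|i s IH] F /=.
  by move=> _ mF F0; apply: eq_integral => x _; rewrite big_nil expR0 mule1.
move=> /andP[si us] mF F0.
have mH : measurable_fun [set: Rd d] (fun x => F (shifts s x)).
  by apply: (measurableT_comp mF); exact: measurable_shifts.
have mu : measurable_fun [set: Rd d] (fun x => upd x (l i) (cd x (l i) + a i x)%R : Rd d).
  by have := measurable_shifts [:: i].
pose E x := (cd x (l i) * a i x - a i x ^+ 2 / 2)%R.
have mE : measurable_fun [set: Rd d] E by rewrite /E; meas.
have mHu : measurable_fun [set: Rd d] (fun x => F (shifts s (upd x (l i) (cd x (l i) + a i x)%R))).
  exact: (measurableT_comp mH mu).
rewrite (integral_iid_resample gam (l i) mHu (fun x => F0 _)).
transitivity (\int[g]_x (F (shifts s x) * (expR (E x))%:E)).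
  rewrite [RHS](@integral_iid_resample _ _ _ gam d (l i)); last 2 first.
  - by apply: emeasurable_funM => //; apply/measurable_EFinP; meas.
  - by move=> x; rewrite mule_ge0// lee_fin expR_ge0.
  apply: eq_integral => x _.
  under eq_integral => t _.
    rewrite upd_upd cd_upd eqxx a_upd -[t in (t + _)%R]mul1r; over.
  have mx : measurable_fun [set: R] (fun t => F (shifts s (upd x (l i) t))).
    by apply: (measurableT_comp mH); exact: measurable_updr.
  rewrite (gauss_affine (a i x) ltr01 mx (fun t => F0 _)).
  apply: eq_integral => t _; congr (_ * _); congr EFin.
  by rewrite invr1 mul1r /E cd_upd eqxx a_upd; congr expR; field.
(* The remaining shifts move neither the coordinate [l i], as [i] is not in [s], nor the values of
   [a]; so the factor just produced passes through them. *)
have EE x : E x = E (shifts s x).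
  rewrite /E a_shifts cd_shifts// big_seq_cond big1 ?addr0// => j /andP[js /eqP/l_inj ji].
  by rewrite ji (negbTE si) in js.
under eq_integral do rewrite EE.
rewrite (IH (fun x => F x * (expR (E x))%:E))//; last 2 first.
- by apply: emeasurable_funM => //; apply/measurable_EFinP; meas.
- by move=> x; rewrite mule_ge0// lee_fin expR_ge0.
by apply: eq_integral => x _; rewrite big_cons -/(E x) [in RHS]expRD EFinM muleA.
Qed.

End mgf_out.
End coordinates.

(** * Total variation between Gaussian chaos densities *)

(** Jensen's inequality from the tangent at the mean: [e^y >= e^m (1 + y - m)], summed over the
    points. *)
Lemma expR_jensen {R : realType} k (y : 'I_k -> R) : (0 < k)%N ->
  expR (k%:R^-1 * \sum_i y i) <= k%:R^-1 * \sum_i expR (y i).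
Proof.
move=> k0; set m := _ * _.
have kN : (k%:R : R) != 0 by rewrite pnatr_eq0 -lt0n.
rewrite -(ler_pM2l (x := k%:R)) ?ltr0n// mulVKf//.
apply: (@le_trans _ _ (\sum_(i < k) expR m * (1 + (y i - m)))); last first.
  apply: ler_sum => i _; rewrite -[y i in leRHS](subrK m) [leRHS]expRD [leRHS]mulrC.
  by rewrite ler_wpM2l ?expR_ge0// expR_ge1Dx.
rewrite -mulr_sumr big_split/= sumr_const card_ord sumrB sumr_const card_ord.
rewrite -[m *+ k]mulr_natl mulVKf// subrr addr0 mulrC.
by [].
Qed.

(** This is [F (a - b) <= |F (a - b)|] with [F] split into its positive and negative parts, so that
    only nonnegative functions have to be integrated. *)
Lemma pos_part_cross {R : realDomainType} (F a b : R) :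
  Num.max F 0 * a + Num.max (- F) 0 * b <=
  Num.max (- F) 0 * a + Num.max F 0 * b + `|F * (a - b)|.
Proof.
have E : Num.max F 0 - Num.max (- F) 0 = F.
  by case: (leP F 0) => h; case: (leP (- F) 0) => h'; lra.
rewrite -subr_ge0 (_ : _ - _ = `|F * (a - b)| - (Num.max F 0 - Num.max (- F) 0) * (a - b)).
  by rewrite E subr_ge0 ler_norm.
by ring.
Qed.

Lemma normrB_pos_parts {R : realDomainType} (a b : R) :
  `|a - b| = Num.max (a - b) 0 + Num.max (b - a) 0.
Proof.
case: (leP (a - b) 0) => h; case: (leP (b - a) 0) => h'.
- by rewrite ler0_norm//; lra.
- by rewrite ler0_norm//; lra.
- by rewrite gtr0_norm//; lra.
- by rewrite gtr0_norm//; lra.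
Qed.

Lemma pos_partD {R : realDomainType} (a b : R) :
  Num.max (a - b) 0 + b = Num.max (b - a) 0 + a.
Proof. by case: (leP (a - b) 0) => h; case: (leP (b - a) 0) => h'; lra. Qed.

Section expectation.
Context {R : realType} {dT : measure_display} {T : measurableType dT}.
Variable P : probability T R.
Local Open Scope ereal_scope.

(** Integrability travels with the value because the quadratic forms below take both signs;
    [has_mean_parts] returns to integrals of nonnegative functions. *)
Definition has_mean (h : T -> R) (c : R) : Prop :=
  P.-integrable setT (EFin \o h) /\ \int[P]_x (h x)%:E = c%:E.

Lemma has_meanZ (w : R) h c : has_mean h c -> has_mean (fun x => w * h x)%R (w * c)%R.
Proof.
move=> [ih eh]; split.
  rewrite (_ : EFin \o _ = (fun x => w%:E * (EFin \o h) x)).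
    exact: integrableZl.
  by apply/funext => x /=; rewrite EFinM.
under eq_integral do rewrite EFinM.
by rewrite (@integralZl _ _ _ P _ measurableT (EFin \o h))//= eh EFinM.
Qed.

Lemma has_mean_sum (I : finType) (h : I -> T -> R) (c : I -> R) :
  (forall i, has_mean (h i) (c i)) ->
  has_mean (fun x => \sum_i h i x)%R (\sum_i c i)%R.
Proof.
move=> hc; split.
  rewrite (_ : EFin \o _ = (fun x => \sum_i (h i x)%:E)).
    by apply: integrable_sum => // i _; case: (hc i).
  by apply/funext => x /=; rewrite sumEFin.
under eq_integral do rewrite -sumEFin.
rewrite (@integral_sum _ _ _ P _ measurableT I (fun i x => (h i x)%:E)); last first.
  by move=> i; case: (hc i).
by rewrite -sumEFin; apply: eq_bigr => i _; case: (hc i).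
Qed.

Lemma has_meanD h c h' c' : has_mean h c -> has_mean h' c' ->
  has_mean (fun x => h x + h' x)%R (c + c')%R.
Proof.
move=> [ih eh] [ih' eh']; split.
  rewrite (_ : EFin \o _ = ((EFin \o h) \+ (EFin \o h'))).
    exact: integrableD.
  by apply/funext => x /=; rewrite EFinD.
under eq_integral do rewrite EFinD.
by rewrite (@integralD _ _ _ P _ measurableT (EFin \o h) (EFin \o h'))//= eh eh' EFinD.
Qed.

Lemma has_mean_parts h c : has_mean h c ->
  exists A B : R, [/\ \int[P]_x (Num.max (h x) 0)%:E = A%:E,
    \int[P]_x (Num.max (- h x) 0)%:E = B%:E & (A - B = c)%R].
Proof.
move=> [ih eh].
have Ep : \int[P]_x (Num.max (h x) 0)%:E = \int[P]_x (EFin \o h)^\+ x.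
  by apply: eq_integral => x _; rewrite funeposE/= -EFin_max.
have En : \int[P]_x (Num.max (- h x) 0)%:E = \int[P]_x (EFin \o h)^\- x.
  by apply: eq_integral => x _; rewrite funenegE/= -EFin_max.
have fp : \int[P]_x (EFin \o h)^\+ x \is a fin_num by exact: integrable_pos_fin_num.
have fn : \int[P]_x (EFin \o h)^\- x \is a fin_num by exact: integrable_neg_fin_num.
exists (fine (\int[P]_x (EFin \o h)^\+ x)), (fine (\int[P]_x (EFin \o h)^\- x)).
rewrite Ep En !fineK//; split => //.
apply: EFin_inj; rewrite -eh EFinB !fineK//.
by rewrite [RHS]integralE.
Qed.

End expectation.

(** * From a gap between means to total variation *)

Section test_function.
Context {R : realType} {dT : measure_display} {T : measurableType dT}.
Variables (P : probability T R) (p p' f : T -> R) (w A B A' B' : R).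
Hypotheses (w0 : 0 < w) (mp : measurable_fun [set: T] p)
  (mp' : measurable_fun [set: T] p') (mf : measurable_fun [set: T] f)
  (p0 : forall x, 0 <= p x) (p0' : forall x, 0 <= p' x).
Local Open Scope ereal_scope.
Hypotheses (pI : \int[P]_x (p x)%:E = 1) (pI' : \int[P]_x (p' x)%:E = 1).
Hypotheses (EA : \int[P]_x (Num.max (f x) 0 * p x)%:E = A%:E)
  (EB : \int[P]_x (Num.max (- f x) 0 * p x)%:E = B%:E)
  (EA' : \int[P]_x (Num.max (f x) 0 * p' x)%:E = A'%:E)
  (EB' : \int[P]_x (Num.max (- f x) 0 * p' x)%:E = B'%:E).
Hypotheses (p2 : \int[P]_x (p x ^+ 2)%:E <= (1 + 2 * w)%:E)
  (p2' : \int[P]_x (p' x ^+ 2)%:E <= (1 + 2 * w)%:E)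
  (f4 : \int[P]_x (f x ^+ 4)%:E <= (288 * w ^+ 2)%:E).
Hypothesis gap : (w / (60 * 60) <= (A - B) - (A' - B'))%R.

Let H x := `|p x - p' x|%R.
Let mH : measurable_fun [set: T] H.
Proof. by apply: measurable_fun_normr; apply: measurable_funB. Qed.
Let H0 x : (0 <= H x)%R. Proof. exact: normr_ge0. Qed.
Let pos0 (y : R) : (0 <= Num.max y 0)%R.
Proof. by rewrite le_max lexx orbT. Qed.
Let mpos (h : T -> R) : measurable_fun [set: T] h ->
  measurable_fun [set: T] (fun x => Num.max (h x) 0)%R.
Proof. by move=> mh; apply: measurable_maxr. Qed.

Let K2 : (w / (60 * 60))%:E <= \int[P]_x (`|f x| * H x)%:E.
Proof.
have mfp := mpos mf; have mfn := mpos (measurable_fun_oppr mf).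
have K1 : A%:E + B'%:E <= B%:E + A'%:E + \int[P]_x (`|f x| * H x)%:E.
  rewrite -EA -EB -EA' -EB'; rewrite -integralDr; side. rewrite -[X in _ <= X + _]integralDr; side. rewrite -integralDr; side.
  apply: le_integralr; side.
  by move=> x; rewrite -normrM; exact: pos_part_cross.
move: K1; have : 0 <= \int[P]_x (`|f x| * H x)%:E by apply: integralr_ge0; nneg.
case: (\int[P]_x _) => [r| |]//=; rewrite -?EFinD ?lee_fin ?leey//.
by move=> r0 h; apply: (le_trans gap); lra.
Qed.

Let sq_dev (q : T -> R) : measurable_fun [set: T] q -> (forall x, (0 <= q x)%R) ->
  \int[P]_x (q x)%:E = 1 -> \int[P]_x (q x ^+ 2)%:E <= (1 + 2 * w)%:E ->
  \int[P]_x ((q x - 1) ^+ 2)%:E <= (2 * w)%:E.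
Proof.
move=> mq q0 qI q2.
have : \int[P]_x ((q x - 1) ^+ 2 + 2 * q x)%:E <= (2 + 2 * w)%:E.
  rewrite (_ : \int[P]_x _ = \int[P]_x (q x ^+ 2 + 1)%:E); last first.
    by apply: eq_integral => x _; congr EFin; ring.
  rewrite integralDr; side.
  rewrite integral_cstr (_ : (2 + 2 * w)%:E = (1 + 2 * w)%:E + 1%:E); last by rewrite -EFinD; congr EFin; ring.
  by rewrite leeD2r.
rewrite integralDr; side.
rewrite integralZr_nneg; side.
rewrite qI mule1.
have : 0 <= \int[P]_x ((q x - 1) ^+ 2)%:E by apply: integralr_ge0; nneg.
by case: (\int[P]_x _) => [r| |]//=; rewrite -?EFinD ?lee_fin//; move=> *; lra.
Qed.

Let hsq : \int[P]_x (H x ^+ 2)%:E <= (8 * w)%:E.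
Proof.
apply: (@le_trans _ _ (\int[P]_x (2 * (p x - 1) ^+ 2 + 2 * (p' x - 1) ^+ 2)%:E)).
  apply: le_integralr; side.
  by move=> x; rewrite /H real_normK ?num_real//; have := sqr_ge0 (p x + p' x - 2)%R; nra.
rewrite integralDr; side.
rewrite integralZr_nneg; side. rewrite integralZr_nneg; side.
apply: (@le_trans _ _ (2%:E * (2 * w)%:E + 2%:E * (2 * w)%:E)).
  by rewrite leeD// lee_wpmul2l ?lee_fin//; apply: sq_dev.
by rewrite -!EFinM -EFinD lee_fin; lra.
Qed.

Let sw := Num.sqrt w.
Let sw0 : (0 < sw)%R. Proof. by rewrite sqrtr_gt0. Qed.
Let sw2 : (sw ^+ 2 = w)%R. Proof. by rewrite sqr_sqrtr// ltW. Qed.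
(** The truncation level for [f], of the order of its size [sqrt w]. With [296 = 8 + 288], from
    [hsq] and [f4], the error in [K3] is [w / (120 * 60)], half of the gap in [K2]. *)
Let Bt := (296 * (30 * 60) * sw)%R.
Let Bt0 : (0 < Bt)%R.
Proof. exact: (mulr_gt0 (mulr_gt0 (ltr0Sn R 295) (mulr_gt0 (ltr0Sn R 29) (ltr0Sn R 59))) sw0). Qed.

(** As [f] is unbounded, AM-GM is applied twice: [|f| H <= Bt H / 2 + f^2 H / (2 Bt)], then
    [f^2 H <= sw H^2 / 2 + f^4 / (2 sw)]. The last two terms have known moments, and only [H]
    remains to be bounded below. *)
Let K3 : \int[P]_x (`|f x| * H x)%:E <= (Bt / 2)%:E * \int[P]_x (H x)%:E + (w / (120 * 60))%:E.
Proof.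
  have c1 : (0 <= sw / (4 * Bt))%R := divr_ge0 (ltW sw0) (mulr_ge0 (ler0n R 4) (ltW Bt0)).
  have c2 : (0 <= (4 * Bt * sw)^-1)%R.
    by rewrite invr_ge0; exact: (mulr_ge0 (mulr_ge0 (ler0n R 4) (ltW Bt0)) (ltW sw0)).
  have c3 : (0 <= Bt / 2)%R by rewrite divr_ge0// ltW.
  have f40 x : (0 <= f x ^+ 4)%R by rewrite (exprM _ 2 2) sqr_ge0.
  apply: (@le_trans _ _ (\int[P]_x (Bt / 2 * H x + (sw / (4 * Bt) * H x ^+ 2 + (4 * Bt * sw)^-1 * f x ^+ 4))%:E)).
    apply: le_integralr; side.
    move=> x; rewrite -subr_ge0.
    have -> : (Bt / 2 * H x + (sw / (4 * Bt) * H x ^+ 2 + (4 * Bt * sw)^-1 * f x ^+ 4) - `|f x| * H x =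
      H x / (2 * Bt) * (Bt - `|f x|) ^+ 2 + (4 * Bt * sw)^-1 * (sw * H x - `|f x| ^+ 2) ^+ 2)%R.
      rewrite (_ : f x ^+ 4 = `|f x| ^+ 4)%R; last by rewrite !(exprM _ 2 2) real_normK ?num_real.
      by field; rewrite !gt_eqF.
    by rewrite addr_ge0// mulr_ge0 ?sqr_ge0// divr_ge0// mulr_ge0// ltW.
  rewrite integralDr; side.
  rewrite integralDr; side.
  rewrite integralZr_nneg; side. rewrite integralZr_nneg; side. rewrite integralZr_nneg; side.
  rewrite leeD2l//.
  apply: (@le_trans _ _ ((sw / (4 * Bt))%:E * (8 * w)%:E + ((4 * Bt * sw)^-1)%:E * (288 * w ^+ 2)%:E)).
    by rewrite leeD// lee_wpmul2l// lee_fin.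
  rewrite -!EFinM -EFinD lee_fin le_eqVlt; apply/orP; left; apply/eqP.
  by rewrite /Bt -sw2; field; rewrite gt_eqF.
Qed.

Let K4 : (sw / (60 * 60 * (296 * (30 * 60))))%:E <= \int[P]_x (H x)%:E.
Proof.
  move: (le_trans K2 K3); have : 0 <= \int[P]_x (H x)%:E by apply: integralr_ge0.
  case: (\int[P]_x _) => [r| |]//=; rewrite -?EFinM -?EFinD ?lee_fin ?leey//.
  move=> r0 h; have : (w / (120 * 60) <= Bt / 2 * r)%R by lra.
  rewrite /Bt -sw2 (_ : sw ^+ 2 / (120 * 60) = sw * (sw / (120 * 60)))%R; last by ring.
  rewrite (_ : (296 * (30 * 60)) * sw / 2 * r = sw * ((148 * (30 * 60)) * r))%R; last by field.
  by rewrite ler_pM2l// => ?; lra.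
Qed.

(** Both densities have mass 1, so the two one-sided parts of [|p - p'|] have equal integrals and
    each is half of the bound [K4]. *)
Lemma test_function_tv_lower :
  (Num.sqrt w / (120 * 60 * (296 * (30 * 60))))%:E <=
  \int[P]_x (Num.max (p x - p' x) 0)%:E.
Proof.
have mh : measurable_fun [set: T] (fun x => Num.max (p x - p' x) 0)%R by apply: mpos; meas.
have mh' : measurable_fun [set: T] (fun x => Num.max (p' x - p x) 0)%R by apply: mpos; meas.
have Heq : \int[P]_x (H x)%:E = \int[P]_x (Num.max (p x - p' x) 0)%:E + \int[P]_x (Num.max (p' x - p x) 0)%:E.
  rewrite -integralDr; side.
  by apply: eq_integral => x _; congr EFin; exact: normrB_pos_parts.
have Hsym : \int[P]_x (Num.max (p x - p' x) 0)%:E = \int[P]_x (Num.max (p' x - p x) 0)%:E.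
  have : \int[P]_x (Num.max (p x - p' x) 0 + p' x)%:E = \int[P]_x (Num.max (p' x - p x) 0 + p x)%:E.
    by apply: eq_integral => x _; congr EFin; exact: pos_partD.
  rewrite integralDr; side. rewrite integralDr; side.
  by rewrite pI pI' => E; rewrite -[LHS](addeK (x := 1))// E addeK.
move: K4; rewrite Heq -Hsym -/sw.
have : 0 <= \int[P]_x (Num.max (p x - p' x) 0)%:E by apply: integralr_ge0.
case: (\int[P]_x _) => [r| |]//=; rewrite -?EFinD ?lee_fin ?leey//.
by move=> *; lra.
Qed.

End test_function.

(** * The density of a block shear of the standard Gaussian *)

Section chaos.
Context {R : realType} {d k : nat}.
Variables (lu lv : 'I_k -> 'I_d).
Hypotheses (lu_inj : injective lu) (lv_inj : injective lv).
Hypothesis luv : forall i j, lu j != lv i.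
Hypothesis k0 : (0 < k)%N.
Local Notation gam := (normal_prob (0 : R) 1).
Local Notation g := (iid gam d).
Local Notation Rdd := (@Rd R d).
Local Notation mat := ('I_k -> 'I_k -> R).
Implicit Types W D : mat.
Local Open Scope ereal_scope.

Definition rowu W i (x : Rdd) : R := (\sum_j W i j * cd x (lu j))%R.
Definition quad W (x : Rdd) : R := (\sum_i rowu W i x ^+ 2)%R.
(** The bilinear form [v^T W u] in two disjoint groups of coordinates; given [u] it is a centred
    Gaussian of variance [quad W]. *)
Definition chaos W (x : Rdd) : R := (\sum_i cd x (lv i) * rowu W i x)%R.
(** The density of the image of the standard Gaussian under the replacement of [v] by [v + W u], as
    [gauss_chaos] shows. *)
Definition chaos_density W (x : Rdd) : R := expR (chaos W x - quad W x / 2).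

Let mcd := @measurable_cd R d.

Lemma measurable_rowu W i : measurable_fun [set: Rdd] (rowu W i).
Proof. by apply: measurable_sum => j; meas. Qed.

Lemma measurable_quad W : measurable_fun [set: Rdd] (quad W).
Proof. by apply: measurable_sum => j; apply: measurable_funX; exact: measurable_rowu. Qed.

Lemma measurable_chaos W : measurable_fun [set: Rdd] (chaos W).
Proof. by apply: measurable_sum => j; apply: measurable_funM => //; exact: measurable_rowu. Qed.

Let mrow := measurable_rowu. Let mquad := measurable_quad. Let mchaos := measurable_chaos.

Lemma measurable_chaos_density W : measurable_fun [set: Rdd] (chaos_density W).
Proof. by rewrite /chaos_density; meas. Qed.
Let mdens := measurable_chaos_density.

Lemma rowu_upd W i x j (t : R) : rowu W i (upd x (lv j) t) = rowu W i x.
Proof. by apply: eq_bigr => l _; rewrite cd_upd (negbTE (luv _ _)). Qed.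

(** The square is linearized by an auxiliary Gaussian: [exp (th rho^2)] is the mean over [v_i] of
    [exp (r v_i rho)] with [r^2 = 2 th]. Integrating out [u] first instead leaves
    [exp (th |W_i|^2 v_i^2)], to which [gauss_sq_mgf] applies. *)
Lemma integral_exp_row W i (th sg : R) : (0 <= th)%R -> (0 < sg)%R ->
  (th * (\sum_j W i j ^+ 2) <= (1 - sg ^- 2) / 2)%R ->
  \int[g]_x (expR (th * rowu W i x ^+ 2))%:E <= sg%:E.
Proof.
move=> th0 sg0 H; pose r := Num.sqrt (2 * th).
have r2 : (r ^+ 2 = 2 * th)%R by rewrite sqr_sqrtr// mulr_ge0.
pose a i' (x : Rdd) : R := if i' == i then (r * rowu W i x)%R else 0%R.
have ma i' : measurable_fun [set: Rdd] (a i').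
  by rewrite /a; case: (i' == i) => //; meas.
have au i' x j (t : R) : a i' (upd x (lv j) t) = a i' x by rewrite /a rowu_upd.
have E1 : \int[g]_x (expR (\sum_i' cd x (lv i') * a i' x) * 1)%:E =
    \int[g]_x (expR (\sum_i' a i' x ^+ 2 / 2) * 1)%:E.
  exact: (@gauss_mgf_out _ _ _ _ _ lv_inj ma au (fun=> 1%R)).
have -> : \int[g]_x (expR (th * rowu W i x ^+ 2))%:E =
    \int[g]_x (expR (\sum_i' a i' x ^+ 2 / 2) * 1)%:E.
  apply: eq_integral => x _; congr EFin; rewrite mulr1 (bigD1 i)//= big1 ?addr0.
    by rewrite /a eqxx exprMn r2; congr expR; field.
  by move=> j /negbTE ji; rewrite /a ji expr0n/= mul0r.
rewrite -E1.
pose c j (x : Rdd) : R := (r * W i j * cd x (lv i))%R.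
have mc j : measurable_fun [set: Rdd] (c j) by rewrite /c; meas.
have cu j x j' (t : R) : c j (upd x (lu j') t) = c j x.
  by rewrite /c cd_upd eq_sym (negbTE (luv _ _)).
have E2 : \int[g]_x (expR (\sum_j cd x (lu j) * c j x) * 1)%:E =
    \int[g]_x (expR (\sum_j c j x ^+ 2 / 2) * 1)%:E.
  exact: (@gauss_mgf_out _ _ _ _ _ lu_inj mc cu (fun=> 1%R)).
have -> : \int[g]_x (expR (\sum_i' cd x (lv i') * a i' x) * 1)%:E =
    \int[g]_x (expR (\sum_j cd x (lu j) * c j x) * 1)%:E.
  apply: eq_integral => x _; congr EFin; congr (expR _ * _)%R.
  rewrite (bigD1 i)//= big1 ?addr0; last by move=> j /negbTE ji; rewrite /a ji mulr0.
  rewrite /a eqxx /rowu 2!mulr_sumr; apply: eq_bigr => j _; rewrite /c; ring.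
rewrite E2.
apply: (@le_trans _ _ (\int[g]_x (expR ((1 - sg ^- 2) / 2 * cd x (lv i) ^+ 2))%:E)); last first.
  rewrite (@integral_gauss_coord _ _ (lv i) (fun t => (expR ((1 - sg ^- 2) / 2 * t ^+ 2))%:E)).
  - by rewrite gauss_sq_mgf.
  - apply/measurable_EFinP; apply: measurable_fun_expR.
    by apply: measurable_funM; [exact: measurable_cst|apply: measurable_funX].
  - by move=> x; rewrite lee_fin expR_ge0.
apply: le_integralr.
- apply: measurable_funM; last exact: measurable_cst.
  apply: measurable_fun_expR; apply: measurable_sum => j.
  by apply: measurable_funM; [apply: measurable_funX; exact: mc|exact: measurable_cst].
- apply: measurable_fun_expR; apply: measurable_funM; first exact: measurable_cst.
  by apply: measurable_funX; exact: mcd.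
- by move=> x; rewrite mulr1 expR_ge0.
move=> x; rewrite mulr1 ler_expR.
rewrite (_ : \sum_j _ = th * (\sum_j W i j ^+ 2) * cd x (lv i) ^+ 2)%R.
  by rewrite ler_wpM2r// sqr_ge0.
rewrite mulr_sumr mulr_suml; apply: eq_bigr => j _.
by rewrite /c !exprMn r2; field.
Qed.

(** The rows share the vector [u] and are dependent; Jensen over the [k] rows bounds the exponential
    of their sum by an average of one-row exponentials with [k c] in place of [c]. *)
Lemma integral_exp_quad W (c sg : R) : (0 <= c)%R -> (0 < sg)%R ->
  (forall i, (k%:R * c * (\sum_j W i j ^+ 2) <= (1 - sg ^- 2) / 2)%R) ->
  \int[g]_x (expR (c * quad W x))%:E <= sg%:E.
Proof.
move=> c0 sg0 H.
have kN : (k%:R : R) != 0%R by rewrite pnatr_eq0 -lt0n.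
have kc : (0 <= k%:R * c)%R by rewrite mulr_ge0.
have kV : (0 <= (k%:R : R)^-1)%R by rewrite invr_ge0.
apply: (@le_trans _ _ (\int[g]_x (k%:R^-1 * \sum_i expR (k%:R * c * rowu W i x ^+ 2))%:E)).
  have ms : measurable_fun [set: Rdd] (fun x => \sum_i expR (k%:R * c * rowu W i x ^+ 2))%R.
    by apply: measurable_sum => i; meas.
  apply: le_integralr; side.
  move=> x; apply: le_trans (expR_jensen _ k0).
  rewrite ler_expR /quad -mulr_sumr !mulrA mulVf// mul1r.
  by [].
rewrite integralZr_nneg; side.
under eq_integral do rewrite -sumEFin.
rewrite ge0_integral_sum//; last by move=> i; apply/measurable_EFinP; meas.
apply: (@le_trans _ _ (k%:R^-1%:E * \sum_(i < k) sg%:E)).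
  rewrite lee_wpmul2l ?lee_fin//; apply: lee_sum => i _.
  by apply: integral_exp_row.
by rewrite sumEFin sumr_const card_ord -EFinM lee_fin -[(sg *+ k)%R]mulr_natl mulrA mulVf// mul1r.
Qed.

(** Every row carries at most its share [w / k] of the squared Frobenius norm, which makes up for
    the factor [k] of the Jensen step. *)
Definition rows_le W (w : R) := forall i, (k%:R * \sum_j W i j ^+ 2 <= w)%R.

Lemma chaos_mgf W (t c : R) :
  \int[g]_x (expR (t * chaos W x + c * quad W x))%:E =
  \int[g]_x (expR ((t ^+ 2 / 2 + c) * quad W x))%:E.
Proof.
pose a i x : R := (t * rowu W i x)%R.
have ma i : measurable_fun [set: Rdd] (a i) by rewrite /a; meas.
have au i x j (s : R) : a i (upd x (lv j) s) = a i x by rewrite /a rowu_upd.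
pose G x := expR (c * quad W x).
have mG : measurable_fun [set: Rdd] G by rewrite /G; meas.
have G0 x : (0 <= G x)%R by exact: expR_ge0.
have Gu x j (s : R) : G (upd x (lv j) s) = G x.
  by rewrite /G; congr (expR (_ * _))%R; apply: eq_bigr => i _; rewrite rowu_upd.
have E := gauss_mgf_out lv_inj ma au mG G0 Gu.
transitivity (\int[g]_x (expR (\sum_i cd x (lv i) * a i x) * G x)%:E).
  apply: eq_integral => x _; rewrite expRD; congr (_ * _)%:E; congr expR.
  by rewrite /chaos mulr_sumr; apply: eq_bigr => i _; rewrite /a; ring.
rewrite E; apply: eq_integral => x _; rewrite mulrDl expRD; congr (_ * _)%:E; congr expR.
by rewrite /quad mulr_sumr; apply: eq_bigr => i _; rewrite /a exprMn; ring.
Qed.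

(** Integrating out [v] turns the squared density into [exp quad]; then [sg = 1 + 2 w] is admissible
    in [integral_exp_quad] as long as [w <= 1/4]. *)
Lemma chaos_density_second_moment W (w : R) : rows_le W w -> (0 <= w <= 4^-1)%R ->
  \int[g]_x (chaos_density W x ^+ 2)%:E <= (1 + 2 * w)%:E.
Proof.
move=> Ww /andP[w0 w4].
have -> : \int[g]_x (chaos_density W x ^+ 2)%:E =
    \int[g]_x (expR (2 * chaos W x + (- 1) * quad W x))%:E.
  by apply: eq_integral => x _; rewrite /chaos_density -expRM_natl; congr (expR _)%:E; field.
rewrite chaos_mgf (_ : 2 ^+ 2 / 2 + -1 = 1 :> R)%R; last by field.
have s0 : (0 < 1 + 2 * w)%R by lra.
apply: integral_exp_quad => // i; apply: (le_trans (y := w)).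
  by rewrite mulr1; exact: Ww.
have -> : ((1 - (1 + 2 * w) ^- 2) / 2 = w + w * (1 - 2 * w - 4 * w ^+ 2) / (1 + 2 * w) ^+ 2)%R.
  by field; rewrite gt_eqF.
rewrite lerDl divr_ge0 ?sqr_ge0// mulr_ge0//; nra.
Qed.

(** From [y^4 <= 24 (e^y + e^(-y))] at [y = s chaos]. The scale [s^2 = 1 / (2 w)] leaves
    [exp (quad / (4 w))], of mean at most 3/2, so the bound is [24 * 4 w^2 * 3 = 288 w^2]. *)
Lemma chaos_fourth_moment D (w : R) : rows_le D w -> (0 < w)%R ->
  \int[g]_x (chaos D x ^+ 4)%:E <= (288 * w ^+ 2)%:E.
Proof.
move=> Dw w0; pose s := ((Num.sqrt (2 * w))^-1)%R.
have w20 : (0 < 2 * w)%R by rewrite mulr_gt0.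
have s2 : (s ^+ 2 = (2 * w)^-1)%R by rewrite exprVn sqr_sqrtr// ltW.
have H t : (t ^+ 2 = (2 * w)^-1)%R -> \int[g]_x (expR (t * chaos D x))%:E <= (3 / 2)%:E.
  move=> t2; have -> : \int[g]_x (expR (t * chaos D x))%:E =
      \int[g]_x (expR (t * chaos D x + 0 * quad D x))%:E.
    by apply: eq_integral => x _; rewrite mul0r addr0.
  rewrite chaos_mgf addr0 t2.
  apply: integral_exp_quad; [by rewrite divr_ge0 ?invr_ge0// ltW|by lra|].
  move=> i; rewrite mulrAC.
  apply: (@le_trans _ _ (w * ((2 * w)^-1 / 2))%R).
    by rewrite ler_wpM2r ?divr_ge0 ?invr_ge0// ltW.
  by rewrite (_ : (w * ((2 * w)^-1 / 2) = 4^-1)%R); [lra|field; rewrite gt_eqF].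
have P1 := H s s2; have P2 := H (- s)%R (etrans (sqrrN s) s2).
have y4 (y : R) : (y ^+ 4 <= 24 * (expR y + expR (- y)))%R.
  have := @expR_ge1Dxn R `|y| 3 (normr_ge0 _).
  have -> : (`|y| ^+ 4 = y ^+ 4)%R by rewrite (exprM _ 2 2) real_normK ?num_real// -exprM.
  have : (expR `|y| <= expR y + expR (- y))%R.
    by case: (leP 0%R y) => y0; [rewrite ger0_norm// lerDl expR_ge0|rewrite ltr0_norm// lerDr expR_ge0].
  rewrite (_ : 4`!%:R = 24 :> R)%R//.
  by move=> h1 h2; rewrite mulrC -ler_pdivrMr//; lra.
apply: (@le_trans _ _ (\int[g]_x (96 * w ^+ 2 * (expR (s * chaos D x) + expR (- s * chaos D x)))%:E)).
  apply: le_integralr; side.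
  - by move=> x; rewrite (exprM _ 2 2) sqr_ge0.
  move=> x; have := y4 (s * chaos D x)%R; rewrite mulNr.
  have s4 : (s ^+ 4 = (4 * w ^+ 2)^-1)%R by rewrite (exprM _ 2 2) s2; field; rewrite gt_eqF.
  have w4 : (0 < 4 * w ^+ 2)%R by rewrite mulr_gt0// exprn_gt0.
  by rewrite exprMn s4 [(_^-1 * _)%R]mulrC ler_pdivrMr//; lra.
rewrite integralZr_nneg; side.
rewrite integralDr; side.
apply: (@le_trans _ _ ((96 * w ^+ 2)%:E * ((3 / 2)%:E + (3 / 2)%:E))).
  apply: lee_wpmul2l; last exact: leeD.
  by rewrite lee_fin mulr_ge0// sqr_ge0.
by rewrite -EFinD -EFinM lee_fin; lra.
Qed.

Let shiftW W := @shifts R d k lv (rowu W) (index_enum 'I_k).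

Lemma gauss_chaos W (F : Rdd -> \bar R) : measurable_fun [set: _] F ->
  (forall x, 0 <= F x) ->
  \int[g]_x F (shiftW W x) = \int[g]_x (F x * (chaos_density W x)%:E).
Proof.
move=> mF F0; rewrite /shiftW (gauss_shifts lv_inj (mrow W) (rowu_upd W) (index_enum_uniq _) mF F0).
apply: eq_integral => x _; congr (_ * _); congr (expR _)%:E.
rewrite /chaos /quad mulr_suml -sumrB.
by [].
Qed.

Lemma chaos_shift W D x :
  chaos D (shiftW W x) = (\sum_i (cd x (lv i) + rowu W i x) * rowu D i x)%R.
Proof.
have su (i : 'I_k) x' j (t : R) : rowu D i (upd x' (lv j) t) = rowu D i x' := rowu_upd D i x' j t.
apply: eq_bigr => i _; rewrite /shiftW (cd_shifts (rowu_upd W)) ?index_enum_uniq//.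
congr (_ * _)%R; last first.
  apply: eq_bigr => j _; congr (_ * _)%R; rewrite (cd_shifts (rowu_upd W)) ?index_enum_uniq//.
  by rewrite big1 ?addr0// => i' /eqP E; move: (luv i' j); rewrite E eqxx.
congr (_ + _)%R; rewrite (eq_bigl (pred1 i)); first by rewrite big_pred1_eq.
by move=> j; rewrite /= (inj_eq lv_inj).
Qed.

(** After the shift the form is [v . D u + W u . D u]. The first part has mean zero, since it pairs
    distinct coordinates; the second has mean [m2] times the Frobenius product of [W] and [D]. *)
Lemma has_mean_chaos_shift W D :
  has_mean g (fun x => chaos D (shiftW W x)) (@m2 R * \sum_i \sum_j W i j * D i j)%R.
Proof.
have hc a b : has_mean g (fun x => cd x a * cd x b)%R (if a == b then @m2 R else 0)%R.
  by split; [exact: integrable_cd2|exact: integral_cd2].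
have -> : (fun x => chaos D (shiftW W x)) = (fun x => \sum_i (\sum_j D i j * (cd x (lv i) * cd x (lu j)) +
     \sum_j \sum_l (W i l * D i j) * (cd x (lu l) * cd x (lu j))))%R.
  apply/funext => x; rewrite chaos_shift; apply: eq_bigr => i _.
  rewrite mulrDl; congr (_ + _)%R.
    by rewrite /rowu mulr_sumr; apply: eq_bigr => j _; ring.
  rewrite /rowu mulr_sumr; apply: eq_bigr => j _; rewrite mulr_suml.
  by apply: eq_bigr => l _; ring.
rewrite mulr_sumr; apply: has_mean_sum => i.
rewrite (_ : _ * _ = \sum_j D i j * 0 + \sum_j \sum_l (W i l * D i j) * (if l == j then @m2 R else 0))%R.
  apply: has_meanD; apply: has_mean_sum => j.
    by apply: has_meanZ; have := hc (lv i) (lu j); rewrite eq_sym (negbTE (luv _ _)).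
  apply: has_mean_sum => l; apply: has_meanZ.
  by have := hc (lu l) (lu j); rewrite (inj_eq lu_inj).
rewrite [X in _ = (X + _)%R]big1 ?add0r; last by move=> j _; rewrite mulr0.
rewrite mulr_sumr; apply: eq_bigr => j _.
rewrite (bigD1 j)//= eqxx big1 ?addr0; first by rewrite mulrC.
by move=> l /negbTE ->; rewrite mulr0.
Qed.

Lemma chaos_density_int1 W : \int[g]_x (chaos_density W x)%:E = 1.
Proof.
have := @gauss_chaos W (cst 1) (measurable_cst _) (fun=> lee01).
rewrite integral_cst//= probability_setT mule1 => ->.
by apply: eq_integral => x _; rewrite mul1e.
Qed.

(** With [D = W - W'] as test form the gap between the means is [m2 |D|^2], and [m2 >= 1/2] turns
    the assumed [w / (30 * 60)] into the gap [w / (60 * 60)] of the test-function bound. *)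
Lemma chaos_tv_lower W W' (w : R) : (0 < w <= 4^-1)%R ->
  rows_le W w -> rows_le W' w -> rows_le (fun i j => W i j - W' i j)%R w ->
  (w / (30 * 60) <= \sum_i \sum_j (W i j - W' i j) ^+ 2)%R ->
  (Num.sqrt w / (120 * 60 * (296 * (30 * 60))))%:E <=
  \int[g]_x (Num.max (chaos_density W x - chaos_density W' x) 0)%:E.
Proof.
move=> /andP[w0 w4] Ww Ww' Dw Dfar; pose D i j := (W i j - W' i j)%R.
have w01 : (0 <= w <= 4^-1)%R by rewrite ltW.
have mean V : exists A B : R, [/\
    \int[g]_x (Num.max (chaos D x) 0 * chaos_density V x)%:E = A%:E,
    \int[g]_x (Num.max (- chaos D x) 0 * chaos_density V x)%:E = B%:E &
    (A - B = @m2 R * \sum_i \sum_j V i j * D i j)%R].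
  have [A [B [EA EB AB]]] := has_mean_parts (has_mean_chaos_shift V D).
  have mpos (h : Rdd -> R) : measurable_fun [set: Rdd] h ->
      measurable_fun [set: Rdd] (fun x => (Num.max (h x) 0)%:E).
    by move=> mh; apply/measurable_EFinP; apply: measurable_maxr.
  have pos0 (y : R) : 0 <= (Num.max y 0)%:E by rewrite lee_fin le_max lexx orbT.
  exists A, B; split => //.
    rewrite -EA (gauss_chaos V (mpos _ (mchaos D)) (fun x => pos0 _)).
    by apply: eq_integral => x _; rewrite EFinM.
  rewrite -EB (gauss_chaos V (mpos _ (measurable_fun_oppr (mchaos D))) (fun x => pos0 _)).
  by apply: eq_integral => x _; rewrite EFinM.
have [A [B [EA EB AB]]] := mean W.
have [A' [B' [EA' EB' AB']]] := mean W'.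
apply: (@test_function_tv_lower _ _ _ g _ _ (chaos D) w A B A' B') => //.
- by move=> x; exact: expR_ge0.
- by move=> x; exact: expR_ge0.
- exact: chaos_density_int1.
- exact: chaos_density_int1.
- exact: chaos_density_second_moment.
- exact: chaos_density_second_moment.
- exact: chaos_fourth_moment.
have -> : ((A - B) - (A' - B') = @m2 R * \sum_i \sum_j D i j ^+ 2)%R.
  rewrite AB AB' -mulrBr; congr (_ * _)%R; rewrite -sumrB; apply: eq_bigr => i _.
  by rewrite -sumrB; apply: eq_bigr => j _; rewrite /D; ring.
have m2g := @m2_ge R.
apply: (@le_trans _ _ (2^-1 * (w / (30 * 60)))%R); first by lra.
by apply: ler_pM => //; rewrite divr_ge0// ltW.
Qed.

End chaos.

(** * Measurability of total variation balls *)

Section tv.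
Context {R : realType} {d : measure_display} {T : measurableType d}.
Implicit Types P Q : probability T R.
Local Open Scope ereal_scope.

Lemma tv_distP P Q (a : R) : tv_dist P Q <= a%:E <->
  forall A, measurable A -> (`|fine (P A) - fine (Q A)| <= a)%R.
Proof.
have fin M (A : set T) : measurable A -> (M : probability T R) A = (fine (M A))%:E.
  by move=> mA; rewrite fineK// fin_num_measure.
split=> [h A mA|h].
  rewrite -lee_fin; apply: le_trans h; apply: ereal_sup_ubound.
  by exists A => //; rewrite (fin P)// (fin Q)// -EFinB abse_EFin.
apply: ge_ereal_sup => _ [A mA <-].
by rewrite (fin P)// (fin Q)// -EFinB abse_EFin lee_fin; exact: h.
Qed.

End tv.

Section countable_algebra.
Context {R : realType} {d : measure_display} {T : measurableType d}.
Variable G : nat -> set T.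
Hypothesis mG : forall i, measurable (G i).
Hypothesis genG : forall S : set (set T), sigma_algebra setT S ->
  (forall i, S (G i)) -> forall A, measurable A -> S A.

Definition code (n : nat) (x : T) : n.-tuple bool := [tuple `[< G i x >] | i < n].

(** Members of the algebra generated by [G], coded by a truth table on the first [n] generators; the
    finite code makes countability immediate. *)
Definition alg (c : {n : nat & {set n.-tuple bool}}) : set T :=
  [set x | code (tag c) x \in tagged c].

Lemma measurable_alg c : measurable (alg c).
Proof.
case: c => n S; rewrite /alg /=.
rewrite (_ : [set _ | _] = \big[setU/set0]_(t in S)
    \big[setI/setT]_(i < n) (if tnth t i then G i else ~` G i)).
  apply: bigsetU_measurable => t _; apply: bigsetI_measurable => i _.
  by case: (tnth t i) => //; exact: measurableC.
apply/seteqP; split=> x /=.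
  move=> xS; rewrite -bigcup_seq_cond; exists (code n x).
    by rewrite /= mem_index_enum xS.
  rewrite -bigcap_seq => i _ /=; rewrite tnth_mktuple.
  by case: ifPn => /asboolP.
rewrite -bigcup_seq_cond => -[t /= /andP[_ tS]]; rewrite -bigcap_seq => xt.
suff -> : code n x = t by [].
apply: eq_from_tnth => i; rewrite tnth_mktuple.
have := xt i; rewrite /= mem_index_enum => /(_ isT).
by case: (tnth t i) => ?; [exact/asboolP|exact/asboolPn].
Qed.

Lemma algC c : exists c', alg c' = ~` alg c.
Proof.
case: c => n S; exists (existT _ n (~: S)%SET); apply/seteqP; split=> x; rewrite /alg /=.
  by rewrite inE => /negP.
by rewrite inE => /negP.
Qed.

Lemma alg_widen n (S : {set n.-tuple bool}) m : (n <= m)%N ->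
  exists S' : {set m.-tuple bool}, alg (existT _ m S') = alg (existT _ n S).
Proof.
move=> nm; exists [set t : m.-tuple bool | [tuple tnth t (widen_ord nm i) | i < n] \in S]%SET.
apply/seteqP; split=> x; rewrite /alg /= inE => h; [|].
  suff -> : code n x = [tuple tnth (code m x) (widen_ord nm i) | i < n] by [].
  by apply: eq_from_tnth => i; rewrite !tnth_mktuple.
suff <- : code n x = [tuple tnth (code m x) (widen_ord nm i) | i < n] by [].
by apply: eq_from_tnth => i; rewrite !tnth_mktuple.
Qed.

Lemma algU c1 c2 : exists c, alg c = alg c1 `|` alg c2.
Proof.
case: c1 => n S; case: c2 => m S'.
have [S1 <-] := alg_widen S (leq_maxl n m).
have [S2 <-] := alg_widen S' (leq_maxr n m).
exists (existT _ (maxn n m) (S1 :|: S2)%SET); apply/seteqP; split=> x; rewrite /alg /=.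
  by rewrite inE => /orP[]; [left|right].
by rewrite inE => -[->|->]; rewrite ?orbT.
Qed.

Lemma alg_gen i : exists c, alg c = G i.
Proof.
exists (existT _ i.+1 [set t : i.+1.-tuple bool | tnth t ord_max]%SET).
apply/seteqP; split=> x; rewrite /alg /= inE tnth_mktuple => /asboolP//.
Qed.

Lemma alg0 : exists c, alg c = set0.
Proof.
exists (existT _ 0%N (finset.set0 : {set 0.-tuple bool})).
by apply/seteqP; split=> x; rewrite /alg /= ?inE.
Qed.

Local Open Scope ereal_scope.
Variables P Q : probability T R.

(** The same [c] has to serve both measures, because [tv_dist_alg] compares [P] and [Q] on one set
    of the algebra. *)
Let near_alg (A : set T) := measurable A /\ forall e : R, (0 < e)%R ->
  exists c, P (A `+` alg c) < e%:E /\ Q (A `+` alg c) < e%:E.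

Let near_algC A : near_alg A -> near_alg (~` A).
Proof.
move=> [mA h]; split; first exact: measurableC.
move=> e /h[c [h1 h2]]; have [c' E] := algC c; exists c'.
suff -> : ~` A `+` alg c' = A `+` alg c by [].
rewrite E; apply/seteqP; split=> x /=.
  by move=> [[nA /contrapT ?]|[nc /contrapT ?]]; [right|left].
by move=> [[? nc]|[? nA]]; [right; split => //; exact/(_ _)|left; split => //]; move=> ?.
Qed.

Let near_alg_sub (A B : set T) (MA : measurable A) (MB : measurable B) c :
  measurable (A `+` alg c).
Proof. by apply: measurableU; apply: measurableD => //; exact: measurable_alg. Qed.

Let near_algU A B : near_alg A -> near_alg B -> near_alg (A `|` B).
Proof.
move=> [mA hA] [mB hB]; split; first exact: measurableU.
move=> e e0; have e2 : (0 < e / 2)%R by rewrite divr_gt0.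
have [c1 [p1 q1]] := hA _ e2; have [c2 [p2 q2]] := hB _ e2.
have [c E] := algU c1 c2; exists c.
have sub : (A `|` B) `+` alg c `<=` (A `+` alg c1) `|` (B `+` alg c2).
  rewrite E => x /= [[[Ax|Bx] /not_orP[n1 n2]]|[[c1x|c2x] /not_orP[nA nB]]].
  - by left; left.
  - by right; left.
  - by left; right.
  - by right; right.
have m1 := near_alg_sub mA mA c1; have m2 := near_alg_sub mB mB c2.
have mU := near_alg_sub (measurableU _ _ mA mB) mA c.
have bd (M : probability T R) : M (A `+` alg c1) < (e / 2)%:E -> M (B `+` alg c2) < (e / 2)%:E ->
    M ((A `|` B) `+` alg c) < e%:E.
  move=> h1 h2; apply: (@le_lt_trans _ _ (M ((A `+` alg c1) `|` (B `+` alg c2)))).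
    by apply: le_measure; rewrite ?inE//; exact: measurableU.
  apply: (@le_lt_trans _ _ (M (A `+` alg c1) + M (B `+` alg c2))).
    exact: measureU2.
  by rewrite (splitr e) EFinD lteD.
by split; apply: bd.
Qed.

Let near_alg_bigU (F : (set T)^nat) n : (forall i, near_alg (F i)) ->
  near_alg (\big[setU/set0]_(i < n) F i).
Proof.
move=> hF; elim: n => [|n IH].
  rewrite big_ord0; split => // e e0; have [c E] := alg0; exists c.
  by rewrite E setYK !measure0 lte_fin.
by rewrite big_ord_recr/=; apply: near_algU.
Qed.

Let near_alg_sigma : sigma_algebra setT near_alg.
Proof.
split.
- split => // e e0; have [c E] := alg0; exists c.
  by rewrite E setYK !measure0 lte_fin.
- by move=> A; rewrite setTD; exact: near_algC.
move=> F hF.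
have mF i : measurable (F i) by case: (hF i).
have mU : measurable (\bigcup_i F i) by exact: bigcupT_measurable.
pose S n := \big[setU/set0]_(i < n) F i.
have mS n : measurable (S n) by exact: bigsetU_measurable.
split => // e e0; have e2 : (0 < e / 2)%R by rewrite divr_gt0.
(* By continuity from below a finite union carries almost all of the mass, and finite unions are
   covered by [near_alg_bigU]. *)
have cv (M : probability T R) : \forall n \near \oo, M ((\bigcup_i F i) `\` S n) < (e / 2)%:E.
  have ndS : nondecreasing_seq S.
    by apply/nondecreasing_seqP => n; rewrite /S big_ord_recr/= subsetEset; exact: subsetUl.
  have c1 : M (S n) @[n --> \oo] --> M (\bigcup_i F i).
    rewrite (_ : \bigcup_i F i = \bigcup_n S n); last first.
      apply/seteqP; split=> [x [i _ Fi]|x [n _]].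
        by exists i.+1 => //; rewrite /S big_ord_recr/=; right.
      by rewrite /S -bigcup_mkord => -[i _ Fi]; exists i.
    by apply: nondecreasing_cvg_mu => //; rewrite -?bigcup_mkord; exact: bigcupT_measurable.
  have fU : M (\bigcup_i F i) \is a fin_num by rewrite fin_num_measure.
  have fS n : M (S n) \is a fin_num by rewrite fin_num_measure.
  have Ed n : M ((\bigcup_i F i) `\` S n) = M (\bigcup_i F i) - M (S n).
    rewrite measureD// ?ltey_eq ?fU//; congr (_ - M _).
    by rewrite setIC; apply/setIidPl; rewrite /S -bigcup_mkord; apply: bigcup_sub => i _; exact: bigcup_sup.
  move: c1; rewrite -[X in _ --> X](fineK fU) => /fine_cvgP[_ /cvgrPdist_lt /(_ _ e2)].
  apply: filterS => n /=; rewrite Ed => h.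
  rewrite -(fineK fU) -(fineK (fS n)) -EFinB lte_fin.
  by apply: le_lt_trans h; exact: ler_norm.
have [n [hP hQ]] : exists n, P ((\bigcup_i F i) `\` S n) < (e / 2)%:E /\ Q ((\bigcup_i F i) `\` S n) < (e / 2)%:E.
  by have [n [? ?]] := filter_ex (filterI (cv P) (cv Q)); exists n.
have [_ /(_ _ e2)[c [pc qc]]] := near_alg_bigU n hF.
exists c.
have bd (M : probability T R) : M ((\bigcup_i F i) `\` S n) < (e / 2)%:E -> M (S n `+` alg c) < (e / 2)%:E ->
    M ((\bigcup_i F i) `+` alg c) < e%:E.
  move=> h1 h2.
  have sub : (\bigcup_i F i) `+` alg c `<=` ((\bigcup_i F i) `\` S n) `|` (S n `+` alg c).
    move=> x /= [[Ux nc]|[cx nU]].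
      by have [Sx|nSx] := pselect (S n x); [right; left|left].
    right; right; split => // Sx; apply: nU; move: Sx.
    by rewrite /S -bigcup_mkord => -[i _ Fi]; exists i.
  have m1 := near_alg_sub (mS n) mU c; have m2 := near_alg_sub mU mU c.
  have m3 : measurable ((\bigcup_i F i) `\` S n) by exact: measurableD.
  apply: (@le_lt_trans _ _ (M (((\bigcup_i F i) `\` S n) `|` (S n `+` alg c)))).
    by apply: le_measure; rewrite ?inE//; exact: measurableU.
  apply: (@le_lt_trans _ _ (M ((\bigcup_i F i) `\` S n) + M (S n `+` alg c))).
    exact: measureU2.
  by rewrite (splitr e) EFinD lteD.
by split; apply: bd.
Qed.

(* A countable algebra generating the sigma-algebra is dense for the
   pseudo-metric [P (A `+` B) + Q (A `+` B)], so it computes the distance. *)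
Lemma tv_dist_alg (a : R) :
  (forall c, (`|fine (P (alg c)) - fine (Q (alg c))| <= a)%R) ->
  tv_dist P Q <= a%:E.
Proof.
move=> h; apply/tv_distP => A mA; apply/ler_addgt0Pr => e e0.
have e2 : (0 < e / 2)%R by rewrite divr_gt0.
have gG i : near_alg (G i).
  split => // e' e0'; have [c' E] := alg_gen i; exists c'.
  by rewrite E setYK !measure0 lte_fin.
have [_ /(_ _ e2)[c [pc qc]]] := genG near_alg_sigma gG mA.
have mc := measurable_alg c.
have df (M : probability T R) : M (A `+` alg c) < (e / 2)%:E ->
    (`|fine (M A) - fine (M (alg c))| <= e / 2)%R.
  have mD := near_alg_sub mA mA c.
  have [f1 f2 f3] : [/\ M A \is a fin_num, M (alg c) \is a fin_num & M (A `+` alg c) \is a fin_num].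
    by split; rewrite fin_num_measure.
  rewrite -(fineK f3) lte_fin => /ltW hM.
  have h1 : (fine (M A) <= fine (M (alg c)) + fine (M (A `+` alg c)))%R.
    rewrite -lee_fin EFinD !fineK//; apply: le_trans (measureU2 M mc mD).
    apply: le_measure; rewrite ?inE//; first exact: measurableU.
    by move=> x Ax; have [cx|ncx] := pselect (alg c x); [left|right; left].
  have h2 : (fine (M (alg c)) <= fine (M A) + fine (M (A `+` alg c)))%R.
    rewrite -lee_fin EFinD !fineK//; apply: le_trans (measureU2 M mA mD).
    apply: le_measure; rewrite ?inE//; first exact: measurableU.
    by move=> x Ax; have [cx|ncx] := pselect (A x); [left|right; right].
  by rewrite ler_norml; apply/andP; split; lra.
have := df P pc; have := df Q qc; have := h c.
rewrite !ler_norml => /andP[? ?] /andP[? ?] /andP[? ?]; apply/andP; split; lra.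
Qed.

End countable_algebra.

Section tv_ball.
Context {R : realType} {d : measure_display} {T : measurableType d}.
Variable G : nat -> set T.
Hypothesis mG : forall i, measurable (G i).
Hypothesis genG : forall S : set (set T), sigma_algebra setT S ->
  (forall i, S (G i)) -> forall A, measurable A -> S A.

Lemma measurable_eval (A : set T) : measurable A ->
  measurable_fun [set: pprobability T R] (fun Q : pprobability T R => Q A).
Proof.
move=> mA.
apply: (measurability _ (ErealGenInftyO.measurableE R)) => _ /= -[_ [r ->] <-].
rewrite setTI preimage_itvNyo -/(mset A r).
(* The generators of the sigma-algebra on distributions have thresholds in [[0, 1]]; the other
   thresholds give trivial sets. *)
have [r0|r0] := leP 0%R r; last by rewrite lt0_mset.
have [r1|r1] := leP r 1%R; last by rewrite gt1_mset.
by apply: sub_sigma_algebra; exists r => /=; [rewrite in_itv/= r0|exists A].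
Qed.

(** By [tv_dist_alg] the ball is cut out by countably many conditions, each on one evaluation at a
    set of the algebra. *)
Lemma measurable_tv_ball (D : probability T R) (a : R) :
  measurable [set Q : pprobability T R | (tv_dist Q D <= a%:E)%E].
Proof.
rewrite (_ : [set _ | _] = \bigcap_c
    [set Q : pprobability T R | `|fine (Q (alg G c)) - fine (D (alg G c))| <= a]).
  rewrite -[X in measurable X]setCK setC_bigcap; apply: measurableC.
  apply: countable_bigcupT_measurable => [|c]; first exact: countableP.
  apply: measurableC.
  have mf : measurable_fun [set: pprobability T R]
      (fun Q : pprobability T R => `|fine (Q (alg G c)) - fine (D (alg G c))|).
    apply: measurableT_comp => //; apply: measurable_funB => //.
    apply: (measurableT_comp (f := fine)) => //.
    by apply: measurable_eval; exact: measurable_alg.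
  set h := (fun Q : pprobability T R => _) in mf.
  have E : [set Q : pprobability T R | h Q <= a] = h @^-1` `]-oo, a]%classic.
    by apply/seteqP; split=> Q; rewrite /= in_itv.
  rewrite -[X in measurable X]setTI -/(h _).
  have := mf measurableT `]-oo, a]%classic (measurable_itv _).
  by rewrite -E.
apply/seteqP; split=> Q /=.
  by move=> /tv_distP h c _; apply: h; exact: measurable_alg.
by move=> h; apply: (tv_dist_alg mG genG) => c; exact: h.
Qed.

End tv_ball.

Section Rd_generators.
Context {R : realType} {d : nat}.

Definition Rd_gen_of (z : option ('I_d * rat)) : set (@Rd R d) :=
  if z is Some (i, q) then [set x | (ratr q : R) < cd x i] else set0.

Definition Rd_gen (n : nat) : set (@Rd R d) := Rd_gen_of (unpickle n).

Lemma measurable_Rd_gen n : measurable (Rd_gen n).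
Proof.
rewrite /Rd_gen; case: (unpickle n) => [[i q]|]//=.
have := @measurable_cd R d i measurableT `](ratr q : R), +oo[%classic (measurable_itv _).
rewrite setTI (_ : _ @^-1` _ = [set x | (ratr q : R) < cd x i])//.
by apply/seteqP; split=> x; rewrite /= in_itv/= andbT.
Qed.

Lemma Rd_gen_generates (S : set (set (@Rd R d))) : sigma_algebra setT S ->
  (forall i, S (Rd_gen i)) -> forall A, measurable A -> S A.
Proof.
move=> sS SG A mA.
have Sq i q : S [set x | (ratr q : R) < cd x i].
  by have := SG (pickle (i, q)); rewrite /Rd_gen pickleK.
have SU (F : nat -> set (@Rd R d)) : (forall i, S (F i)) -> S (\bigcup_i F i).
  by case: sS => _ _; apply.
have Sray i (r : R) : S [set x | r < cd x i].
  rewrite (_ : [set _ | _] = \bigcup_n (if unpickle n is Some q then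
     (if (r < ratr q) then [set x : @Rd R d | (ratr q : R) < cd x i] else set0) else set0)).
    apply: SU => n; case: (unpickle n) => [q|]; last by case: sS.
    by case: ifP => _ //; case: sS.
  apply/seteqP; split=> x /=.
    move=> /rat_in_itvoo[q]; rewrite in_itv/= => /andP[rq qx].
    by exists (pickle q); [exact: I|rewrite pickleK rq; exact: qx].
  move=> [n _]; case: (unpickle n) => [q|]; last by [].
  by case: (ltP r (ratr q)) => [rq qx|_]; [exact: (lt_trans rq qx)|].
have Spre i (B : set (measurableTypeR R)) : measurable B -> S (cd^~ i @^-1` B).
  move=> mB; pose C := [set B : set R | S (cd^~ i @^-1` B)].
  have sC : sigma_algebra setT C.
    case: sS => S0 SC SU'; split.
    - by rewrite /C /= preimage_set0.
    - by move=> B' CB; rewrite /C /= setTD; have := SC _ CB; rewrite setTD.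
    - by move=> F CF; rewrite /C /= preimage_bigcup; exact: SU'.
  have mB' : (@RGenOInfty.G R).-sigma.-measurable B by rewrite -RGenOInfty.measurableE.
  apply: (mB' C); split => // _ [r ->].
  rewrite /C /=; rewrite (_ : _ @^-1` _ = [set x | r < cd x i]) //.
  by apply/seteqP; split=> x; rewrite /= in_itv/= andbT.
apply: (mA S); split => //.
rewrite -bigcup_seq => B [i _ [C mC <-]]; rewrite setTI.
exact: Spre.
Qed.

Lemma measurable_Gauss_correct (r kappa alpha : R) (D : probability (@Rd R d) R) :
  measurable (correct (Gauss r d kappa alpha) D).
Proof. exact: (measurable_tv_ball measurable_Rd_gen Rd_gen_generates). Qed.

End Rd_generators.

(** * Packings *)

Section hamming.
Variables (T : finType).
Local Notation word := {ffun T -> 'I_16}.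
Implicit Types a b : word.

Definition agree a b := #|[pred x | a x == b x]|.

(** Markov's inequality with weight [16 ^ agree a b]: over all [b] the weights add up to a power of
    31, as each position contributes 16 for the matching letter and 1 for each of the 15 others. *)
Lemma agree_ball a (D : nat) :
  (#|[pred b | (#|T| <= agree a b + D)%N]| * 16 ^ #|T| <= 32 ^ #|T| * 16 ^ D)%N.
Proof.
have E : (\sum_(b : word) \prod_(x : T) (if b x == a x then 16 else 1) = 31 ^ #|T|)%N.
  rewrite -(bigA_distr_bigA (fun x v => if v == a x then 16 else 1)%N).
  rewrite (eq_bigr (fun=> 31%N)); first by rewrite prod_nat_const.
  move=> x _; rewrite (bigD1 (a x))//= eqxx (eq_bigr (fun=> 1%N)); last first.
    by move=> v /negbTE ->.
  by rewrite sum1_card cardC1 card_ord.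
apply: (@leq_trans (31 ^ #|T| * 16 ^ D)); last first.
  by rewrite leq_mul2r; apply/orP; right; case: (#|T|) => // n; rewrite leq_exp2r.
rewrite -E -sum1_card big_distrl/= big_distrl/=.
rewrite [leqRHS](bigID [pred b | (#|T| <= agree a b + D)%N])/=.
apply: leq_trans (leq_addr _ _); apply: leq_sum => b; rewrite inE => hb.
rewrite mul1n (_ : \prod_(x : T) _ = 16 ^ agree a b)%N.
  by rewrite -expnD leq_exp2l.
rewrite /agree -[RHS]prod_nat_const [RHS]big_mkcond/=; apply: eq_bigr => x _.
by rewrite inE eq_sym.
Qed.

(** The ball has at most [2^N * 16^D] words with [8 D <= N]; squaring keeps the estimate among
    natural numbers. *)
Lemma agree_ball_sq a (D : nat) : (8 * D <= #|T|)%N ->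
  (#|[pred b | (#|T| <= agree a b + D)%N]| ^ 2 <= 8 ^ #|T|)%N.
Proof.
move=> hD; have := agree_ball a D; set c := #|_|; set N := #|T| => h.
have h1 : (c <= 2 ^ N * 16 ^ D)%N.
  rewrite -(leq_pmul2r (m := 16 ^ N)) ?expn_gt0//; apply: leq_trans h _.
  by rewrite mulnAC -expnMn.
apply: (@leq_trans ((2 ^ N * 16 ^ D) ^ 2)); first by rewrite leq_exp2r.
rewrite expnMn -!expnM (mulnC N) (mulnC D) !expnM.
rewrite (_ : (16 ^ 2 = 2 ^ 8)%N)// -(expnM 2 8).
apply: (@leq_trans ((2 ^ 2) ^ N * 2 ^ N)); first by rewrite leq_mul2l leq_exp2l// hD orbT.
by rewrite -expnMn.
Qed.

Lemma cluster_card (S : pred word) (D : nat) : (8 * D <= #|T|)%N ->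
  (forall a b, S a -> S b -> (#|T| <= agree a b + D)%N) ->
  (#|S| ^ 2 <= 8 ^ #|T|)%N.
Proof.
move=> hD hS; case: (pickP S) => [a Sa|S0]; last by rewrite eq_card0// exp0n// expn_gt0.
apply: leq_trans (agree_ball_sq a hD); rewrite leq_exp2r//.
by apply: subset_leq_card; apply/fintype.subsetP => b Sb; rewrite inE; exact: hS.
Qed.

End hamming.

Section separation.
Context {R : realType} {d : measure_display} {T : measurableType d}.
Local Open Scope ereal_scope.

Lemma density_scheffe (P P' Q : probability T R) (p p' : T -> R) :
  has_density P Q p -> has_density P' Q p' ->
  exists2 B, measurable B &
    P B = P' B + \int[Q]_x (Num.max (p x - p' x) 0)%:E.
Proof.
move=> [mp p0 PQ] [mp' p0' PQ']; pose B := [set x | (p' x < p x)%R].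
have mB : measurable B.
  rewrite (_ : B = [set: T] `&` (fun x => (p' x < p x)%R) @^-1` [set true]).
    exact: (measurable_fun_ltr mp' mp).
  by apply/seteqP; split=> x //= [].
have mI : measurable_fun [set: T] (\1_B : T -> R) by exact: measurable_indic.
have I0 x : (0 <= (\1_B x : R))%R by [].
have tr (M : probability T R) : M B = \int[M]_x (\1_B x)%:E by rewrite integral_indic ?setIT.
have mE : measurable_fun [set: T] (fun x => (\1_B x : R)%:E) by exact/measurable_EFinP.
have E0 x : 0 <= (\1_B x : R)%:E by rewrite lee_fin.
have mm : measurable_fun [set: T] (fun x => Num.max (p x - p' x) 0)%R.
  by apply: measurable_maxr; meas.
have m0 x : (0 <= Num.max (p x - p' x) 0)%R by rewrite le_max lexx orbT.
exists B => //; rewrite !tr (PQ _ mE E0) (PQ' _ mE E0).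
under eq_integral do rewrite -EFinM.
under [X in _ = X + _]eq_integral do rewrite -EFinM.
rewrite -integralDr; side.
apply: eq_integral => x _; congr EFin; rewrite indicE.
have [xB|xB] := boolP (x \in B).
  by move/set_mem: xB => /= h; rewrite !mul1r max_l ?subr_ge0 ?ltW//; ring.
have : ~ B x by move=> ?; move/negP: xB; apply; exact/mem_set.
by move=> /negP; rewrite -leNgt => h; rewrite !mul0r max_r ?subr_le0// addr0.
Qed.

Lemma tv_ball_meet (o P P' : probability T R) (a : R) :
  tv_dist o P <= a%:E -> tv_dist o P' <= a%:E ->
  forall B, measurable B -> (fine (P B) <= fine (P' B) + 2 * a)%R.
Proof.
move=> /tv_distP h /tv_distP h' B mB; have := h B mB; have := h' B mB.
by rewrite !ler_norml => /andP[? ?] /andP[? ?]; lra.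
Qed.

End separation.

Section gaussian_packing.
Context {R : realType}.
Variables (kappa : R) (kappa_gt1 : 1 < kappa).

(** In place of pairwise separation, an output may be correct for up to [V] members: the averaging
    argument sees only the ratio of [#|I|] to [V], which must be exponential in [d^2]. *)
Definition packing (d : nat) (r alpha X : R) : Prop :=
  exists (I : finType) (P : I -> probability (@Rd R d) R)
    (Q : probability (@Rd R d) R) (p : I -> @Rd R d -> R) (V N : nat),
  [/\ [/\ forall i, has_density (P i) Q (p i),
      forall i, (\int[Q]_x (p i x ^+ 2)%:E <= X%:E)%E &
      forall i, valid (Gauss r d kappa alpha) (P i)],
    forall o, (\sum_(i : I) (o \in correct (Gauss r d kappa alpha) (P i)) <= V)%N,
    (5 ^ N * V <= #|I|)%N, (0 < V)%N & (d ^ 2 <= 9 * N)%N ].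

(** The reference covariance [c] is the midpoint of 1 and [kappa]; [th] is the relative radius with
    [c (1 + 3 th) = kappa] and [c (1 - 2 th) >= 1]. *)
Let c := (1 + kappa) / 2.
Let th := (kappa - 1) / (3 * (1 + kappa)).

Lemma affine_scale d (q : R) (z : @Rd R d) i :
  cd (affine_map 0 q%:M z) i = q * cd z i.
Proof.
rewrite /cd tnth_mktuple mxE add0r (bigD1 i)//= mxE eqxx mulr1n big1 ?addr0//.
by move=> j /negbTE ji; rewrite mxE eq_sym ji mulr0n mul0r.
Qed.

Lemma affine_scaleK d (q : R) (z : @Rd R d) : q != 0 ->
  affine_map 0 (q^-1)%:M (affine_map 0 q%:M z) = z.
Proof.
by move=> q0; apply: eq_from_tnth => i; rewrite -!/(cd _ i) !affine_scale mulKf.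
Qed.

Lemma norm2_sq d (v : 'cV[R]_d) : (v^T *m v) 0 0 = \sum_i v i 0 ^+ 2.
Proof. by rewrite mxE; apply: eq_bigr => i _; rewrite mxE expr2. Qed.

(** Cauchy-Schwarz for each row, by Lagrange's identity. *)
Lemma frob_le d (A : 'M[R]_d) (v : 'cV[R]_d) :
  \sum_i (A *m v) i 0 ^+ 2 <= (\sum_i \sum_j A i j ^+ 2) * \sum_j v j 0 ^+ 2.
Proof.
rewrite mulr_suml; apply: ler_sum => i _; rewrite mxE.
set a := fun j => A i j; set b := fun j => v j 0.
rewrite -subr_ge0.
have -> : (\sum_j A i j ^+ 2) * (\sum_j v j 0 ^+ 2) - (\sum_j A i j * v j 0) ^+ 2 =
   2^-1 * \sum_j \sum_l (a j * b l - a l * b j) ^+ 2.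
  have E1 : (\sum_j A i j ^+ 2) * (\sum_j v j 0 ^+ 2) = \sum_j \sum_l a j ^+ 2 * b l ^+ 2.
    by rewrite mulr_suml; apply: eq_bigr => j _; rewrite mulr_sumr.
  have E2 : (\sum_j A i j ^+ 2) * (\sum_j v j 0 ^+ 2) = \sum_j \sum_l a l ^+ 2 * b j ^+ 2.
    by rewrite E1 exchange_big.
  have E3 : (\sum_j A i j * v j 0) ^+ 2 = \sum_j \sum_l a j * b j * (a l * b l).
    by rewrite expr2 mulr_suml; apply: eq_bigr => j _; rewrite mulr_sumr.
  have -> : \sum_j \sum_l (a j * b l - a l * b j) ^+ 2 =
     \sum_j \sum_l a j ^+ 2 * b l ^+ 2 + \sum_j \sum_l a l ^+ 2 * b j ^+ 2
     - 2 * \sum_j \sum_l a j * b j * (a l * b l).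
    rewrite mulr_sumr -big_split/= -sumrB; apply: eq_bigr => j _.
    rewrite mulr_sumr -big_split/= -sumrB; apply: eq_bigr => l _; ring.
  by rewrite -E1 -E2 -E3; field.
by rewrite mulr_ge0 ?invr_ge0//; apply: sumr_ge0 => j _; apply: sumr_ge0 => l _; exact: sqr_ge0.
Qed.

Lemma near_identity_valid d (r alpha : R) (N : 'M[R]_d) : 0 < r ->
  \sum_i \sum_j N i j ^+ 2 <= th ^+ 2 ->
  valid (Gauss r d kappa alpha) (gauss_law 0 (Num.sqrt c *: (1%:M + N))).
Proof.
move=> r0 Nth; exists 0, ((Num.sqrt c *: (1%:M + N)) *m (Num.sqrt c *: (1%:M + N))^T).
have kg := kappa_gt1; have c0 : 0 < c by rewrite /c; lra.
have th0 : 0 < th by rewrite /th divr_gt0; lra.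
have th1 : th <= 3^-1 by rewrite /th ler_pdivrMr; lra.
have q2 : Num.sqrt c * Num.sqrt c = c by rewrite -expr2 sqr_sqrtr// ltW.
set S := _ *m _.
have SE : S = c *: ((1%:M + N) *m (1%:M + N)^T).
  by rewrite /S linearZ/= -scalemxAl -scalemxAr scalerA q2.
have ST : S^T = S by rewrite /S trmx_mul trmxK.
have quadS (v : 'cV_d) : (v^T *m S *m v) 0 0 = c * \sum_i ((1%:M + N)^T *m v) i 0 ^+ 2.
  rewrite -norm2_sq SE -scalemxAr -scalemxAl mxE trmx_mul trmxK.
  by rewrite !mulmxA.
have bnd (v : 'cV_d) : let s := \sum_i v i 0 ^+ 2 in
    (1 - 2 * th) * s <= \sum_i ((1%:M + N)^T *m v) i 0 ^+ 2 <= (1 + 3 * th) * s.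
  move=> s; pose u := N^T *m v.
  have us : \sum_i u i 0 ^+ 2 <= th ^+ 2 * s.
    apply: le_trans (frob_le _ _) _; rewrite ler_wpM2r//.
      by apply: sumr_ge0 => i _; exact: sqr_ge0.
    by rewrite exchange_big/=; under eq_bigr do under eq_bigr do rewrite mxE.
  have s0 : 0 <= s by apply: sumr_ge0 => i _; exact: sqr_ge0.
  have E i : ((1%:M + N)^T *m v) i 0 = v i 0 + u i 0.
    by rewrite linearD/= trmx1 mulmxDl mul1mx mxE.
  have u0 : 0 <= \sum_i u i 0 ^+ 2 by apply: sumr_ge0 => i _; exact: sqr_ge0.
  have thN : th != 0 by rewrite gt_eqF.
  apply/andP; split.
    (* The cross term [2 v u] is split with weight [th], which is the bound on the ratio of the
       norms of [u] and [v]. *)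
    apply: (@le_trans _ _ (\sum_i ((1 - th) * v i 0 ^+ 2 + (1 - th^-1) * u i 0 ^+ 2))).
      rewrite big_split/= -!mulr_sumr -/s.
      have : th^-1 * (\sum_i u i 0 ^+ 2) <= th * s.
        by rewrite -ler_pdivlMl ?invr_gt0// invrK mulrA -expr2.
      by move=> h; lra.
    apply: ler_sum => i _; rewrite E -subr_ge0.
    rewrite (_ : _ - _ = th^-1 * (th * v i 0 + u i 0) ^+ 2); last by field.
    by rewrite mulr_ge0 ?sqr_ge0// invr_ge0 ltW.
  apply: (@le_trans _ _ (\sum_i ((1 + th) * v i 0 ^+ 2 + (1 + th^-1) * u i 0 ^+ 2))).
    apply: ler_sum => i _; rewrite E -subr_ge0.
    rewrite (_ : _ - _ = th^-1 * (th * v i 0 - u i 0) ^+ 2); last by field.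
    by rewrite mulr_ge0 ?sqr_ge0// invr_ge0 ltW.
  rewrite big_split/= -!mulr_sumr -/s.
  have : th^-1 * (\sum_i u i 0 ^+ 2) <= th * s.
    by rewrite -ler_pdivlMl ?invr_gt0// invrK mulrA -expr2.
  have : \sum_i u i 0 ^+ 2 <= th * s.
    by apply: le_trans us _; rewrite expr2 ler_wpM2r//; nra.
  by move=> h h'; lra.
have k1 : 1 <= c * (1 - 2 * th).
  rewrite (_ : c * (1 - 2 * th) = 1 + (kappa - 1) / 6); last by rewrite /c /th; field; rewrite gt_eqF//; lra.
  by lra.
have k2 : c * (1 + 3 * th) <= kappa.
  by rewrite (_ : c * (1 + 3 * th) = kappa)//; rewrite /c /th; field; rewrite gt_eqF//; lra.
split.
- rewrite /norm2 big1 ?sqrtr0 ?ltW// => i _.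
  by rewrite mxE expr0n.
- split; first by rewrite linearB/= ST trmx1.
  move=> v; rewrite mulmxBr mulmxBl mulmx1 mxE [X in _ + X]mxE subr_ge0 quadS norm2_sq.
  have /andP[h _] := bnd v; apply: le_trans (ler_wpM2l (ltW c0) h).
  rewrite mulrA -[leLHS]mul1r ler_wpM2r//.
  by apply: sumr_ge0 => i _; exact: sqr_ge0.
- split; first by rewrite linearB/= ST tr_scalar_mx.
  move=> v; rewrite mulmxBr mulmxBl mxE [X in _ + X]mxE subr_ge0 quadS.
  rewrite mul_mx_scalar -scalemxAl mxE norm2_sq.
  have /andP[_ h] := bnd v; apply: le_trans (ler_wpM2l (ltW c0) h) _.
  rewrite mulrA ler_wpM2r//.
  by apply: sumr_ge0 => i _; exact: sqr_ge0.
- exact: gauss_lawP.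
Qed.

End gaussian_packing.

(** * Packing by block perturbations *)

Section packing2.
Context {R : realType}.
Variables (kappa : R) (kappa_gt1 : 1 < kappa).
Let c := (1 + kappa) / 2.
Let th := (kappa - 1) / (3 * (1 + kappa)).
Variables (d k : nat) (lu lv : 'I_k -> 'I_d).
Hypotheses (lu_inj : injective lu) (lv_inj : injective lv).
Hypothesis luv : forall i j, lu j != lv i.
Hypothesis k0 : (0 < k)%N.
Local Notation gam := (normal_prob (0 : R) 1).
Local Notation Rdd := (@Rd R d).
Local Notation word := {ffun 'I_k * 'I_k -> 'I_16}.
Local Open Scope ereal_scope.

Definition blockmx (W : 'I_k -> 'I_k -> R) : 'M[R]_d :=
  \matrix_(a, b) (\sum_i \sum_j (if (a == lv i) && (b == lu j) then W i j else 0))%R.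

Lemma blockmx_cd W (z : Rdd) a :
  (\sum_b blockmx W a b * cd z b = \sum_(i | lv i == a) rowu lu W i z)%R.
Proof.
under eq_bigr do rewrite mxE mulr_suml.
rewrite exchange_big/= [RHS]big_mkcond/=; apply: eq_bigr => i _.
under eq_bigr do rewrite mulr_suml.
rewrite exchange_big/= [lv i == a]eq_sym; case: (eqVneq a (lv i)) => [_|_] /=; last first.
  by rewrite big1// => j _; rewrite big1// => b _; rewrite mul0r.
apply: eq_bigr => j _; rewrite (bigD1 (lu j))//= eqxx big1 ?addr0// => b /negbTE ->.
by rewrite mul0r.
Qed.

Lemma blockmx_frob W : (\sum_a \sum_b blockmx W a b ^+ 2 = \sum_i \sum_j W i j ^+ 2)%R.
Proof.
pose e (a : 'I_d) : option 'I_k := [pick i | lv i == a].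
pose e' (b : 'I_d) : option 'I_k := [pick i | lu i == b].
have ev i : e (lv i) = Some i.
  rewrite /e; case: pickP => [j /eqP/lv_inj ->//|/(_ i)]; by rewrite eqxx.
have eu i : e' (lu i) = Some i.
  rewrite /e'; case: pickP => [j /eqP/lu_inj ->//|/(_ i)]; by rewrite eqxx.
have E i j : blockmx W (lv i) (lu j) = W i j.
  rewrite mxE (bigD1 i)//= (bigD1 j)//= !eqxx/= !big1 ?addr0//.
    by move=> i' /negbTE ii; apply: big1 => j' _; rewrite (inj_eq lv_inj) eq_sym ii.
  by move=> j' /negbTE jj; rewrite (inj_eq lu_inj) eq_sym jj.
have Z a b : (e a == None) || (e' b == None) -> blockmx W a b = 0%R.
  move=> h; rewrite mxE big1// => i _; rewrite big1// => j _.
  case: ifP => // /andP[/eqP ae /eqP be]; move: h; rewrite ae be ev eu.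
  by [].
transitivity (\sum_(a | e a != None) \sum_(b | e' b != None) blockmx W a b ^+ 2)%R.
  rewrite (bigID (fun a => e a != None))/= [X in (_ + X)%R]big1 ?addr0; last first.
    by move=> a; rewrite negbK => ea; apply: big1 => b _; rewrite Z ?ea// expr0n.
  apply: eq_bigr => a _; rewrite (bigID (fun b => e' b != None))/= [X in (_ + X)%R]big1 ?addr0//.
  by move=> b; rewrite negbK => eb; rewrite Z ?eb ?orbT// expr0n.
have im (l : 'I_k -> 'I_d) (l_inj : injective l) (F : 'I_d -> R) :
    (\sum_(a | [pick i | l i == a] != None) F a = \sum_i F (l i))%R.
  rewrite (reindex_omap l (fun a => [pick i | l i == a]))/=; last first.
    by move=> a; case: pickP => //= i /eqP ->.
  apply: eq_bigl => i; case: pickP => [j /eqP/l_inj ->|/(_ i)]; rewrite ?eqxx//.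
rewrite (im lv lv_inj); apply: eq_bigr => i _; rewrite (im lu lu_inj).
by apply: eq_bigr => j _; rewrite E.
Qed.

Let q := Num.sqrt c.
Let c0 : (0 < c)%R. Proof. by have := kappa_gt1; rewrite /c => ?; lra. Qed.
Let q0 : (0 < q)%R. Proof. by rewrite sqrtr_gt0. Qed.
Let qN : q != 0%R. Proof. by rewrite gt_eqF. Qed.

Definition block_law W : probability Rdd R := gauss_law 0 (q *: (1%:M + blockmx W)).

(** The block map changes only the coordinates [lv], by functions of the coordinates [lu], which it
    leaves alone. It is therefore a composition of [shifts] followed by a scaling, and [gauss_chaos]
    gives its density. *)
Lemma affine_block W (z : Rdd) : affine_map 0 (q *: (1%:M + blockmx W)) z =
  affine_map 0 q%:M (shifts lv (rowu lu W) (index_enum 'I_k) z).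
Proof.
apply: eq_from_tnth => a; rewrite -!/(cd _ a) affine_scale.
rewrite (cd_shifts (rowu_upd luv W))// ?index_enum_uniq// /cd tnth_mktuple -/(cd _ a).
rewrite mxE add0r -blockmx_cd.
under eq_bigr do rewrite mxE -mulrA mxE mulrDl -/(cd _ _).
rewrite -mulr_sumr big_split/=; congr (_ * (_ + _))%R.
rewrite (bigD1 a)//= mxE eqxx mul1r big1 ?addr0// => b /negbTE ba.
by rewrite mxE eq_sym ba mul0r.
Qed.

Definition block_density W (y : Rdd) : R :=
  chaos_density lu lv W (affine_map 0 (q^-1)%:M y).

Lemma block_has_density W :
  has_density (block_law W) (gauss_law 0 q%:M) (block_density W).
Proof.
have mp : measurable_fun [set: Rdd] (block_density W).
  apply: (measurableT_comp (measurable_chaos_density lu lv W)).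
  exact: measurable_affine_map.
have p0 x : (0 <= block_density W x)%R by exact: expR_ge0.
split => // f mf f0.
rewrite /block_law integral_gauss_law// integral_gauss_law; last 2 first.
- by apply: emeasurable_funM => //; exact/measurable_EFinP.
- by move=> x; rewrite mule_ge0// lee_fin.
under eq_integral do rewrite affine_block.
have mfq : measurable_fun [set: Rdd] (fun x => f (affine_map 0 q%:M x)).
  by apply: (measurableT_comp mf); exact: measurable_affine_map.
rewrite (gauss_chaos lv_inj luv W mfq (fun x => f0 _)).
by apply: eq_integral => x _; rewrite /block_density affine_scaleK.
Qed.

Lemma block_second_moment W (w : R) : rows_le W w -> (0 <= w <= 4^-1)%R ->
  \int[gauss_law 0 q%:M]_y (block_density W y ^+ 2)%:E <= (1 + 2 * w)%:E.
Proof.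
move=> Ww w4; have [mp _ _] := block_has_density W.
rewrite integral_gauss_law; last 2 first.
- by apply/measurable_EFinP; apply: measurable_funX.
- by move=> x; rewrite lee_fin sqr_ge0.
under eq_integral do rewrite /block_density affine_scaleK//.
exact: chaos_density_second_moment.
Qed.

Lemma block_separated W W' (w : R) : (0 < w <= 4^-1)%R ->
  rows_le W w -> rows_le W' w -> rows_le (fun i j => W i j - W' i j)%R w ->
  (w / (30 * 60) <= \sum_i \sum_j (W i j - W' i j) ^+ 2)%R ->
  exists2 B, measurable B &
    (fine (block_law W' B) + Num.sqrt w / (120 * 60 * (296 * (30 * 60))) <=
     fine (block_law W B))%R.
Proof.
move=> w4 Ww Ww' Dw Dfar.
have [B mB E] := density_scheffe (block_has_density W) (block_has_density W').
exists B => //; rewrite -lee_fin EFinD !fineK ?fin_num_measure// E leeD2l//.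
have [mp _ _] := block_has_density W; have [mp' _ _] := block_has_density W'.
rewrite integral_gauss_law; last 2 first.
- by apply/measurable_EFinP; apply: measurable_maxr => //; apply: measurable_funB.
- by move=> x; rewrite lee_fin le_max lexx orbT.
under eq_integral do rewrite /block_density affine_scaleK//.
exact: (chaos_tv_lower lu_inj lv_inj luv k0 w4 Ww Ww' Dw Dfar).
Qed.

(** With [sqrt w = sepK * alpha] the separation of [chaos_tv_lower] is [3 alpha], more than the
    [2 alpha] that two laws with a common correct output can differ by. *)
Definition sepK : R := (3 * (120 * 60 * (296 * (30 * 60))))%R.

Lemma sepK_gt0 : (0 < sepK)%R.
Proof. by apply: mulr_gt0; [|apply: mulr_gt0; [|apply: mulr_gt0; [|]]]; try apply: mulr_gt0; exact: ltr0Sn. Qed.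

Lemma block_packing (r alpha : R) : (0 < r)%R -> (0 < alpha)%R ->
  (sepK * alpha <= th)%R -> (d ^ 2 <= 9 * k ^ 2)%N ->
  packing kappa d r alpha (1 + 2 * (sepK * alpha) ^+ 2)%R.
Proof.
move=> r0 a0 ath dk; pose w := ((sepK * alpha) ^+ 2)%R.
have K0 := sepK_gt0.
have Ka0 : (0 < sepK * alpha)%R by rewrite mulr_gt0.
have kg := kappa_gt1.
have th1 : (th <= 3^-1)%R by rewrite /th ler_pdivrMr; lra.
have w0 : (0 < w)%R by rewrite exprn_gt0.
have w4 : (w <= 4^-1)%R.
  rewrite /w (_ : 4^-1 = 2^-1 ^+ 2 :> R)%R; last by field.
  by rewrite ler_sqr ?nnegrE ?invr_ge0//; [lra|exact: ltW].
have th0 : (0 < th)%R := lt_le_trans Ka0 ath.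
have wth : (w <= th ^+ 2)%R by rewrite /w ler_sqr ?nnegrE; [exact: ath|exact: ltW|exact: ltW].
have sw : Num.sqrt w = (sepK * alpha)%R by rewrite /w sqrtr_sqr gtr0_norm.
have kR : (0 < k%:R :> R)%R by rewrite ltr0n.
have kN : (k%:R : R) != 0%R by rewrite gt_eqF.
(* The grid step. An entry, or a difference of two entries, is at most [15 s], and
   [k^2 (15 s)^2 = w] is the bound asked by [rows_le]. *)
pose s := (sepK * alpha / (15 * k%:R))%R.
have s2 : (s ^+ 2 * (15 ^+ 2 * k%:R ^+ 2) = w)%R by rewrite /s /w; field.
clearbody s.
pose W (o : word) i j : R := (s * (o (i, j) : nat)%:R)%R.
have small (f : 'I_k -> 'I_k -> R) : (forall i j, (f i j ^+ 2 <= (s * 15) ^+ 2)%R) -> rows_le f w.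
  move=> hf i; rewrite -s2; apply: (@le_trans _ _ (k%:R * \sum_(j < k) (s * 15) ^+ 2)%R).
    by rewrite ler_pM2l//; apply: ler_sum => j _.
  by rewrite sumr_const card_ord -mulr_natl le_eqVlt; apply/orP; left; apply/eqP; ring.
have o15 (v : 'I_16) : ((v : nat)%:R <= 15 :> R)%R.
  by rewrite ler_nat -ltnS.
have Ww o : rows_le (W o) w.
  apply: small => i j; rewrite /W !exprMn ler_wpM2l ?sqr_ge0//.
  by rewrite ler_sqr ?nnegrE.
have Dw o o' : rows_le (fun i j => W o i j - W o' i j)%R w.
  apply: small => i j; rewrite /W -mulrBr !exprMn ler_wpM2l ?sqr_ge0//.
  rewrite -real_normK ?num_real// ler_sqr ?nnegrE//.
  rewrite ler_norml; have := o15 (o (i, j)); have := o15 (o' (i, j)).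
  have : (0 <= (o (i, j) : nat)%:R :> R)%R by []. have : (0 <= (o' (i, j) : nat)%:R :> R)%R by [].
  by move=> *; apply/andP; split; lra.
have frob o : (\sum_i \sum_j blockmx (W o) i j ^+ 2 <= th ^+ 2)%R.
  rewrite blockmx_frob; apply: le_trans wth.
  apply: (@le_trans _ _ (\sum_(i < k) w / k%:R)%R).
    by apply: ler_sum => i _; rewrite ler_pdivlMr// mulrC; exact: Ww.
  by rewrite sumr_const card_ord -[(_ *+ _)%R]mulr_natr -mulrA mulVf// mulr1.
have cardP : #|{: 'I_k * 'I_k}| = (k ^ 2)%N by rewrite card_prod !card_ord mulnn.
pose D := (k ^ 2 %/ 8)%N.
have hD : (8 * D <= #|{: 'I_k * 'I_k}|)%N by rewrite cardP mulnC leq_trunc_div.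
(* Distinct letters differ by at least 1, so each disagreement contributes [s^2]; more than
   [k^2 / 8] of them give [w / (15^2 * 8)]. *)
have far o o' : (agree o o' + D < #|{: 'I_k * 'I_k}|)%N ->
    (w / (30 * 60) <= \sum_i \sum_j (W o i j - W o' i j) ^+ 2)%R.
  move=> hag; rewrite pair_big/=.
  have E : (\sum_(p : 'I_k * 'I_k) (s ^+ 2 * (o p != o' p)%:R) <= \sum_(p : 'I_k * 'I_k) (W o p.1 p.2 - W o' p.1 p.2) ^+ 2)%R.
    apply: ler_sum => -[i j] _ /=; rewrite /W -mulrBr exprMn ler_wpM2l ?sqr_ge0//.
    case: (eqVneq (o (i, j)) (o' (i, j))) => [->|ne]; first by rewrite subrr expr0n.
    have : ((o (i, j) : nat) != (o' (i, j) : nat))%N by [].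
    rewrite neq_ltn -real_normK ?num_real// => /orP[h|h].
      rewrite distrC ger0_norm ?subr_ge0 ?ler_nat 1?ltnW// -natrB 1?ltnW//.
      by rewrite -natrX ler_nat expn_gt0 subn_gt0 h.
    rewrite ger0_norm ?subr_ge0 ?ler_nat 1?ltnW// -natrB 1?ltnW//.
    by rewrite -natrX ler_nat expn_gt0 subn_gt0 h.
  apply: le_trans E; rewrite -mulr_sumr -natr_sum.
  have -> : (w / (30 * 60) = s ^+ 2 * (k%:R ^+ 2 / 8))%R by rewrite -s2; field.
  rewrite ler_wpM2l ?sqr_ge0// ler_pdivrMr// -natrX -natrM ler_nat.
  have E2 : (\sum_(i : 'I_k * 'I_k) (o i != o' i) + agree o o' = k ^ 2)%N.
    rewrite -cardP -(cardC [pred x | o x == o' x]) addnC; congr (_ + _)%N.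
    by rewrite -sum1_card [RHS]big_mkcond/=; apply: eq_bigr => x _; rewrite !inE; case: (o x == o' x).
  move: hag; rewrite cardP -E2 addnC ltn_add2r => hlt.
  apply: (@leq_trans (D.+1 * 8)); last by rewrite leq_mul2r hlt orbT.
  by rewrite E2 ltnW// ltn_ceil.
pose G o := correct (Gauss r d kappa alpha) (block_law (W o)).
(* The largest cluster of words with pairwise distance at most [D]. Since words further apart have
   no common correct output, the members served by one output form such a cluster. *)
pose V := \max_(S : {set word} | [forall a in S, forall b in S, (#|{: 'I_k * 'I_k}| <= agree a b + D)%N]) #|S|.
have V2 : (V ^ 2 <= 8 ^ (k ^ 2))%N.
  rewrite /V; apply: (big_ind (fun v => (v ^ 2 <= 8 ^ (k ^ 2))%N)) => //.
    by move=> x y hx hy; rewrite maxnE; case: (leqP x y) => xy; [rewrite subnKC|rewrite (eqP (ltnW xy)) addn0].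
  move=> S /'forall_in_'forall_in_idP hS; rewrite -cardP; apply: (cluster_card hD).
  by move=> a b aS bS; apply: hS.
exists word, (fun o => block_law (W o)), (gauss_law 0 q%:M), (fun o => block_density (W o)), V, (k ^ 2)%N.
split => //.
- split=> o.
  + exact: block_has_density.
  + by apply: block_second_moment => //; rewrite ltW.
  + exact: near_identity_valid.
- move=> o; rewrite -/(G _).
  have -> : (\sum_(i : word) (o \in G i) = #|[set i : word | o \in G i]%SET|)%N.
    by rewrite -sum1_card [RHS]big_mkcond/=; apply: eq_bigr => i _; rewrite inE; case: (_ \in _).
  rewrite /V; apply: leq_bigmax_cond.
  apply/'forall_in_'forall_in_idP => a; rewrite inE => /set_mem oa b; rewrite inE => /set_mem ob.
  rewrite leqNgt; apply/negP => /far hfar.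
  have w04 : (0 < w <= 4^-1)%R by rewrite w0.
  have [B mB hB] := block_separated w04 (Ww a) (Ww b) (Dw a b) hfar.
  have := tv_ball_meet oa ob mB; move: hB; rewrite sw /sepK.
  set K := (120 * 60 * (296 * (30 * 60)))%R.
  have K0' : (0 < K)%R by move: K0; rewrite /sepK pmulr_rgt0.
  rewrite (_ : 3 * K * alpha / K = 3 * alpha)%R; last by field; rewrite gt_eqF.
  by move=> *; lra.
(* After squaring this is [25 * 8 <= 16 ^ 2], raised to the power [k ^ 2]; the alphabet of 16
   letters is large enough for it. *)
- rewrite card_ffun cardP card_ord -leq_sqr !expnMn.
  apply: (@leq_trans ((5 ^ k ^ 2) ^ 2 * 8 ^ k ^ 2)); first by rewrite leq_mul2l V2 orbT.
  rewrite -!expnM ![(k ^ 2 * 2)%N]mulnC !expnM -expnMn.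
  by rewrite -expnMn !leq_exp2r.
- rewrite /V; have s1 : [forall a in [set [ffun=> ord0] : word]%SET, forall b in [set [ffun=> ord0] : word]%SET, (#|{: 'I_k * 'I_k}| <= agree a b + D)%N].
    apply/'forall_in_'forall_in_idP => a; rewrite inE => /eqP -> b; rewrite inE => /eqP ->.
    by apply: leq_trans (leq_addr _ _); rewrite /agree; apply: subset_leq_card; apply/fintype.subsetP => x _; rewrite inE.
  by apply: leq_trans (leq_bigmax_cond _ s1); rewrite cards1.
Qed.

End packing2.

Lemma sum_pairwise_le1 n (F : pred 'I_n) :
  (forall i j : 'I_n, (i < j)%N -> F i -> F j -> False) -> (\sum_i F i <= 1)%N.
Proof.
move=> h; case: (pickP F) => [i Fi|F0]; last by rewrite big1// => i _; rewrite F0.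
rewrite (bigD1 i)//= Fi big1 ?addn0// => j ji; case Fj: (F j) => //; exfalso.
have : (j : nat) != i by []. rewrite neq_ltn => /orP[jl|jl].
  exact: (h _ _ jl Fj Fi).
exact: (h _ _ jl Fi Fj).
Qed.

(** * Packing in dimension one by change of scale *)

Section packing1.
Context {R : realType}.
Variables (kappa : R) (kappa_gt1 : 1 < kappa).
Let c := (1 + kappa) / 2.
Let th := (kappa - 1) / (3 * (1 + kappa)).
Local Notation gam := (normal_prob (0 : R) 1).
Local Notation Rd1 := (@Rd R 1).
Let q := Num.sqrt c.
Local Open Scope ereal_scope.

Lemma gauss_itv_lower (a b : R) : (0 <= a)%R -> (a <= b)%R -> (b <= 1)%R ->
  ((b - a) / 6)%:E <= gam `]a, b]%classic.
Proof.
move=> a0 ab b1; rewrite /normal_prob.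
apply: (@le_trans _ _ (\int[lebesgue_measure]_(x in `]a, b]) (6^-1)%:E)).
  rewrite integral_cst//= lebesgue_measure_itv/= lte_fin.
  case: ltP => h; first by rewrite -EFinB -EFinM mulrC.
  by rewrite mule0 lee_fin (_ : a = b) ?subrr ?mul0r//; apply/eqP; rewrite eq_le ab h.
apply: ge0_le_integral => //.
- by apply/measurable_EFinP; apply: measurable_funTS; exact: measurable_normal_pdf.
move=> x /=; rewrite in_itv/= => /andP[ax xb]; rewrite lee_fin.
rewrite normal_pdfE ?oner_eq0// /normal_fun /normal_peak subr0 !expr1n mul1r.
have h1 : (3^-1 <= (Num.sqrt (pi *+ 2 : R))^-1)%R.
  have p0 := @pi_gt0 R; have := @pihalf_lt2 R; rewrite ltr_pdivrMr// => p4.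
  have p20 : (0 < pi *+ 2 :> R)%R by rewrite -mulr_natr mulr_gt0.
  have sp0 : (0 < Num.sqrt (pi *+ 2 : R))%R by rewrite sqrtr_gt0.
  rewrite lef_pV2 ?posrE// -(@gtr0_norm R 3)// -sqrtr_sqr ler_wsqrtr// -mulr_natr; lra.
have h2 : (2^-1 <= expR (- x ^+ 2 / (1 *+ 2)))%R.
  apply: le_trans (expR_ge1Dx _).
  have : (x ^+ 2 <= 1)%R by rewrite expr2; nra.
  by rewrite (_ : (1 *+ 2 = 2 :> R)%R)//; lra.
rewrite (_ : 6^-1 = 3^-1 * 2^-1 :> R)%R; last by field.
by apply: ler_pM => //; rewrite invr_ge0.
Qed.

Variable s : R.
Hypothesis s1 : (1 <= s <= 2)%R.
Let s0 : (0 < s)%R. Proof. by have := s1 => /andP[? ?]; lra. Qed.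
Let c0 : (0 < c)%R. Proof. by have := kappa_gt1; rewrite /c => ?; lra. Qed.
Let q0 : (0 < q)%R. Proof. by rewrite sqrtr_gt0. Qed.
Let qN : q != 0%R. Proof. by rewrite gt_eqF. Qed.

(** The matrix is the scalar [q s], written as a perturbation of the identity so that
    [near_identity_valid] applies. *)
Definition scale_law : probability Rd1 R := gauss_law 0 (q *: (1%:M + (s - 1)%:M)).

Definition scale_density1 (t : R) : R := (s^-1 * expR (t ^+ 2 / 2 - ((t - 0) / s) ^+ 2 / 2))%R.

Definition scale_density (y : Rd1) : R :=
  scale_density1 (cd (affine_map 0 (q^-1)%:M y) ord0).

Let mp1 : measurable_fun [set: R] scale_density1.
Proof. by rewrite /scale_density1; meas. Qed.

Let p10 t : (0 <= scale_density1 t)%R.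
Proof. by rewrite mulr_ge0 ?expR_ge0// invr_ge0 ltW. Qed.

Lemma affine_scale1 (x : Rd1) : affine_map 0 (q *: (1%:M + (s - 1)%:M)) x =
  affine_map 0 q%:M (upd x ord0 (s * cd x ord0 + 0)%R).
Proof.
have -> : q *: (1%:M + (s - 1)%:M) = (q * s)%:M :> 'M[R]_1.
  by rewrite -raddfD/= addrC subrK scale_scalar_mx.
apply: eq_from_tnth => i; rewrite -!/(cd _ i) !affine_scale cd_upd (ord1 i) eqxx.
by rewrite addr0 mulrA.
Qed.

Let mdens : measurable_fun [set: Rd1] scale_density.
Proof.
apply: (measurableT_comp mp1); apply: (measurableT_comp (measurable_cd _)).
exact: measurable_affine_map.
Qed.

Lemma scale_has_density : has_density scale_law (gauss_law 0 q%:M) scale_density.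
Proof.
split; [exact: mdens|by move=> x; exact: p10|].
move=> f mf f0; rewrite /scale_law [RHS]integral_gauss_law; last 2 first.
- by apply: emeasurable_funM => //; exact/measurable_EFinP.
- by move=> x; rewrite mule_ge0// lee_fin; exact: p10.
rewrite [LHS](integral_gauss_law _ _ mf f0).
have mF : measurable_fun [set: Rd1] (fun x => f (affine_map 0 q%:M x)).
  by apply: (measurableT_comp mf); exact: measurable_affine_map.
have mL : measurable_fun [set: Rd1] (fun x => f (affine_map 0 (q *: (1%:M + (s - 1)%:M)) x)).
  by apply: (measurableT_comp mf); exact: measurable_affine_map.
rewrite (integral_iid_resample gam ord0 mL (fun x => f0 _)).
have mR : measurable_fun [set: Rd1] (fun x => f (affine_map 0 q%:M x) * (scale_density (affine_map 0 q%:M x))%:E).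
  apply: emeasurable_funM => //; apply/measurable_EFinP.
  by apply: (measurableT_comp mdens); exact: measurable_affine_map.
rewrite [RHS](integral_iid_resample gam ord0 mR); last first.
  by move=> x; rewrite mule_ge0// lee_fin; exact: p10.
apply: eq_integral => x _.
have mx : measurable_fun [set: R] (fun t => f (affine_map 0 q%:M (upd x ord0 t))).
  by apply: (measurableT_comp mF); exact: measurable_updr.
transitivity (\int[gam]_t f (affine_map 0 q%:M (upd x ord0 (s * t + 0)%R))).
  by apply: eq_integral => t _; rewrite affine_scale1 upd_upd cd_upd eqxx.
rewrite (gauss_affine 0 s0 mx (fun t => f0 _)).
by apply: eq_integral => t _; rewrite /scale_density affine_scaleK// cd_upd eqxx.
Qed.

Lemma scale_second_moment (e : R) : (s - 1 <= e)%R -> (e <= 20^-1)%R ->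
  \int[gauss_law 0 q%:M]_y (scale_density y ^+ 2)%:E <= (1 + 4 * e ^+ 2)%:E.
Proof.
move=> se e20; have /andP[s1' s2'] := s1.
rewrite integral_gauss_law; last 2 first.
- by apply/measurable_EFinP; apply: measurable_funX.
- by move=> x; rewrite lee_fin sqr_ge0.
under eq_integral do rewrite /scale_density affine_scaleK//.
rewrite (@integral_gauss_coord _ _ ord0 (fun t => (scale_density1 t ^+ 2)%:E)); last 2 first.
- by apply/measurable_EFinP; apply: measurable_funX.
- by move=> x; rewrite lee_fin sqr_ge0.
pose u := (1 - s^-1 ^+ 2)%R.
have sV0 : (0 < s^-1)%R by rewrite invr_gt0.
have sV1 : (s^-1 <= 1)%R by rewrite invf_le1.
have sVl : (1 - (s - 1) <= s^-1)%R.
  rewrite -subr_ge0 (_ : _ - _ = (s - 1) ^+ 2 / s)%R; last by field; rewrite gt_eqF.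
  by rewrite divr_ge0 ?sqr_ge0// ltW.
have u0 : (0 <= u)%R by rewrite /u; nra.
have u2e : (u <= 2 * (s - 1))%R by rewrite /u; nra.
(* An upper bound for [(1 - 2 u)^(-1/2)], the integral of [exp (u t^2)]. The prefactor [s^-2] is
   [1 - u], and [(1 - u) sg <= 1 + u^2] has no linear term. *)
pose sg := (1 + u + 2 * u ^+ 2)%R.
have sg0 : (0 < sg)%R by rewrite /sg; nra.
have k1 : (u <= (1 - sg ^- 2) / 2)%R.
  have : (1 <= sg ^+ 2 * (1 - 2 * u))%R.
    have -> : (sg ^+ 2 * (1 - 2 * u) = 1 + u ^+ 2 * (1 - 6 * u - 4 * u ^+ 2 - 8 * u ^+ 2 * u))%R by rewrite /sg; ring.
    rewrite lerDl mulr_ge0 ?sqr_ge0//.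
    have ub : (u <= 10^-1)%R by lra.
    have u2 : (u ^+ 2 <= 100^-1)%R.
      rewrite (_ : 100^-1 = 10^-1 ^+ 2 :> R)%R; last by field.
      by rewrite ler_sqr ?nnegrE// invr_ge0.
    have u3 : (u ^+ 2 * u <= u ^+ 2)%R by rewrite ler_piMr ?sqr_ge0//; lra.
    by lra.
  rewrite -ler_pdivrMl ?exprn_gt0// mulr1 => h; lra.
apply: (@le_trans _ _ (\int[gam]_t (s^-1 ^+ 2 * expR ((1 - sg ^- 2) / 2 * t ^+ 2))%:E)).
  have ms : measurable_fun [set: R] (fun t => scale_density1 t ^+ 2)%R by apply: measurable_funX.
  apply: le_integralr; side.
  have key (t : R) : (2 * (t ^+ 2 / 2 - ((t - 0) / s) ^+ 2 / 2) <= (1 - sg ^- 2) / 2 * t ^+ 2)%R.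
    have -> : (2 * (t ^+ 2 / 2 - ((t - 0) / s) ^+ 2 / 2) = u * t ^+ 2)%R.
      by rewrite /u; field; rewrite gt_eqF.
    by rewrite ler_wpM2r ?sqr_ge0.
  move=> t; rewrite /scale_density1 exprMn ler_wpM2l ?sqr_ge0// -expRM_natl ler_expR.
  exact: key.
rewrite integralZr_nneg; side.
rewrite gauss_sq_mgf// -EFinM lee_fin.
have -> : (s^-1 ^+ 2 = 1 - u)%R by rewrite /u; ring.
by rewrite /sg; nra.
Qed.

(** This event separates the scales: its probability decreases as [s] grows. *)
Lemma scale_ball : scale_law [set y : Rd1 | (`|cd y ord0| <= q)%R] =
  gam [set t | (`|t| <= s^-1)%R].
Proof.
have mB : measurable [set t : R | (`|t| <= s^-1)%R].
  rewrite (_ : [set _ | _] = `[(- s^-1)%R, s^-1%R]%classic) //.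
  by apply/seteqP; split=> t /=; rewrite in_itv/= ler_norml.
have key1 (t : R) : (`|q * (s * t)| <= q -> `|t| <= s^-1)%R.
  by rewrite normrM (gtr0_norm q0) ger_pMr// normrM (gtr0_norm s0) -ler_pdivlMl// mulr1.
have key2 (t : R) : (`|t| <= s^-1 -> `|q * (s * t)| <= q)%R.
  by rewrite normrM (gtr0_norm q0) ger_pMr// normrM (gtr0_norm s0) -ler_pdivlMl// mulr1.
have E : scale_law [set y : Rd1 | (`|cd y ord0| <= q)%R] =
    iid gam 1 [set x : Rd1 | (`|cd x ord0| <= s^-1)%R].
  rewrite /scale_law /gauss_law /distribution/= /pushforward; congr (_ _).
  apply/seteqP; split=> x /=; rewrite affine_scale1 affine_scale cd_upd eqxx addr0.
    exact: key1.
  exact: key2.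
have mB' : measurable [set x : Rd1 | (`|cd x ord0| <= s^-1)%R].
  have := @measurable_cd R 1 ord0 measurableT _ mB; rewrite setTI.
  by [].
rewrite E.
have -> : iid gam 1 [set x : Rd1 | (`|cd x ord0| <= s^-1)%R] =
    \int[iid gam 1]_x (\1_[set t : R | (`|t| <= s^-1)%R] (cd x ord0))%:E.
  transitivity (\int[iid gam 1]_x (\1_[set x : Rd1 | (`|cd x ord0| <= s^-1)%R] x)%:E).
    by rewrite integral_indic// setIT.
  by [].
rewrite (@integral_gauss_coord _ _ ord0 (fun t => (\1_[set t : R | (`|t| <= s^-1)%R] t)%:E)).
- by rewrite integral_indic// setIT.
- exact/measurable_EFinP.
- by move=> x; rewrite lee_fin.
Qed.

End packing1.

Section packing1_end.
Context {R : realType}.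
Variables (kappa : R) (kappa_gt1 : 1 < kappa).
Let th := (kappa - 1) / (3 * (1 + kappa)).
Local Notation gam := (normal_prob (0 : R) 1).
Local Open Scope ereal_scope.

Lemma scale_separated (s t : R) : (1 <= s)%R -> (s <= t)%R -> (t <= 2)%R ->
  (fine (scale_law kappa t [set y : @Rd R 1 | (`|cd y ord0| <= Num.sqrt ((1 + kappa) / 2))%R])
   + (t - s) / 24 <=
  fine (scale_law kappa s [set y : @Rd R 1 | (`|cd y ord0| <= Num.sqrt ((1 + kappa) / 2))%R]))%R.
Proof.
move=> s1 st t2.
have s12 : (1 <= s <= 2)%R by apply/andP; split; lra.
have t12 : (1 <= t <= 2)%R by apply/andP; split; lra.
rewrite !scale_ball//.
have tV : (0 < t^-1)%R by rewrite invr_gt0; lra.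
have sV : (0 < s^-1)%R by rewrite invr_gt0; lra.
have ts : (t^-1 <= s^-1)%R by rewrite lef_pV2 ?posrE//; lra.
have sV1 : (s^-1 <= 1)%R by rewrite invf_le1//; lra.
have E (u : R) : [set x : R | (`|x| <= u)%R] = `[(- u)%R, u]%classic.
  by apply/seteqP; split=> x /=; rewrite in_itv/= ler_norml.
rewrite !E.
have h := gauss_itv_lower (ltW tV) ts sV1.
(* As [s] and [t] are at most 2. With the density bound 1/6 of [gauss_itv_lower] this gives the
   constant 24; the right half of the event is enough. *)
have hd : (t - s <= 4 * (s^-1 - t^-1))%R.
  have -> : (s^-1 - t^-1 = (t - s) * (s^-1 * t^-1))%R by field; rewrite !gt_eqF//; lra.
  have t1' : (2^-1 <= t^-1)%R by rewrite lef_pV2 ?posrE//; lra.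
  have s1' : (2^-1 <= s^-1)%R by lra.
  have : (4^-1 <= s^-1 * t^-1)%R.
    by apply: (@le_trans _ _ (2^-1 * 2^-1)%R); [lra|apply: ler_pM].
  by move=> ?; nra.
have fin (A : set (measurableTypeR R)) : measurable A -> gam A \is a fin_num by move=> mA; rewrite fin_num_measure.
rewrite -lee_fin EFinD !fineK ?fin//.
apply: (@le_trans _ _ (gam `[(- t^-1)%R, t^-1%R]%classic + gam `]t^-1%R, s^-1%R]%classic)).
  by rewrite leeD2l//; apply: le_trans h; rewrite lee_fin; lra.
rewrite -measureU//.
- apply: le_measure; rewrite ?inE//; first exact: measurableU.
  move=> x /=; rewrite !in_itv/= => -[/andP[h1 h2]|/andP[h1 h2]]; apply/andP; split; lra.
- apply/seteqP; split=> x //=; rewrite !in_itv/= => -[/andP[h1 h2] /andP[h3 h4]].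
  by move: (lt_le_trans h3 h2); rewrite ltxx.
Qed.

Let scale_contra (u v si sj alpha : R) : (0 < alpha -> si + 60 * alpha <= sj ->
  u + (sj - si) / 24 <= v -> v <= u + 2 * alpha -> False)%R.
Proof. by move=> *; lra. Qed.

Lemma scale_packing (r alpha : R) : (0 < r)%R -> (0 < alpha)%R ->
  (@sepK R * alpha <= th)%R ->
  packing kappa 1 r alpha (1 + 2 * (@sepK R * alpha) ^+ 2)%R.
Proof.
move=> r0 a0 ath; have kg := kappa_gt1.
have K0 : (30 * 60 * 60 <= @sepK R)%R by rewrite /sepK; lra.
have th1 : (th <= 3^-1)%R by rewrite /th ler_pdivrMr; lra.
have Ka : (30 * 60 * 60 * alpha <= @sepK R * alpha)%R by rewrite ler_wpM2r// ltW.
(* Neighbouring scales are then separated by [60 alpha / 24], more than [2 alpha], so an output is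
   correct for at most one of them. Five scales suffice for [V = N = 1]. *)
pose eta := (60 * alpha)%R.
have e0 : (0 < eta)%R by rewrite mulr_gt0.
have e1 : (4 * eta <= 20^-1)%R by rewrite /eta; lra.
pose s (i : 'I_5) : R := (1 + (i : nat)%:R * eta)%R.
have i4 (i : 'I_5) : ((i : nat)%:R <= 4 :> R)%R by rewrite ler_nat -ltnS.
have i0 (i : 'I_5) : (0 <= (i : nat)%:R :> R)%R by [].
have s12 i : (1 <= s i <= 2)%R.
  by rewrite /s; have := i4 i; have := i0 i => ? ?; apply/andP; split; nra.
have se i : (s i - 1 <= 4 * eta)%R by rewrite /s; have := i4 i => ?; nra.
exists 'I_5, (fun i => scale_law kappa (s i)), (gauss_law 0 (Num.sqrt ((1 + kappa) / 2))%:M),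
  (fun i => scale_density kappa (s i)), 1%N, 1%N.
split; [split=> i| | | by [] | by []].
  + exact: scale_has_density.
  + apply: le_trans (scale_second_moment kappa_gt1 (s12 i) (se i) e1) _.
    rewrite lee_fin lerD2l /eta.
    have : ((30 * 60 * 60 * alpha) ^+ 2 <= (@sepK R * alpha) ^+ 2)%R.
      by rewrite ler_sqr ?nnegrE// mulr_ge0 ?ltW//; lra.
    have := sqr_ge0 alpha; rewrite !exprMn => ? ?; lra.
  + apply: near_identity_valid => //.
    rewrite big_ord1 big_ord1 mxE eqxx mulr1n ler_sqr ?nnegrE.
    * by apply: le_trans (se i) (le_trans _ ath); rewrite /eta; lra.
    * by have /andP[] := s12 i; lra.
    * by apply: le_trans ath; rewrite mulr_ge0 ?ltW//; lra.
- move=> o; apply: sum_pairwise_le1 => i j ij /set_mem oi /set_mem oj.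
  have ijR : ((i : nat)%:R + 1 <= (j : nat)%:R :> R)%R by rewrite natr1 ler_nat.
  have sij : (s i + eta <= s j)%R by rewrite /s; nra.
  have /andP[si1 si2] := s12 i; have /andP[sj1 sj2] := s12 j.
  have sij' : (s i <= s j)%R by lra.
  have hs := scale_separated si1 sij' sj2.
  have mB : measurable [set y : @Rd R 1 | (`|cd y ord0| <= Num.sqrt ((1 + kappa) / 2))%R].
    have m1 : measurable_fun [set: @Rd R 1] (fun y : @Rd R 1 => `|cd y ord0|%R).
      by apply: measurable_fun_normr; exact: measurable_cd.
    have := m1 measurableT `]-oo, (Num.sqrt ((1 + kappa) / 2))%R]%classic (measurable_itv _).
    rewrite setTI (_ : _ @^-1` _ = [set y | (`|cd y ord0| <= Num.sqrt ((1 + kappa) / 2))%R])//.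
  exact: (scale_contra a0 sij hs (tv_ball_meet oi oj mB)).
- by rewrite card_ord.
Qed.

End packing1_end.

(** * The lower bound *)

Section lower.
Context {R : realType}.

Lemma leq_3half (d : nat) : (1 < d)%N -> (d <= 3 * d./2)%N.
Proof. by have := odd_double_half d; rewrite -addnn; case: (odd d) => /=; lia. Qed.

Lemma expR_le1D2 (e : R) : 0 <= e <= 2^-1 -> expR e <= 1 + 2 * e.
Proof.
move=> /andP[e0 e1]; have := expR_ge1Dx (- e); rewrite expRN => h.
have h' : 0 < 1 - e by lra.
apply: (@le_trans _ _ (1 - e)^-1).
  by rewrite -[leLHS]invrK lef_pV2 ?posrE ?invr_gt0 ?expR_gt0.
by rewrite -[leLHS]mul1r ler_pdivrMr//; nra.
Qed.

(** As [e^(1/2) <= 2], base 5 leaves room to absorb constants down to 2/5: the success probability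
    2/3 and the 4/9 of the second-moment bound. *)
Lemma exp_half_le (N : nat) (a : R) : (0 < N)%N -> 2 / 5 <= a ->
  expR (N%:R / 2) <= 5 ^+ N * a.
Proof.
case: N => // N _ ha.
have h2 : expR (2^-1 : R) <= 2 by have := @expR_le1D2 2^-1; rewrite lexx invr_ge0 ler0n => /(_ isT); lra.
rewrite expRM_natl; apply: (@le_trans _ _ (2 ^+ N.+1)).
  by rewrite lerXn2r ?nnegrE ?expR_ge0.
rewrite !exprS; have : (2 : R) ^+ N <= 5 ^+ N by rewrite lerXn2r ?nnegrE//; lra.
have : 0 <= (2 : R) ^+ N by rewrite exprn_ge0.
by move=> ? ?; nra.
Qed.

Lemma gauss_lower (kappa : R) : 1 < kappa -> exists (alpha0 c : R),
  [/\ 0 < alpha0, 0 < c &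
   forall (d : nat) (r alpha eps : R) (m n : nat), (0 < d)%N -> 0 < r ->
     0 < alpha < alpha0 -> 0 < eps < 2^-1 -> (0 < m)%N ->
     achievable (Gauss r d kappa alpha) m eps 0 n ->
     c * gauss_rate d m alpha eps <= n%:R].
Proof.
move=> kg; have q1 : 2 / 5 <= 2 / 3 :> R by lra.
have q2 : 2 / 5 <= 4 / 9 :> R by lra.
pose th := (kappa - 1) / (3 * (1 + kappa)).
have th0 : 0 < th by rewrite divr_gt0//; lra.
have K0 := @sepK_gt0 R.
pose C1 := 2 * @sepK R ^+ 2.
have C10 : 0 < C1 by rewrite mulr_gt0// exprn_gt0.
(* The sum of the constants in [T1], [T2] and [T3]; the 9 below comes from [d^2 <= 9 N]. *)
pose A := 4 + 4 * Num.sqrt (2 * C1) + 2 * C1.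
have A0 : 0 < A by rewrite /A; have := sqrtr_ge0 (2 * C1); lra.
exists (th / @sepK R), (9 * A)^-1; split; [exact: divr_gt0|by rewrite invr_gt0 mulr_gt0|].
move=> d r alpha eps m n d0 r0 /andP[a0 a1] /andP[e0 e1] m0 [B Bdp Bs].
have ath : @sepK R * alpha <= th by move: a1; rewrite ltr_pdivlMr// mulrC => /ltW.
have [I [P [Q [p [V [N [[dens mom val] cnt card V0 dN]]]]]]] :
    packing kappa d r alpha (1 + 2 * (@sepK R * alpha) ^+ 2).
  have [d1|d1] := leqP d 1.
    have -> : d = 1%N by apply/eqP; rewrite eqn_leq d1 d0.
    exact: scale_packing.
  pose k := d./2.
  have k0 : (0 < k)%N by rewrite half_gt0.
  have kd : (k + k <= d)%N by rewrite addnn -[leqRHS]odd_double_half leq_addl.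
  have ltu (j : 'I_k) : (j < d)%N.
    by apply: leq_trans kd; apply: leq_trans (ltn_ord j) (leq_addr _ _).
  have ltv (j : 'I_k) : (k + j < d)%N by apply: leq_trans kd; rewrite ltn_add2l.
  apply: (@block_packing R kappa kg d k (fun j => Ordinal (ltu j)) (fun j => Ordinal (ltv j))) => //.
  - by move=> i j /(congr1 val)/= ij; exact: val_inj.
  - by move=> i j /(congr1 val)/= /addnI ij; exact: val_inj.
  - move=> i j; apply/negP => /eqP/(congr1 val)/= ij.
    by have := ltn_ord j; rewrite ij ltnNge leq_addr.
  - by rewrite (_ : 9 = 3 ^ 2)%N// -expnMn leq_exp2r// leq_3half.
set X := 1 + _ in mom.
have XE : X = 1 + C1 * alpha ^+ 2 by rewrite /X /C1 exprMn; ring.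
clearbody X C1; clear a1 ath th0 K0 th.
have X1 : 1 < X by rewrite XE ltrDl mulr_gt0// exprn_gt0.
have X0 : 0 <= X by lra.
have N0 : (0 < N)%N.
  by case: N dN {card} => //; rewrite muln0 leqn0 expn_eq0/= andbT => /eqP dd; rewrite dd in d0.
have VR : 0 < V%:R :> R by rewrite ltr0n.
have cardR : 5 ^+ N * V%:R <= #|I|%:R :> R by rewrite -natrX -natrM ler_nat.
pose z0 : @Rd R d := [tuple (0 : R) | i < d].
have mG i : measurable (correct (Gauss r d kappa alpha) (P i)) by exact: measurable_Gauss_correct.
have AG i : ((2 / 3)%:E <= \int[iid (iid (P i) m) n]_x B x (correct (Gauss r d kappa alpha) (P i)))%E.
  by apply: Bs; exact: val.
have nR : 0 <= n%:R :> R by [].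
have mR : 0 < m%:R :> R by rewrite ltr0n.
have NR : 0 < N%:R :> R by rewrite ltr0n.
have Xexp j : X ^+ j <= expR (C1 * alpha ^+ 2 * j%:R).
  rewrite [_ * j%:R]mulrC expRM_natl lerXn2r ?nnegrE ?expR_ge0// XE; exact: expR_ge1Dx.
have BA := family_dp_bound z0 dens X1 mom mG cnt AG m0 (ltW e0) Bdp.
have BB := family_amgm_bound dens X1 mom mG cnt AG.
set tau := Num.min _ _ in BA.
have tau0 : 0 <= tau by rewrite le_min ler01 sqrtr_ge0.
(* The two bounds on [tau], by 1 and by a multiple of [alpha sqrt m], turn this into the first two
   terms of the rate. *)
have KA : N%:R <= 4 * n%:R * tau * eps.
  have h1 : 5 ^+ N * (2 / 3) <= (1 + tau * (expR eps - 1)) ^+ n.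
    rewrite -(ler_pM2l VR); apply: le_trans BA.
    have -> : V%:R * (5 ^+ N * (2 / 3)) = 5 ^+ N * V%:R * (2 / 3) :> R by ring.
    by rewrite ler_wpM2r// divr_ge0.
  have h2 : expR eps - 1 <= 2 * eps by rewrite lerBlDl; apply: expR_le1D2; rewrite !ltW.
  have h3 : 0 <= expR eps - 1 by rewrite subr_ge0 -[1]expR0 ler_expR ltW.
  have h4 : (1 + tau * (expR eps - 1)) ^+ n <= expR (n%:R * (tau * (2 * eps))).
    rewrite expRM_natl lerXn2r ?nnegrE ?expR_ge0 ?addr_ge0 ?mulr_ge0//.
    apply: le_trans (expR_ge1Dx _); rewrite lerD2l ler_wpM2l//.
  have := le_trans (exp_half_le N0 q1) (le_trans h1 h4).
  by rewrite ler_expR => h; lra.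
have T1 : eps^-1 <= 4 * n%:R / N%:R.
  rewrite ler_pdivlMr// -ler_pdivlMl ?invr_gt0// invrK.
  have t1 : tau <= 1 by rewrite ge_min lexx.
  apply: le_trans KA _; rewrite [leRHS]mulrC ler_wpM2r ?(ltW e0)//.
  by rewrite ler_piMr// mulr_ge0.
pose y := C1 * alpha ^+ 2 * m%:R.
have y0 : 0 <= y by rewrite /y !mulr_ge0 ?sqr_ge0// ltW.
(* The bound is [sqrt (2 y)]. For [y > 1/2] it exceeds 1; otherwise
   [X ^+ m - 1 <= e^y - 1 <= 2 y]. *)
have T2' : tau <= Num.sqrt (2 * C1) * (alpha * Num.sqrt m%:R).
  have -> : Num.sqrt (2 * C1) * (alpha * Num.sqrt m%:R) = Num.sqrt (2 * y).
    rewrite -{1}(ger0_norm (ltW a0)) -sqrtr_sqr -sqrtrM ?sqr_ge0// -sqrtrM; last by rewrite mulr_ge0// ltW.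
    by congr Num.sqrt; rewrite /y; ring.
  have [h|h] := leP y 2^-1; last first.
    apply: (@le_trans _ _ 1); first by rewrite ge_min lexx.
    by rewrite -[leLHS]sqrtr1 ler_wsqrtr//; lra.
  apply: (@le_trans _ _ (Num.sqrt (X ^+ m - 1))); first by rewrite ge_min lexx orbT.
  apply: ler_wsqrtr; rewrite lerBlDl; apply: le_trans (Xexp m) _.
  by apply: expR_le1D2; rewrite y0.
have sm0 : 0 < Num.sqrt (m%:R : R) by rewrite sqrtr_gt0.
have T2 : (alpha * eps * Num.sqrt m%:R)^-1 <= 4 * Num.sqrt (2 * C1) * n%:R / N%:R.
  have g0 : 0 < alpha * eps * Num.sqrt m%:R by rewrite !mulr_gt0.
  rewrite ler_pdivlMr// -ler_pdivlMl ?invr_gt0// invrK.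
  apply: le_trans KA _.
  have : 4 * n%:R * eps * tau <= 4 * n%:R * eps * (Num.sqrt (2 * C1) * (alpha * Num.sqrt m%:R)).
    by rewrite ler_wpM2l// !mulr_ge0// ltW.
  by move=> h; lra.
have T3 : (alpha ^+ 2 * m%:R)^-1 <= 2 * C1 * n%:R / N%:R.
  have g0 : 0 < alpha ^+ 2 * m%:R by rewrite mulr_gt0// exprn_gt0.
  rewrite ler_pdivlMr// -ler_pdivlMl ?invr_gt0// invrK.
  pose rho : R := #|I|%:R / V%:R.
  have rho5 : 5 ^+ N <= rho by rewrite ler_pdivlMr.
  have rho0 : 0 < rho by apply: lt_le_trans rho5; rewrite exprn_gt0.
  (* With this value of [l] the first term of [family_amgm_bound] is half of the left-hand side, and
     the other half bounds the second moment from below. *)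
  have l0 : 0 < rho * (2 / 3) by rewrite mulr_gt0// divr_gt0.
  have := BB _ l0.
  have IE : #|I|%:R = rho * V%:R :> R by rewrite divfK// gt_eqF.
  rewrite IE -exprM; set Y := X ^+ (m * n).
  have -> : rho * V%:R * (Y / (2 * (rho * (2 / 3)))) = V%:R * (3 / 4 * Y) by field; rewrite gt_eqF.
  have -> : rho * V%:R * (2 / 3) = V%:R * (rho * (2 / 3)) by ring.
  have -> : rho * (2 / 3) / 2 * V%:R = V%:R * (rho / 3) by field.
  rewrite -mulrDr ler_pM2l// => h.
  have hY : 5 ^+ N * (4 / 9) <= Y by lra.
  have := le_trans (exp_half_le N0 q2) (le_trans hY (Xexp (m * n)%N)).
  by rewrite ler_expR natrM => h'; lra.
have dR : d%:R ^+ 2 <= 9 * N%:R :> R by rewrite -natrX -natrM ler_nat.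
rewrite ler_pdivrMl ?mulr_gt0// /gauss_rate -!mulrDr.
have g1 : 0 <= eps^-1 + (alpha * eps * Num.sqrt m%:R)^-1 + (alpha ^+ 2 * m%:R)^-1.
  by rewrite !addr_ge0 ?invr_ge0 ?mulr_ge0 ?sqr_ge0// ltW.
apply: (@le_trans _ _ (9 * N%:R * (A * n%:R / N%:R))).
  apply: ler_pM => //.
  by rewrite /A; move: T1 T2 T3 => ? ? ?; lra.
by rewrite le_eqVlt; apply/orP; left; apply/eqP; field; rewrite gt_eqF.
Qed.

End lower.

(** * The private tournament *)

Lemma measurable_fun_invr {R : realType} {d} {T : measurableType d} (f : T -> R) :
  measurable_fun [set: T] f -> (forall x, 0 < f x) ->
  measurable_fun [set: T] (fun x => (f x)^-1).
Proof.
move=> mf f0; rewrite (_ : (fun _ => _) = fun x => expR (- ln (f x))).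
  apply: measurable_fun_expR; apply: measurable_fun_oppr.
  exact: (measurableT_comp (@measurable_ln R) mf).
by apply/funext => x; rewrite expRN lnK// posrE.
Qed.

Section finite_mixture.
Context {R : realType} {dX dO : measure_display}.
Context {X : measurableType dX} {O : measurableType dO}.
Variables (N : nat) (out : 'I_N.+1 -> O) (w : 'I_N.+1 -> X -> R).
Hypothesis mw : forall i, measurable_fun [set: X] (w i).
Hypothesis w0 : forall i x, 0 <= w i x.
Hypothesis w1 : forall x, \sum_i w i x = 1.

Definition mixture (x : X) : {measure set O -> \bar R} :=
  msum (fun k => mscale (NngNum (w0 (inord k) x)) (dirac (out (inord k)))) N.+1.

Lemma mixtureE x S : mixture x S = (\sum_i w i x * \1_S (out i))%:E.
Proof.
rewrite /mixture/= /msum -sumEFin; apply: eq_bigr => i _.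
by rewrite /mscale/= inord_val EFinM /dirac.
Qed.

Let measurable_mixture U : measurable U -> measurable_fun [set: X] (mixture ^~ U).
Proof.
move=> mU; rewrite (_ : (fun x => mixture x U) = fun x => (\sum_i w i x * \1_U (out i))%:E); last first.
  by apply/funext => x; rewrite mixtureE.
apply/measurable_EFinP; apply: measurable_sum => i.
by apply: measurable_funM => //; exact: mw.
Qed.

HB.instance Definition _ := isKernel.Build _ _ _ _ R mixture measurable_mixture.

Let mixture_prob x : mixture x [set: O] = 1%E.
Proof.
rewrite mixtureE; congr EFin; rewrite -[RHS](w1 x); apply: eq_bigr => i _.
by rewrite indicT mulr1.
Qed.

HB.instance Definition _ := Kernel_isProbability.Build _ _ _ _ R mixture mixture_prob.

Lemma exists_mixture_kernel : exists A : R.-pker X ~> O,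
  forall x S, A x S = (\sum_i w i x * \1_S (out i))%:E.
Proof. by exists mixture => x S; exact: mixtureE. Qed.

End finite_mixture.

Section tournament.
Context {R : realType} {dY dO : measure_display}.
Context {Y : measurableType dY} {O : measurableType dO}.
Variables (N n : nat) (s : 'I_N.+1 -> 'I_N.+1 -> Y -> R) (tau lam : R).
Hypothesis ms : forall i j, measurable_fun [set: Y] (s i j).
Hypothesis s_le : forall i j y, `|s i j y| <= tau.
Hypothesis lam0 : 0 <= lam.

Definition score i j (x : n.-tuple Y) : R := \sum_k s i j (tnth x k).
(* [weight] is an exponential mechanism for a soft minimum over [j] of the scores
   [score i j]; [energy] is [exp (- lam)] raised to that soft minimum. *)
Definition energy i (x : n.-tuple Y) : R := \sum_j expR (- (lam * score i j x)).
Definition weight i (x : n.-tuple Y) : R :=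
  (energy i x)^-1 / \sum_k (energy k x)^-1.

Let mscore i j : measurable_fun [set: n.-tuple Y] (score i j).
Proof.
apply: measurable_sum => k.
by apply: (measurableT_comp (ms i j)); exact: measurable_tnth.
Qed.

Let energy_gt0 i x : 0 < energy i x.
Proof.
by rewrite /energy big_ord_recl ltr_wpDr ?expR_gt0// sumr_ge0// => j _; exact: expR_ge0.
Qed.

Let menergy i : measurable_fun [set: n.-tuple Y] (energy i).
Proof.
apply: measurable_sum => j; apply: measurable_fun_expR; apply: measurable_fun_oppr.
by apply: measurable_funM => //; exact: mscore.
Qed.

Let total_gt0 x : 0 < \sum_k (energy k x)^-1.
Proof.
rewrite big_ord_recl ltr_wpDr ?invr_gt0// sumr_ge0// => j _.
by rewrite invr_ge0 ltW.
Qed.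

Lemma measurable_weight i : measurable_fun [set: n.-tuple Y] (weight i).
Proof.
have mV k : measurable_fun [set: n.-tuple Y] (fun x => (energy k x)^-1).
  exact: measurable_fun_invr (menergy k) (energy_gt0 k).
apply: measurable_funM; first exact: mV.
by apply: measurable_fun_invr => //; apply: measurable_sum => k; exact: mV.
Qed.

Lemma weight_ge0 i x : 0 <= weight i x.
Proof. by rewrite /weight divr_ge0 ?invr_ge0 ?ltW. Qed.

Lemma weight_sum1 x : \sum_i weight i x = 1.
Proof. by rewrite /weight -mulr_suml divff// gt_eqF. Qed.

Let score_close i j (l : 'I_n) (x x' : n.-tuple Y) :
  (forall k, k != l -> tnth x k = tnth x' k) -> score i j x' <= score i j x + 2 * tau.
Proof.
move=> h; rewrite /score (bigD1 l)//= [in leRHS](bigD1 l)//=.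
rewrite (eq_bigr (fun k => s i j (tnth x k))); last by move=> k kl; rewrite h.
have := s_le i j (tnth x l); have := s_le i j (tnth x' l).
rewrite !ler_norml => /andP[? ?] /andP[? ?]; lra.
Qed.

Let energy_close i (l : 'I_n) (x x' : n.-tuple Y) :
  (forall k, k != l -> tnth x k = tnth x' k) ->
  energy i x <= expR (2 * lam * tau) * energy i x'.
Proof.
move=> h; rewrite /energy mulr_sumr; apply: ler_sum => j _.
rewrite -expRD ler_expR; have := ler_wpM2l lam0 (score_close i j h).
by rewrite mulrDr; lra.
Qed.

(** One user moves a score by at most [2 tau], so the numerator and the normalizer each change by a
    factor of at most [exp (2 lam tau)]. *)
Lemma weight_close i (l : 'I_n) (x x' : n.-tuple Y) :
  (forall k, k != l -> tnth x k = tnth x' k) ->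
  weight i x <= expR (4 * lam * tau) * weight i x'.
Proof.
move=> h; have h' k : k != l -> tnth x' k = tnth x k by move=> /h ->.
pose E := expR (2 * lam * tau); have E0 : 0 < E by exact: expR_gt0.
have V (y y' : n.-tuple Y) k : (forall k, k != l -> tnth y k = tnth y' k) ->
    (energy k y')^-1 <= E * (energy k y)^-1.
  move=> hy; rewrite -[leLHS]mul1r ler_pdivrMr// mulrAC ler_pdivlMr// mul1r.
  exact: energy_close hy.
have -> : expR (4 * lam * tau) = E * E by rewrite /E -expRD; congr expR; ring.
rewrite /weight ler_pdivrMr//.
have h1 : (energy i x)^-1 <= E * (energy i x')^-1 by apply: V.
have h2 : \sum_k (energy k x')^-1 <= E * \sum_k (energy k x)^-1.
  by rewrite mulr_sumr; apply: ler_sum => k _; exact: V.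
apply: (le_trans h1).
have -> : E * E * ((energy i x')^-1 / (\sum_k (energy k x')^-1)) * (\sum_k (energy k x)^-1) =
  E * (energy i x')^-1 * ((E * \sum_k (energy k x)^-1) / (\sum_k (energy k x')^-1)) by ring.
rewrite ler_peMr//; first by rewrite mulr_ge0 ?invr_ge0 ?ltW.
by rewrite ler_pdivlMr// mul1r.
Qed.

(** Keeping only [i'] in the normalizer and only the rival [i'] in [energy i] leaves
    [energy i' * exp (lam * score i i')]. AM-GM then separates the two scores at the price of
    doubling [lam], and each term becomes a product over the users. *)
Let weight_le i i' x : weight i x <=
  \sum_j (2^-1 * \prod_k expR (2 * lam * s i i' (tnth x k)) +
          2^-1 * \prod_k expR (- (2 * lam) * s i' j (tnth x k))).
Proof.
have prodE (f : Y -> R) (c : R) : \prod_(k < n) expR (c * f (tnth x k)) = expR (c * \sum_k f (tnth x k)).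
  by rewrite mulr_sumr expR_sum.
apply: (@le_trans _ _ (energy i' x / energy i x)).
  rewrite /weight [leRHS]mulrC ler_pM2l ?invr_gt0//.
  rewrite -[leRHS]invrK lef_pV2 ?posrE ?invr_gt0//.
  rewrite (bigD1 i')//= lerDl sumr_ge0// => j _; by rewrite invr_ge0 ltW.
apply: (@le_trans _ _ (energy i' x * expR (lam * score i i' x))).
  apply: ler_wpM2l; first exact/ltW/energy_gt0.
  rewrite -[leRHS]invrK lef_pV2 ?posrE ?invr_gt0 ?expR_gt0//.
  rewrite -expRN /energy (bigD1 i')//= lerDl sumr_ge0// => j _; exact: expR_ge0.
rewrite /energy mulr_suml; apply: ler_sum => j _.
rewrite !prodE -/(score _ _ _) -/(score _ _ _).
set a := score i' j x; set b := score i i' x.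
have -> : expR (2 * lam * b) = expR (lam * b) ^+ 2 by rewrite -expRM_natl; congr expR; ring.
have -> : expR (- (2 * lam) * a) = expR (- (lam * a)) ^+ 2 by rewrite -expRM_natl; congr expR; ring.
have := sqr_ge0 (expR (- (lam * a)) - expR (lam * b)); lra.
Qed.

Local Open Scope ereal_scope.

Lemma weight_expectation (P : probability Y R) (rho : R) i i' : (0 <= rho)%R ->
  (forall j, \int[P]_y (expR (- (2 * lam) * s i' j y))%:E <= rho%:E) ->
  \int[P]_y (expR (2 * lam * s i i' y))%:E <= rho%:E ->
  \int[iid P n]_x (weight i x)%:E <= (N.+1%:R * rho ^+ n)%:E.
Proof.
move=> rho0 h1 h2.
have me c i1 j1 : measurable_fun [set: Y] (fun y => expR (c * s i1 j1 y))%R.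
  by apply: measurable_fun_expR; apply: measurable_funM => //; exact: ms.
have mp c i1 j1 : measurable_fun [set: n.-tuple Y] (fun x => \prod_k expR (c * s i1 j1 (tnth x k)))%R.
  exact: (measurable_prod_tnth (me c i1 j1)).
have p0 c i1 j1 (x : n.-tuple Y) : (0 <= \prod_(k < n) expR (c * s i1 j1 (tnth x k)))%R.
  by apply: prodr_ge0 => k _; exact: expR_ge0.
pose F j (x : n.-tuple Y) := (2^-1 * \prod_k expR (2 * lam * s i i' (tnth x k)) +
          2^-1 * \prod_k expR (- (2 * lam) * s i' j (tnth x k)))%R.
have mF j : measurable_fun [set: n.-tuple Y] (F j).
  by apply: measurable_funD; apply: measurable_funM => //; exact: mp.
have F0 j x : (0 <= F j x)%R by rewrite addr_ge0// mulr_ge0 ?invr_ge0//; exact: p0.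
apply: (@le_trans _ _ (\int[iid P n]_x (\sum_j F j x)%:E)).
  apply: le_integralr; [exact: measurable_weight| |exact: weight_ge0|].
  - by apply: measurable_sum => j; exact: mF.
  - by move=> x; exact: weight_le.
under eq_integral do rewrite -sumEFin.
rewrite ge0_integral_sum//; last 2 first.
- by move=> j; apply/measurable_EFinP; exact: mF.
- by move=> j x _; rewrite lee_fin; exact: F0.
apply: (@le_trans _ _ (\sum_(j < N.+1) (rho ^+ n)%:E)); last first.
  by rewrite sumEFin sumr_const card_ord mulr_natl.
apply: lee_sum => j _; rewrite integralDr; last 4 first.
- by apply: measurable_funM => //; exact: mp.
- by apply: measurable_funM => //; exact: mp.
- by move=> x; rewrite mulr_ge0 ?invr_ge0//; exact: p0.
- by move=> x; rewrite mulr_ge0 ?invr_ge0//; exact: p0.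
rewrite integralZr_nneg; [|exact: mp|by rewrite invr_ge0|by move=> x; exact: p0].
rewrite integralZr_nneg; [|exact: mp|by rewrite invr_ge0|by move=> x; exact: p0].
have e1 := integral_iid_prod_le n (me _ _ _) (fun y => expR_ge0 _) rho0 h2.
have e2 := integral_iid_prod_le n (me _ _ _) (fun y => expR_ge0 _) rho0 (h1 j).
apply: (@le_trans _ _ ((2^-1)%:E * (rho ^+ n)%:E + (2^-1)%:E * (rho ^+ n)%:E)).
  by apply: leeD; apply: lee_wpmul2l; rewrite ?lee_fin ?invr_ge0.
by rewrite -!EFinM -EFinD lee_fin; lra.
Qed.

(** The reference point [i'] wins against all rivals and every bad [i] loses to [i'], with a factor
    [rho] per user. The square counts the bad points and the rivals of [i']. *)
Lemma tournament_utility (P : probability Y R) (rho : R) i' (good : pred 'I_N.+1) :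
  (0 <= rho)%R ->
  (forall j, \int[P]_y (expR (- (2 * lam) * s i' j y))%:E <= rho%:E) ->
  (forall i, ~~ good i -> \int[P]_y (expR (2 * lam * s i i' y))%:E <= rho%:E) ->
  (1 - N.+1%:R ^+ 2 * rho ^+ n)%:E <=
    \int[iid P n]_x (\sum_i weight i x * (good i)%:R)%:E.
Proof.
move=> rho0 h1 h2.
have mg (b : pred 'I_N.+1) : measurable_fun [set: n.-tuple Y] (fun x => \sum_i weight i x * (b i)%:R)%R.
  by apply: measurable_sum => i; apply: measurable_funM => //; exact: measurable_weight.
have g0 (b : pred 'I_N.+1) x : (0 <= \sum_i weight i x * (b i)%:R)%R.
  by apply: sumr_ge0 => i _; rewrite mulr_ge0 ?weight_ge0.
pose bad i := ~~ good i.
have E : \int[iid P n]_x (\sum_i weight i x * (good i)%:R)%:E +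
    \int[iid P n]_x (\sum_i weight i x * (bad i)%:R)%:E = 1.
  rewrite -integralDr; [|exact: mg|exact: mg|by move=> x; exact: g0|by move=> x; exact: g0].
  rewrite -[RHS](integral_cstr (iid P n) 1); apply: eq_integral => x _.
  congr EFin; rewrite -big_split/= -[RHS](weight_sum1 x); apply: eq_bigr => i _.
  by rewrite /bad -mulrDr; case: (good i); rewrite ?addr0 ?add0r mulr1.
have B : \int[iid P n]_x (\sum_i weight i x * (bad i)%:R)%:E <= (N.+1%:R ^+ 2 * rho ^+ n)%:E.
  under eq_integral do rewrite -sumEFin.
  rewrite ge0_integral_sum//; last 2 first.
  - by move=> i; apply/measurable_EFinP; apply: measurable_funM => //; exact: measurable_weight.
  - by move=> i x _; rewrite lee_fin mulr_ge0 ?weight_ge0.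
  apply: (@le_trans _ _ (\sum_(j < N.+1) (N.+1%:R * rho ^+ n)%:E)); last first.
    by rewrite sumEFin sumr_const card_ord -[(_ * _ *+ _)%R]mulr_natl mulrA -expr2.
  apply: lee_sum => i _; rewrite /bad; case: (boolP (good i)) => gi /=.
    under eq_integral do rewrite mulr0.
    by rewrite integral0 lee_fin mulr_ge0// exprn_ge0.
  under eq_integral do rewrite mulr1.
  exact: (weight_expectation rho0 h1 (h2 i gi)).
rewrite EFinB -E leeBlDr// leeD2l//.
Qed.

End tournament.

Section tournament_algorithm.
Context {R : realType} {dZ dO : measure_display}.
Context {Z : measurableType dZ} {O : measurableType dO}.

Lemma tournament_achievable (t : @task R _ _ Z O) (m n N : nat) (eps tau lam rho : R)
    (out : 'I_N.+1 -> O) (s : 'I_N.+1 -> 'I_N.+1 -> m.-tuple Z -> R) :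
  (forall i j, measurable_fun [set: m.-tuple Z] (s i j)) ->
  (forall i j y, `|s i j y| <= tau) -> 0 <= lam -> 4 * lam * tau <= eps -> 0 <= rho ->
  (forall D, valid t D -> exists i',
    (forall j, \int[iid D m]_y (expR (- (2 * lam) * s i' j y))%:E <= rho%:E)%E /\
    (forall i, ~ correct t D (out i) ->
       \int[iid D m]_y (expR (2 * lam * s i i' y))%:E <= rho%:E)%E) ->
  N.+1%:R ^+ 2 * rho ^+ n <= 3^-1 ->
  achievable t m eps 0 n.
Proof.
move=> ms sle l0 le rho0 H hn.
have [A AE] := exists_mixture_kernel out (@measurable_weight _ _ _ N n s lam ms)
  (@weight_ge0 _ _ _ N n s lam) (@weight_sum1 _ _ _ N n s lam).
exists A.
- move=> x x' [l xx'] S mS; rewrite !AE adde0 -EFinM lee_fin mulr_sumr.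
  apply: ler_sum => i _; rewrite mulrA ler_wpM2r//.
  apply: le_trans (weight_close sle l0 i xx') _.
  by rewrite ler_wpM2r ?weight_ge0// ler_expR.
- move=> D vD; have [i' [h1 h2]] := H D vD.
  pose good i := out i \in correct t D.
  have h2' i : ~~ good i -> (\int[iid D m]_y (expR (2 * lam * s i i' y))%:E <= rho%:E)%E.
    by move=> /negP gi; apply: h2 => c; apply: gi; exact: mem_set.
  have := @tournament_utility _ _ _ N n s lam ms (iid D m) rho i' good rho0 h1 h2'.
  under eq_integral do rewrite -[X in X%:E]/(\sum_i weight s lam i _ * \1_(correct t D) (out i))%R -AE.
  by apply: le_trans; rewrite lee_fin; lra.
Qed.

End tournament_algorithm.

(** * The clipped empirical frequency of an event *)

Section frequency.
Context {R : realType} {d : measure_display} {Z : measurableType d}.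

Lemma expR_le1DX2 (x : R) : `|x| <= 2^-1 -> expR x <= 1 + x + 2 * x ^+ 2.
Proof.
rewrite ler_norml => /andP[x0 x1]; have := expR_ge1Dx (- x); rewrite expRN => h.
have h' : 0 < 1 - x by lra.
apply: (@le_trans _ _ (1 - x)^-1).
  by rewrite -[leLHS]invrK lef_pV2 ?posrE ?invr_gt0 ?expR_gt0.
rewrite -[leLHS]mul1r ler_pdivrMr// -subr_ge0.
have -> : (1 + x + 2 * x ^+ 2) * (1 - x) - 1 = x ^+ 2 * (1 - 2 * x) by ring.
by rewrite mulr_ge0 ?sqr_ge0//; lra.
Qed.

Variables (D : probability Z R) (m : nat) (B : set Z).
Hypotheses (m0 : (0 < m)%N) (mB : measurable B).
Let p : R := fine (D B).

Definition freq (y : m.-tuple Z) : R := (\sum_l \1_B (tnth y l)) / m%:R.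

Let p01 : 0 <= p <= 1.
Proof.
rewrite /p fine_ge0//=; have := @probability_le1 _ _ _ D B mB.
by rewrite -[D B]fineK ?fin_num_measure// lee_fin.
Qed.

Let mR : 0 < m%:R :> R. Proof. by rewrite ltr0n. Qed.

Let mI (l : 'I_m) : measurable_fun [set: m.-tuple Z] (fun y => \1_B (tnth y l) : R).
Proof. by apply: (measurableT_comp (measurable_indic _)) => //; exact: measurable_tnth. Qed.

Lemma measurable_freq : measurable_fun [set: m.-tuple Z] freq.
Proof. by apply: measurable_funM => //; apply: measurable_sum => l; exact: mI. Qed.

Lemma freq_ge0 y : 0 <= freq y.
Proof. by rewrite divr_ge0// sumr_ge0. Qed.

Local Open Scope ereal_scope.

Let integral_B : \int[D]_z (\1_B z)%:E = p%:E.
Proof. by rewrite integral_indic// setIT /p fineK// fin_num_measure. Qed.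

Lemma integral_freq : \int[iid D m]_y (freq y)%:E = p%:E.
Proof.
under eq_integral do rewrite /freq mulrC.
have mS : measurable_fun [set: m.-tuple Z] (fun y => \sum_l \1_B (tnth y l) : R)%R.
  by apply: measurable_sum => l; exact: mI.
rewrite integralZr_nneg; [|exact: mS|by rewrite invr_ge0|by move=> y; rewrite sumr_ge0].
under eq_integral do rewrite -sumEFin.
rewrite ge0_integral_sum//; last by move=> l; apply/measurable_EFinP; exact: mI.
have E (l : 'I_m) : \int[iid D m]_y (\1_B (tnth y l) : R)%:E = p%:E.
  rewrite (integral_iid_resample D l); [|by apply/measurable_EFinP; exact: mI|by move=> y; rewrite lee_fin].
  under eq_integral => y _.
    under eq_integral => z _ do rewrite tnth_upd eqxx.
    rewrite integral_B.
    over.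
  exact: integral_cstr.
rewrite (eq_bigr (fun=> p%:E)); last by move=> l _; exact: E.
by rewrite sumEFin sumr_const card_ord -EFinM -[(p *+ m)%R]mulr_natl mulrA mulVf ?mul1r// gt_eqF.
Qed.

(** Concentration at scale [1 / sqrt m]: the linear term of each example has mean zero, and
    [x = 1 / (2 sqrt m)] makes the product [(1 + 1 / (2 m))^m <= e^(1/2) <= 2]. *)
Lemma freq_mgf : \int[iid D m]_y (expR (Num.sqrt m%:R / 2 * (freq y - p)))%:E <= 2%:E.
Proof.
pose q : R := Num.sqrt m%:R.
have q2 : (q ^+ 2 = m%:R)%R by rewrite sqr_sqrtr// ltW.
have q1 : (1 <= q)%R by rewrite -sqrtr1 ler_wsqrtr// ler1n.
have q0 : (0 < q)%R by lra.
pose x := ((2 * q)^-1)%R.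
have x0 : (0 < x)%R by rewrite invr_gt0 mulr_gt0.
have x1 : (x <= 2^-1)%R by rewrite lef_pV2 ?posrE; lra.
have x2 : (2 * x ^+ 2 = (2 * m%:R)^-1)%R by rewrite /x -q2; field; rewrite gt_eqF.
pose g (z : Z) : R := expR (x * (\1_B z - p)).
have mg : measurable_fun [set: Z] g.
  apply: measurable_fun_expR; apply: measurable_funM => //; apply: measurable_funB => //.
under eq_integral => y _.
  rewrite (_ : expR _ = \prod_l g (tnth y l))%R; last first.
    rewrite -expR_sum -mulr_sumr sumrB sumr_const card_ord; congr expR.
    rewrite /freq -/q -[(p *+ m)%R]mulr_natl -q2 /x; field; rewrite gt_eqF//.
  over.
have /andP[pl ph] := p01.
have gc : \int[D]_z (g z)%:E <= (1 + 2 * x ^+ 2)%:E.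
  have mi : measurable_fun [set: Z] (\1_B : Z -> R) by exact: measurable_indic.
  (* The constant [x p] is added on both sides so that only nonnegative functions are integrated. *)
  have L : \int[D]_z (g z + x * p)%:E <= \int[D]_z ((1 + 2 * x ^+ 2) + x * \1_B z)%:E.
    apply: le_integralr.
    - by apply: measurable_funD.
    - by apply: measurable_funD => //; apply: measurable_funM.
    - by move=> z; rewrite addr_ge0 ?expR_ge0// mulr_ge0// ltW.
    move=> z; have [b0 b1] : (0 <= \1_B z :> R)%R /\ (\1_B z <= 1 :> R)%R by rewrite indicE; case: (z \in B); rewrite ?lexx ?ler01.
    have bp : (`|\1_B z - p| <= 1)%R by rewrite ler_norml; apply/andP; split; lra.
    have h : (`|x * (\1_B z - p)| <= 2^-1)%R.
      rewrite normrM (gtr0_norm x0); apply: le_trans x1.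
      by rewrite ler_piMr// ltW.
    have := expR_le1DX2 h; rewrite /g exprMn.
    have : ((\1_B z - p) ^+ 2 <= 1)%R by rewrite -real_normK ?num_real// expr_le1.
    move=> hb; have := ler_wpM2l (sqr_ge0 x) hb; move=> ? ?; lra.
  have xp : (0 <= x * p)%R by rewrite mulr_ge0// ltW.
  rewrite integralDr// in L; last by move=> z; exact: expR_ge0.
  rewrite integralDr in L; last 4 first.
  - exact: measurable_cst.
  - exact: (measurable_funM (measurable_cst _) mi).
  - by move=> z; rewrite addr_ge0// mulr_ge0// sqr_ge0.
  - by move=> z; rewrite mulr_ge0// ltW.
  rewrite integral_cstr integral_cstr integralZr_nneg// in L; last exact: ltW.
  move: L; rewrite integral_B -EFinM.
  by rewrite leeD2rE.
have c0 : (0 <= 1 + 2 * x ^+ 2)%R by rewrite addr_ge0// mulr_ge0// sqr_ge0.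
apply: le_trans (integral_iid_prod_le m mg (fun z => expR_ge0 _) c0 gc) _.
rewrite lee_fin x2; apply: (@le_trans _ _ (expR ((2 * m%:R)^-1) ^+ m)%R).
  by apply: lerXn2r; [rewrite nnegrE -x2|rewrite nnegrE expR_ge0|exact: expR_ge1Dx].
rewrite -expRM_natl (_ : m%:R * _ = 2^-1)%R; last by field; rewrite gt_eqF.
have := @expR_le1DX2 2^-1; rewrite ger0_norm ?invr_ge0// => /(_ (lexx _)); lra.
Qed.

Definition clip (tau x : R) : R := Num.max (- tau)%R (Num.min tau x).

Lemma clip_le tau x : (0 <= tau)%R -> (`|clip tau x| <= tau)%R.
Proof.
move=> t0; rewrite /clip ler_norml; apply/andP; split; first by rewrite le_max lexx.
by rewrite ge_max ge_min lexx/= andbT; lra.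
Qed.

Lemma clipN tau x : (0 <= tau)%R -> clip tau (- x) = (- clip tau x)%R.
Proof.
move=> t0.
have hi y : (tau <= y)%R -> clip tau y = tau.
  by move=> h; rewrite /clip (min_l h) max_r//; lra.
have lo y : (y <= - tau)%R -> clip tau y = (- tau)%R.
  by move=> h; rewrite /clip (@min_r _ _ tau y) ?max_l//; lra.
have mi y : (- tau <= y)%R -> (y <= tau)%R -> clip tau y = y.
  by move=> h1 h2; rewrite /clip (min_r h2) max_r.
have [h1|h1] := leP tau x; first by rewrite (hi x)// lo//; lra.
have [h2|h2] := leP x (- tau)%R; first by rewrite (lo x)// hi//; lra.
by rewrite (mi x) ?ltW// mi//; lra.
Qed.

Lemma measurable_clip tau c : measurable_fun [set: m.-tuple Z] (fun y => clip tau (freq y - c)).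
Proof.
apply: measurable_maxr => //; apply: measurable_minr => //.
by apply: measurable_funB => //; exact: measurable_freq.
Qed.

(* The clipped vote is at least [3/10 alpha + Z - (Z - tau / 2)^+] with
   [Z = freq - p] centred, and [(Z - tau / 2)^+ <= 2 / sqrt m * exp (sqrt m / 2 * (Z - tau / 2))]. *)
Lemma clip_mgf (alpha tau lam mid : R) : (0 < alpha)%R -> (alpha <= tau)%R ->
  (4 * expR (- (Num.sqrt m%:R * tau / 4)) <= alpha / 10)%R ->
  (0 < lam)%R -> (4 * lam * tau <= 1)%R -> (8 * lam * tau ^+ 2 <= alpha / 5)%R ->
  (mid + 3 / 10 * alpha <= p)%R ->
  \int[iid D m]_y (expR (- (2 * lam) * clip tau (freq y - mid)))%:E <=
    (expR (- (lam * alpha / 5)))%:E.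
Proof.
move=> a0 at_ htau l0 l1 l2 hmid.
pose q : R := Num.sqrt m%:R.
have q1 : (1 <= q)%R by rewrite -sqrtr1 ler_wsqrtr// ler1n.
have q0 : (0 < q)%R by lra.
have t0 : (0 < tau)%R by lra.
have /andP[pl ph] := p01.
pose T (y : m.-tuple Z) : R := expR (q / 2 * (freq y - p)).
pose kT : R := (2 * expR (- (q * tau / 4)))%R.
have kT0 : (0 <= kT)%R by rewrite mulr_ge0 ?expR_ge0.
pose K := (1 + 8 * lam ^+ 2 * tau ^+ 2 - 2 * lam * (3 / 10 * alpha) + 2 * lam * p)%R.
have mf := measurable_freq.
have mT : measurable_fun [set: m.-tuple Z] T.
  by apply: measurable_fun_expR; apply: measurable_funM => //; apply: measurable_funB.
have K0 : (0 <= K)%R.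
  rewrite /K; have : (lam * alpha <= lam * tau)%R by rewrite ler_wpM2l// ltW.
  have : (0 <= lam * p)%R by rewrite mulr_ge0// ltW.
  have : (0 <= lam ^+ 2 * tau ^+ 2)%R by rewrite mulr_ge0 ?sqr_ge0.
  by move=> *; lra.
have ptw y : (expR (- (2 * lam) * clip tau (freq y - mid)) + 2 * lam * freq y <=
    K + 2 * lam * kT * T y)%R.
  set f := freq y; set s := clip tau _.
  have s1 : (`|s| <= tau)%R by apply: clip_le; exact: ltW.
  have h : (`|- (2 * lam) * s| <= 2^-1)%R.
    rewrite normrM normrN (@gtr0_norm _ (2 * lam)%R) ?mulr_gt0//.
    have : (2 * lam * `|s| <= 2 * lam * tau)%R by rewrite ler_wpM2l// mulr_ge0 ?ltW.
    by move=> ?; lra.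
  have s2 : (s ^+ 2 <= tau ^+ 2)%R by rewrite -[leLHS]real_normK ?num_real// lerXn2r// nnegrE ltW.
  have e1 := expR_le1DX2 h.
  have e2 : (2 * (- (2 * lam) * s) ^+ 2 <= 8 * lam ^+ 2 * tau ^+ 2)%R.
    have := ler_wpM2l (sqr_ge0 lam) s2; rewrite exprMn sqrrN exprMn => ?; lra.
  have P0 : (0 <= kT * T y)%R by rewrite mulr_ge0 ?expR_ge0.
  have P1 : (f - p - tau / 2 <= kT * T y)%R.
    rewrite /kT /T -mulrA -expRD.
    have := expR_ge1Dx (- (q * tau / 4) + q / 2 * (freq y - p)); rewrite -/f.
    set E := expR _ => hE.
    have E0 : (0 <= E)%R by exact: expR_ge0.
    have : (q * (f - p - tau / 2) <= 2 * E)%R by lra.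
    have [hn _|hp hq] := leP (f - p - tau / 2)%R 0%R; first by lra.
    apply: le_trans hq; rewrite ler_peMl// ltW//.
  have s3 : (3 / 10 * alpha + (f - p) - kT * T y <= s)%R.
    rewrite /s /clip le_max le_min; apply/orP.
    have [h1|h1] := leP (f - mid)%R (- tau)%R; [left; lra|right].
    by apply/andP; split; lra.
  have := ler_wpM2l (ltW l0) s3.
  by rewrite /K; move=> ?; lra.
have m1 : measurable_fun [set: m.-tuple Z] (fun y => expR (- (2 * lam) * clip tau (freq y - mid))).
  by apply: measurable_fun_expR; apply: measurable_funM => //; exact: measurable_clip.
have m2 : measurable_fun [set: m.-tuple Z] (fun y => 2 * lam * freq y)%R by apply: measurable_funM.
have m3 : measurable_fun [set: m.-tuple Z] (fun y => 2 * lam * kT * T y)%R by apply: measurable_funM.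
have l20 : (0 <= 2 * lam)%R by rewrite mulr_ge0 ?ltW.
have L : \int[iid D m]_y (expR (- (2 * lam) * clip tau (freq y - mid)) + 2 * lam * freq y)%:E <=
    \int[iid D m]_y (K + 2 * lam * kT * T y)%:E.
  apply: le_integralr => //; [exact: measurable_funD|exact: measurable_funD|].
  by move=> y; rewrite addr_ge0 ?expR_ge0// mulr_ge0 ?freq_ge0.
move: L; rewrite integralDr; [|exact: m1|exact: m2|by move=> y; exact: expR_ge0|by move=> y; rewrite mulr_ge0 ?freq_ge0].
rewrite [X in _ <= X]integralDr; [|exact: measurable_cst|exact: m3|by move=> y; exact: K0|by move=> y; apply: mulr_ge0; [apply: mulr_ge0|exact: expR_ge0]].
rewrite integralZr_nneg; [|exact: mf|exact: l20|by move=> y; exact: freq_ge0].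
rewrite integralZr_nneg; [|exact: mT|by rewrite mulr_ge0|by move=> y; exact: expR_ge0].
rewrite integral_cstr integral_freq -EFinM => L.
have F : (2 * lam * kT)%:E * \int[iid D m]_y (T y)%:E <= (2 * lam * (alpha / 10))%:E.
  apply: (@le_trans _ _ ((2 * lam * kT)%:E * 2%:E)).
    by apply: lee_wpmul2l; [rewrite lee_fin mulr_ge0|exact: freq_mgf].
  have k2 : (kT * 2 <= alpha / 10)%R by rewrite /kT; apply: le_trans htau; rewrite -/q; lra.
  by rewrite -EFinM lee_fin; have := ler_wpM2l l20 k2; lra.
have := le_trans L (leeD2l _ F); rewrite -EFinD -leeBrDr// -EFinB => {}L.
apply: (le_trans L); rewrite lee_fin; apply: le_trans (expR_ge1Dx _).
(* The drift is [- 2 lam (3/10 - 1/10) alpha], and the quadratic term [8 lam^2 tau^2] uses up half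
   of it. *)
have := ler_wpM2l (ltW l0) l2; rewrite /K; move=> ?; lra.
Qed.

End frequency.

(** * A net of Gaussians *)

Section shear.
Context {R : realType} {d : nat}.
Local Notation gam := (normal_prob (0 : R) 1).
Local Notation g := (iid gam d).
Local Notation Rdd := (@Rd R d).

Definition shear (i : 'I_d) (b : R) (r : 'I_d -> R) (x : Rdd) : Rdd :=
  upd x i (cd x i + b + \sum_j r j * cd x j).

Lemma measurable_shear i b r : measurable_fun [set: Rdd] (shear i b r).
Proof.
apply/measurable_fun_tnthP => k /=.
rewrite (_ : _ \o _ = fun x => if k == i then cd x i + b + \sum_j r j * cd x j else cd x k).
  case: (k == i); last exact: measurable_cd.
  apply: measurable_funD; first by apply: measurable_funD => //; exact: measurable_cd.
  by apply: measurable_sum => j; apply: measurable_funM => //; exact: measurable_cd.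
by apply/funext => x /=; rewrite tnth_upd.
Qed.

Local Open Scope ereal_scope.

(** Given the other coordinates a shear is [(1 + r_i) x_i + t], so [gauss_affine_tv] applies;
    averaging [|t|] costs [8 * 3/2 = 12 <= 14] for each other coefficient. *)
Lemma shear_tv i b r (f : Rdd -> R) : (\sum_j `|r j| <= 2^-1)%R ->
  measurable_fun [set: Rdd] f -> (forall x, (0 <= f x <= 1)%R) ->
  \int[g]_x (f x)%:E <=
  \int[g]_x (f (shear i b r x))%:E + (14 * (\sum_j `|r j|) + 8 * `|b|)%:E.
Proof.
move=> rle mf f01.
have f0 x : (0 <= f x)%R by have /andP[] := f01 x.
have mfs : measurable_fun [set: Rdd] (fun x => f (shear i b r x)).
  exact: (measurableT_comp mf (measurable_shear i b r)).
have ri : (`|r i| <= 2^-1)%R.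
  by apply: le_trans rle; rewrite (bigD1 i)//= lerDl sumr_ge0.
have si : (2^-1 <= 1 + r i <= 2)%R.
  by move: ri; rewrite ler_norml => /andP[? ?]; apply/andP; split; lra.
pose t (x : Rdd) : R := (b + \sum_(j | j != i) r j * cd x j)%R.
pose T (x : Rdd) : R := (14 * `|r i| + 8 * (`|b| + \sum_(j | j != i) `|r j| * `|cd x j|))%R.
have mT : measurable_fun [set: Rdd] T.
  apply: measurable_funD => //; apply: measurable_funM => //; apply: measurable_funD => //.
  under eq_fun do rewrite big_mkcond/=.
  apply: measurable_sum => j; case: (j != i) => //; apply: measurable_funM => //.
  by apply: measurable_fun_normr; exact: measurable_cd.
have T0 x : (0 <= T x)%R.
  rewrite /T addr_ge0 ?mulr_ge0 ?addr_ge0 ?sumr_ge0// => j _; exact: mulr_ge0.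
have mI1 : measurable_fun [set: Rdd] (fun x => (f x)%:E) by exact/measurable_EFinP.
have mI2 : measurable_fun [set: Rdd] (fun x => (f (shear i b r x))%:E) by exact/measurable_EFinP.
have E1 x : (0 <= (f x)%:E) by rewrite lee_fin.
rewrite (integral_iid_resample gam i mI1 E1).
rewrite (integral_iid_resample gam i mI2 (fun x => E1 _)).
have step x : \int[gam]_u (f (upd x i u))%:E <=
    \int[gam]_u (f (shear i b r (upd x i u)))%:E + (T x)%:E.
  have mfu : measurable_fun [set: R] (fun u => f (upd x i u)).
    exact: (measurableT_comp mf (measurable_updr x i)).
  have h := @gauss_affine_tv R (1 + r i)%R (t x) _ si mfu (fun u => f01 _).
  have E u : shear i b r (upd x i u) = upd x i ((1 + r i) * u + t x)%R.
    rewrite /shear upd_upd; congr (upd x i _).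
    rewrite cd_upd eqxx (bigD1 i)//= cd_upd eqxx /t.
    rewrite (eq_bigr (fun j => r j * cd x j)%R); first by ring.
    by move=> j ji; rewrite cd_upd (negbTE ji).
  under [X in _ <= X + _]eq_integral do rewrite E.
  apply: (le_trans h); rewrite leeD2l// lee_fin /T.
  have -> : (1 + r i - 1 = r i)%R by ring.
  rewrite lerD2l ler_wpM2l//; apply: le_trans (ler_normD _ _) _.
  rewrite lerD2l; apply: le_trans (ler_norm_sum _ _ _) _.
  by apply: ler_sum => j _; rewrite normrM.
have mJ (F : Rdd -> R) : measurable_fun [set: Rdd] F -> (forall x, (0 <= F x)%R) ->
    measurable_fun [set: Rdd] (fun x => \int[gam]_u (F (upd x i u))%:E).
  move=> mF F0; apply: (measurable_upd_inner gam i (f := fun x => (F x)%:E)).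
  - exact/measurable_EFinP.
  - by move=> x; rewrite lee_fin.
have mJs := mJ _ mfs (fun x => f0 _).
apply: (@le_trans _ _ (\int[g]_x (\int[gam]_u (f (shear i b r (upd x i u)))%:E + (T x)%:E))).
  apply: ge0_le_integral => //.
  - by move=> x _; apply: integral_ge0 => u _; rewrite lee_fin.
  - exact: mJ.
  - by apply: emeasurable_funD; [exact: mJs|exact/measurable_EFinP].
rewrite ge0_integralD; [|exact: measurableT|by move=> x _; apply: integral_ge0 => u _; rewrite lee_fin
  |exact: mJs|by move=> x _; rewrite lee_fin|by apply/measurable_EFinP].
rewrite leeD2l// /T.
have mn j : measurable_fun [set: Rdd] (fun x => `|r j| * `|cd x j|)%R.
  by apply: measurable_funM => //; apply: measurable_fun_normr; exact: measurable_cd.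
have ms : measurable_fun [set: Rdd] (fun x => \sum_(j | j != i) `|r j| * `|cd x j|)%R.
  by under eq_fun do rewrite big_mkcond/=; apply: measurable_sum => j; case: (j != i).
rewrite integralDr; last 4 first.
- exact: measurable_cst.
- by apply: measurable_funM => //; apply: measurable_funD.
- by move=> x; rewrite mulr_ge0.
- by move=> x; rewrite mulr_ge0// addr_ge0// sumr_ge0// => j _; exact: mulr_ge0.
rewrite [X in _ + X <= _]integralZr_nneg; last 3 first.
- by apply: measurable_funD.
- by [].
- by move=> x; rewrite addr_ge0// sumr_ge0// => j _; exact: mulr_ge0.
rewrite [\int[g]_x (_ + _)%:E]integralDr; last 4 first.
- exact: measurable_cst.
- exact: ms.
- by move=> x.
- by move=> x; rewrite sumr_ge0// => j _; exact: mulr_ge0.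
rewrite !integral_cstr.
have S : \int[g]_x (\sum_(j | j != i) `|r j| * `|cd x j|)%:E <= (\sum_(j | j != i) (3 / 2 * `|r j|))%:E.
  under eq_integral do rewrite -sumEFin -big_filter.
  rewrite ge0_integral_sum; [|exact: measurableT|by move=> j; apply/measurable_EFinP; exact: mn
    |by move=> j x _; rewrite lee_fin mulr_ge0].
  rewrite -sumEFin -[leRHS]big_filter; apply: lee_sum => j _.
  rewrite integralZr_nneg//; last by apply: measurable_fun_normr; exact: measurable_cd.
  rewrite (@integral_gauss_coord _ _ j (fun u => (`|u|)%:E)); last 2 first.
  - by apply/measurable_EFinP; exact: measurable_fun_normr.
  - by move=> u; rewrite lee_fin.
  rewrite mulrC EFinM; apply: lee_wpmul2l; first by rewrite lee_fin.
  exact: gauss_abs_moment_le.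
apply: (@le_trans _ _ (14 * `|r i| + 8 * (`|b| + \sum_(j | j != i) (3 / 2 * `|r j|)))%:E).
  rewrite [leRHS]EFinD leeD2l// [leRHS]EFinM; apply: lee_wpmul2l; first by rewrite lee_fin.
  by rewrite [leRHS]EFinD leeD2l.
rewrite lee_fin -mulr_sumr [in leRHS](bigD1 i)//=.
have : (0 <= \sum_(j | j != i) `|r j|)%R by exact: sumr_ge0.
by move=> ?; lra.
Qed.

End shear.

Section affine_tv.
Context {R : realType} {d : nat}.
Local Notation gam := (normal_prob (0 : R) 1).
Local Notation g := (iid gam d).
Local Notation Rdd := (@Rd R d).
Variables (E : 'M[R]_d) (b : 'cV[R]_d) (eta : R).
Hypothesis eta4 : eta <= 4^-1.
Hypothesis E_le : forall i, \sum_j `|E i j| <= eta.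
Hypothesis b_le : forall i, `|b i 0| <= eta.

Definition headmx k : 'M[R]_d := \matrix_(i, j) (if (i < k)%N then E i j else 0).
Definition headcv k : 'cV[R]_d := \col_i (if (i < k)%N then b i 0 else 0).

Let norm1 (v : 'rV[R]_d) : R := \sum_j `|v 0 j|.

Let headmx_le k i : \sum_j `|headmx k i j| <= eta.
Proof.
under eq_bigr do rewrite mxE; case: (i < k)%N; first exact: E_le.
by rewrite big1 => [|j _]; [apply: le_trans (E_le i); exact: sumr_ge0|rewrite normr0].
Qed.

Let norm1_mul k (v : 'rV[R]_d) : norm1 (v *m headmx k) <= norm1 v * eta.
Proof.
rewrite /norm1; apply: (@le_trans _ _ (\sum_j \sum_i `|v 0 i| * `|headmx k i j|)).
  apply: ler_sum => j _; rewrite mxE; apply: le_trans (ler_norm_sum _ _ _) _.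
  by apply: ler_sum => i _; rewrite normrM.
rewrite exchange_big/= mulr_suml; apply: ler_sum => i _.
by rewrite -mulr_sumr ler_wpM2l.
Qed.

(** The perturbation [v *m headmx k] has at most a quarter of the norm of [v]. This gives both the
    inverse used in the induction and a bound on it. *)
Let norm1_le k (v : 'rV[R]_d) : norm1 v <= 2 * norm1 (v *m (1%:M + headmx k)).
Proof.
have h := norm1_mul k v.
have h2 : norm1 v <= norm1 (v *m (1%:M + headmx k)) + norm1 (v *m headmx k).
  rewrite /norm1 -big_split/=; apply: ler_sum => j _.
  rewrite mulmxDr mulmx1 mxE.
  have := ler_normB (v 0 j + (v *m headmx k) 0 j) ((v *m headmx k) 0 j).
  by rewrite addrK.
have n0 : 0 <= norm1 v by exact: sumr_ge0.
have : norm1 v * eta <= norm1 v * 4^-1 by rewrite ler_wpM2l.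
lra.
Qed.

Let head_unit k : 1%:M + headmx k \in unitmx.
Proof.
rewrite -row_free_unit; apply: inj_row_free => v v0.
have := norm1_le k v; rewrite v0 {2}/norm1 big1 ?mulr0; last by move=> j _; rewrite mxE normr0.
move=> h; apply/rowP => j; rewrite mxE; apply/eqP; rewrite -normr_le0.
by apply: le_trans h; rewrite /norm1 (bigD1 j)//= lerDl sumr_ge0.
Qed.

Local Open Scope ereal_scope.

(* The map [x |-> b + (1 + E) x] is built one coordinate at a time: the new value of
   coordinate [k], an affine function of [x], is also an affine function of the
   vector whose first [k] coordinates have already been replaced. *)
Lemma affine_head_tv (k : nat) (f : Rdd -> R) : (k <= d)%N ->
  measurable_fun [set: Rdd] f -> (forall x, (0 <= f x <= 1)%R) ->
  \int[g]_x (f x)%:E <=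
  \int[g]_x (f (affine_map (headcv k) (1%:M + headmx k) x))%:E + (k%:R * (44 * eta))%:E.
Proof.
elim: k f => [|k IH] f kd mf f01.
  rewrite mul0r adde0; under [X in _ <= X]eq_integral => x _.
    rewrite (_ : affine_map _ _ _ = x); last first.
      apply: eq_from_tnth => i; rewrite tnth_mktuple mxE ltn0 add0r (bigD1 i)//= big1; last first.
        by move=> j ji; rewrite !mxE ltn0 addr0 eq_sym (negbTE ji) mul0r.
      by rewrite !mxE eqxx ltn0 !addr0 mul1r.
    over.
  exact: lexx.
pose i := Ordinal kd.
pose c : 'rV[R]_d := row i E.
pose r : 'rV[R]_d := c *m invmx (1%:M + headmx k).
have rc : r *m (1%:M + headmx k) = c by rewrite mulmxKV.
have r1 : (norm1 r <= 2 * eta)%R.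
  apply: le_trans (norm1_le k r) _; rewrite rc ler_pM2l// /norm1.
  by under eq_bigr do rewrite mxE; exact: E_le.
pose be := (b i 0 - (r *m headcv k) 0 0)%R.
have eta0 : (0 <= eta)%R by apply: le_trans (b_le i).
have be_le : (`|be| <= 2 * eta)%R.
  apply: le_trans (ler_normB _ _) _.
  have : (`|(r *m headcv k) 0 0| <= norm1 r * eta)%R.
    rewrite mxE; apply: le_trans (ler_norm_sum _ _ _) _; rewrite /norm1 mulr_suml.
    apply: ler_sum => j _; rewrite normrM ler_wpM2l// mxE.
    by case: (j < k)%N; rewrite ?normr0.
  have : (norm1 r * eta <= 2^-1 * eta)%R by rewrite ler_wpM2r//; move: r1 eta4; lra.
  by have := b_le i; move=> *; lra.
have rle : (\sum_j `|r 0 j| <= 2^-1)%R by move: r1 eta4; rewrite /norm1; lra.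
pose S := shear i be (fun j => r 0%R j).
have mS : measurable_fun [set: Rdd] (fun x => f (S x)).
  exact: (measurableT_comp mf (measurable_shear _ _ _)).
have SE x : S (affine_map (headcv k) (1%:M + headmx k) x) =
    affine_map (headcv k.+1) (1%:M + headmx k.+1) x.
  apply: eq_from_tnth => l; rewrite /S /shear -!/(cd _ l) cd_upd.
  have cE k' (a : 'I_d) : cd (affine_map (headcv k') (1%:M + headmx k') x) a =
      (headcv k' a 0 + (cd x a + \sum_j headmx k' a j * cd x j))%R.
    rewrite /cd tnth_mktuple; congr (_ + _)%R.
    under eq_bigr do rewrite mxE mulrDl; rewrite big_split/=; congr (_ + _)%R.
    rewrite (bigD1 a)//= mxE eqxx mul1r big1 ?addr0// => j ja.
    by rewrite mxE eq_sym (negbTE ja) mul0r.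
  case: eqVneq => [->|li]; last first.
    have lk : (l < k.+1)%N = (l < k)%N.
      by rewrite ltnS leq_eqVlt; move: li; rewrite -val_eqE/= => /negbTE ->.
    by rewrite !cE !mxE lk; congr (_ + (_ + _))%R; apply: eq_bigr => j _; rewrite !mxE lk.
  have R1 : (\sum_j r 0 j * cd (affine_map (headcv k) (1%:M + headmx k) x) j =
     (r *m headcv k) 0 0 + \sum_j c 0 j * cd x j)%R.
    rewrite -rc; under eq_bigr do rewrite /cd tnth_mktuple mulrDr.
    rewrite big_split/=; congr (_ + _)%R; first by rewrite mxE.
    under eq_bigr do rewrite mulr_sumr.
    rewrite exchange_big/=; apply: eq_bigr => j _; rewrite [in RHS]mxE mulr_suml.
    by apply: eq_bigr => a _; rewrite mulrA.
  rewrite R1 /be !cE !mxE /= ltnn ltnSn add0r.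
  rewrite [X in (_ + X + _ + _)%R]big1 ?addr0; last by move=> j _; rewrite mxE ltnn mul0r.
  rewrite [in RHS](eq_bigr (fun j => c 0 j * cd x j)%R); first by ring.
  by move=> j _; rewrite !mxE ltnSn.
have h1 := shear_tv i be rle mf f01.
have h2 : \int[g]_x (f (S x))%:E <=
  \int[g]_x (f (affine_map (headcv k.+1) (1%:M + headmx k.+1) x))%:E + (k%:R * (44 * eta))%:E.
  under [X in _ <= X + _]eq_integral do rewrite -SE.
  exact: (IH (fun x => f (S x)) (ltnW kd) mS (fun x => f01 _)).
apply: (le_trans h1); apply: (le_trans (leeD2r _ h2)).
(* Row and offset of the shear are at most [2 eta], so one coordinate costs
   [(14 + 8) * 2 eta = 44 eta]. *)
rewrite -addeA leeD2l// -EFinD lee_fin -natr1; move: r1 be_le; rewrite /norm1; lra.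
Qed.

Lemma affine_tv (f : Rdd -> R) :
  measurable_fun [set: Rdd] f -> (forall x, (0 <= f x <= 1)%R) ->
  \int[g]_x (f x)%:E <=
  \int[g]_x (f (affine_map b (1%:M + E) x))%:E + (d%:R * (44 * eta))%:E.
Proof.
move=> mf f01; have := affine_head_tv (leqnn d) mf f01.
have -> : headmx d = E by apply/matrixP => i j; rewrite mxE ltn_ord.
by have -> : headcv d = b by apply/colP => i; rewrite mxE ltn_ord.
Qed.

End affine_tv.

Section gauss_net.
Context {R : realType}.
Local Notation gam := (normal_prob (0 : R) 1).

Lemma affine_comp d (mu b : 'cV[R]_d) (M A : 'M[R]_d) (x : Rd d) :
  affine_map mu M (affine_map b A x) = affine_map (mu + M *m b) (M *m A) x.
Proof.
apply: eq_from_tnth => i; rewrite !tnth_mktuple !mxE -addrA; congr (_ + _).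
under eq_bigr do rewrite tnth_mktuple mulrDr mulr_sumr.
rewrite big_split/=; congr (_ + _); rewrite exchange_big/=; apply: eq_bigr => j _.
by rewrite mxE mulr_suml; apply: eq_bigr => k _; rewrite mulrA.
Qed.

Lemma quad_sum d (c : R) (M : 'M[R]_d) (u : 'rV[R]_d) :
  (u *m (M *m M^T - c%:M) *m u^T) 0 0 =
  \sum_j ((u *m M) 0 j) ^+ 2 - c * \sum_j (u 0 j) ^+ 2.
Proof.
have sq (v : 'rV[R]_d) : (v *m v^T) 0 0 = \sum_j v 0 j ^+ 2.
  by rewrite mxE; apply: eq_bigr => j _; rewrite mxE expr2.
rewrite mulmxBr mulmxBl mulmxA -mulmxA -trmx_mul mul_mx_scalar -scalemxAl.
by rewrite mxE sq mxE mxE sq.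
Qed.

Lemma loewner_lower d (M : 'M[R]_d) (u : 'rV[R]_d) : loewner_le 1%:M (M *m M^T) ->
  \sum_j (u 0 j) ^+ 2 <= \sum_j ((u *m M) 0 j) ^+ 2.
Proof.
by move=> [_ /(_ u^T)]; rewrite trmxK quad_sum mul1r subr_ge0.
Qed.

Lemma loewner_upper d (c : R) (M : 'M[R]_d) (u : 'rV[R]_d) : loewner_le (M *m M^T) c%:M ->
  \sum_j ((u *m M) 0 j) ^+ 2 <= c * \sum_j (u 0 j) ^+ 2.
Proof.
move=> [_ /(_ u^T)]; rewrite trmxK -opprB mulmxN mulNmx mxE quad_sum.
by rewrite opprB subr_ge0.
Qed.

(** Write [M' = M (1 + E)] and absorb [M] into the test function. The rows of the inverse of [M]
    have length at most 1, because the covariance is at least the identity; hence the entries of [E]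
    are at most [d h] and its row sums at most [d^2 h]. *)
Lemma gauss_law_close d (mu mu' : 'cV[R]_d) (M M' : 'M[R]_d) (h : R) :
  (0 < d)%N -> loewner_le 1%:M (M *m M^T) -> d%:R ^+ 2 * h <= 4^-1 ->
  (forall i j, `|M' i j - M i j| <= h) -> (forall i, `|mu' i 0 - mu i 0| <= h) ->
  forall B, measurable B ->
  `|fine (gauss_law mu' M' B) - fine (gauss_law mu M B)| <= d%:R * (44 * (d%:R ^+ 2 * h)).
Proof.
move=> d0 low dh hM hmu.
have h0 : 0 <= h by apply: le_trans (hmu (Ordinal d0)).
have uM : M \in unitmx.
  rewrite -row_free_unit; apply: inj_row_free => u u0.
  have := loewner_lower u low; rewrite u0 [leRHS]big1; last by move=> j _; rewrite mxE expr0n.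
  move=> hu; apply/rowP => j; rewrite mxE; apply/eqP; rewrite -sqrf_eq0 eq_le sqr_ge0 andbT.
  by apply: le_trans hu; rewrite (bigD1 j)//= lerDl sumr_ge0// => k _; exact: sqr_ge0.
have iM i j : `|invmx M i j| <= 1.
  have := loewner_lower (row i (invmx M)) low; rewrite -row_mul mulVmx//.
  rewrite [leRHS](bigD1 i)//= !mxE eqxx expr1n [X in _ <= 1 + X]big1 ?addr0; last first.
    by move=> k ki; rewrite !mxE eq_sym (negbTE ki) expr0n.
  move=> hu; rewrite -(@expr_le1 _ 2)// real_normK ?num_real//.
  apply: le_trans hu; rewrite (bigD1 j)//= mxE lerDl sumr_ge0// => k _; exact: sqr_ge0.
pose E := invmx M *m (M' - M); pose b := invmx M *m (mu' - mu).
have ME : M *m (1%:M + E) = M' by rewrite mulmxDr mulmx1 mulmxA mulmxV// mul1mx addrC subrK.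
have mE : mu + M *m b = mu' by rewrite mulmxA mulmxV// mul1mx addrC subrK.
have dhE : \sum_(k < d) h = d%:R * h by rewrite sumr_const card_ord mulr_natl.
have Eij i j : `|E i j| <= d%:R * h.
  rewrite mxE; apply: le_trans (ler_norm_sum _ _ _) _; rewrite -dhE.
  apply: ler_sum => k _; rewrite normrM !mxE -[leRHS]mul1r; apply: ler_pM => //; exact: hM.
have Ei i : \sum_j `|E i j| <= d%:R ^+ 2 * h.
  apply: (@le_trans _ _ (\sum_(j < d) (d%:R * h))); first by apply: ler_sum.
  by rewrite sumr_const card_ord -[leLHS]mulr_natl mulrA expr2.
have bi i : `|b i 0| <= d%:R ^+ 2 * h.
  apply: (@le_trans _ _ (d%:R * h)).
    rewrite mxE; apply: le_trans (ler_norm_sum _ _ _) _; rewrite -dhE.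
    apply: ler_sum => k _; rewrite normrM !mxE -[leRHS]mul1r; apply: ler_pM => //; exact: hmu.
  by rewrite ler_wpM2r// expr2 ler_peMl// ler1n.
have one B : measurable B ->
    fine (gauss_law mu M B) <= fine (gauss_law mu' M' B) + d%:R * (44 * (d%:R ^+ 2 * h)).
  move=> mB; rewrite -lee_fin EFinD !fineK ?fin_num_measure//.
  have PE nu A : gauss_law nu A B = (\int[iid gam d]_x (\1_B (affine_map nu A x))%:E)%E.
    transitivity (\int[gauss_law nu A]_y (\1_B y)%:E)%E; first by rewrite integral_indic// setIT.
    by rewrite integral_gauss_law//; exact/measurable_EFinP.
  rewrite !PE.
  have mF : measurable_fun [set: Rd d] (fun x => \1_B (affine_map mu M x) : R).
    by apply: (measurableT_comp (measurable_indic _)) => //; exact: measurable_affine_map.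
  have F01 (x : Rd d) : 0 <= (\1_B (affine_map mu M x) : R) <= 1.
    by rewrite indicE; case: (_ \in _); rewrite ?lexx ?ler01.
  have := affine_tv dh Ei bi mF F01.
  by under [X in (_ <= X + _)%E -> _]eq_integral do rewrite affine_comp ME mE.
move=> B mB.
have C nu A : fine (gauss_law nu A (~` B)) = 1 - fine (gauss_law nu A B).
  by rewrite probability_setC// fineB ?fin_num_measure.
have := one _ mB; have := one _ (measurableC mB); rewrite !C => h1 h2.
by rewrite ler_norml; apply/andP; split; lra.
Qed.

Lemma norm2_entry d (mu : 'cV[R]_d) i : `|mu i 0| <= norm2 mu.
Proof.
rewrite -sqrtr_sqr ler_wsqrtr// (bigD1 i)//= lerDl sumr_ge0// => j _; exact: sqr_ge0.
Qed.

(** The grid has at most [40 * 40 * (1 + r) (1 + kappa) (1 + d)^3 (1 + 1 / alpha)] values per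
    parameter, and [d^2 + d <= 2 d^2] parameters. *)
Definition net_const : R := 2 * (ln (40 * 40) + 3).

Lemma gauss_net (kappa r alpha : R) (d : nat) : 1 < kappa -> 0 < r -> 0 < alpha <= 1 ->
  (0 < d)%N ->
  exists (N : nat) (Q : 'I_N.+1 -> probability (Rd d) R),
    (forall D, valid (Gauss r d kappa alpha) D -> exists i, forall B, measurable B ->
       `|fine (Q i B) - fine (D B)| <= alpha / 10) /\
    ln (N.+1%:R : R) <= net_const * d%:R ^+ 2 * log_factor r d kappa alpha.
Proof.
move=> kg r0 /andP[a0 a1] d0.
have dR : 1 <= d%:R :> R by rewrite ler1n.
have dp : 0 < d%:R :> R by lra.
(* The grid discretizes [mu] and the factor [M] of the covariance. Entries of [mu] are at most [r],
   and the squared rows of [M] at most [kappa]. *)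
pose A := r + kappa; have A0 : 0 < A by rewrite /A; lra.
(* The error [44 d^3 h] of [gauss_law_close] is then at most [alpha / 10]. *)
pose h := alpha / (20 * 25 * d%:R ^+ 3).
have h0 : 0 < h by rewrite divr_gt0// !mulr_gt0// exprn_gt0.
have dN : (d%:R : R) != 0 by rewrite gt_eqF.
have hd : d%:R ^+ 3 * h = alpha / (20 * 25) by rewrite /h; field.
clearbody h.
pose K' := Num.truncn (2 * A / h).
have q0 : 0 <= 2 * A / h by rewrite divr_ge0 ?mulr_ge0 ?ltW.
pose pt (k : 'I_K'.+1) : R := - A + k%:R * h.
pose kof (v : R) : 'I_K'.+1 := inord (Num.truncn ((v + A) / h)).
have rnd v : `|v| <= A -> `|pt (kof v) - v| <= h.
  rewrite ler_norml => /andP[v1 v2].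
  have v0 : 0 <= (v + A) / h by rewrite divr_ge0 ?(ltW h0)//; lra.
  have kK : (Num.truncn ((v + A) / h) < K'.+1)%N.
    by rewrite ltnS le_truncn// ler_pM2r ?invr_gt0//; lra.
  rewrite /pt /kof inordK//; have /andP[t1 t2] := truncn_itv v0.
  set k := Num.truncn _ in t1 t2 *.
  move: t1 t2; rewrite ler_pdivlMr// ltr_pdivrMr// -natr1 mulrDl mul1r => t1 t2.
  by rewrite ler_norml; apply/andP; split; lra.
pose T := ({ffun 'I_d * 'I_d -> 'I_K'.+1} * {ffun 'I_d -> 'I_K'.+1})%type.
pose N := #|{: T}|.-1.
have cT : #|{: T}| = (K'.+1 ^ (d * d) * K'.+1 ^ d)%N.
  by rewrite card_prod !card_ffun card_prod !card_ord.
have NE : N.+1 = #|{: T}| by rewrite /N prednK// cT muln_gt0 !expn_gt0.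
pose Q (i : 'I_N.+1) : probability (Rd d) R := let t := enum_val (cast_ord NE i) in
  gauss_law (\col_a pt (t.2 a)) (\matrix_(a, c) pt (t.1 (a, c))).
exists N, Q; split.
  move=> D [mu [Sigma [hmu low up [M MS DE]]]]; rewrite -MS in low up.
  have hM i j : `|M i j| <= A.
    have := loewner_upper (delta_mx 0 i) up; rewrite -rowE.
    have -> : \sum_j0 ((delta_mx 0 i : 'rV[R]_d) 0 j0) ^+ 2 = 1.
      rewrite (bigD1 i)//= mxE !eqxx expr1n big1 ?addr0// => k ki.
      by rewrite mxE eqxx (negbTE ki) expr0n.
    rewrite mulr1 => hs.
    have : M i j ^+ 2 <= kappa.
      apply: le_trans hs; rewrite (bigD1 j)//= mxE lerDl sumr_ge0// => k _; exact: sqr_ge0.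
    rewrite -real_normK ?num_real// => hk.
    have n0 := normr_ge0 (M i j); rewrite /A.
    by have [hl|hl] := leP `|M i j| 1; [lra|rewrite expr2 in hk; nra].
  have hmu' i : `|mu i 0| <= A by apply: le_trans (norm2_entry mu i) _; rewrite /A; lra.
  pose t : T := ([ffun p => kof (M p.1 p.2)], [ffun a => kof (mu a 0)]).
  exists (cast_ord (esym NE) (enum_rank t)) => B mB.
  rewrite /Q cast_ordKV enum_rankK /=.
  have -> : D B = gauss_law mu M B by rewrite DE.
  apply: le_trans (gauss_law_close (h := h) d0 low _ _ _ mB) _.
  - have : d%:R ^+ 2 * h <= d%:R ^+ 3 * h by rewrite ler_wpM2r ?(ltW h0)// ler_weXn2l.
    by rewrite hd; lra.
  - by move=> i j; rewrite !mxE ffunE; exact: rnd.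
  - by move=> i; rewrite !mxE ffunE; exact: rnd.
  have -> : d%:R * (44 * (d%:R ^+ 2 * h)) = 44 * (d%:R ^+ 3 * h) by ring.
  by rewrite hd; lra.
have LF1 : 1 <= log_factor r d kappa alpha.
  rewrite /log_factor -!addrA lerDl !addr_ge0// ln_ge0// lerDl ?invr_ge0 ?ltW//; lra.
pose X : R := (1 + r) * (1 + kappa); pose Y : R := (1 + d%:R) ^+ 3; pose W : R := 1 + alpha^-1.
have aV : 0 < alpha^-1 by rewrite invr_gt0.
have X1 : 1 <= X by rewrite /X; nra.
have Y1 : 1 <= Y by rewrite exprn_ege1//; lra.
have W1 : 1 <= W by rewrite /W; lra.
have KX : K'.+1%:R <= 40 * 40 * (X * Y * W).
  have XYW : 1 <= X * Y * W by rewrite -[1]mulr1 -[X in X * _ <= _]mulr1; apply: ler_pM => //; apply: ler_pM.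
  have t1 : K'%:R <= 2 * A / h by have /andP[] := truncn_itv q0.
  rewrite -natr1.
  have hE : h^-1 = 20 * 25 * d%:R ^+ 3 * alpha^-1.
    have -> : h = alpha / (20 * 25) / d%:R ^+ 3 by rewrite -hd; field.
    by field; rewrite dN gt_eqF.
  have : A * (d%:R ^+ 3 * alpha^-1) <= X * (Y * W).
    apply: ler_pM => //; first exact: ltW.
    - by rewrite mulr_ge0 ?(ltW aV)// exprn_ge0// ltW.
    - by rewrite /A /X; nra.
    - apply: ler_pM; [by rewrite exprn_ge0// ltW|exact: ltW| |by rewrite /W; lra].
      by rewrite lerXn2r ?nnegrE; lra.
  rewrite mulrA => hA.
  have : 2 * A / h = 20 * 50 * (A * d%:R ^+ 3 * alpha^-1) by rewrite hE; ring.
  by move=> hh; move: (K'%:R) t1 => k1 t1; lra.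
have lnK : ln (K'.+1%:R : R) <= (ln (40 * 40) + 3) * log_factor r d kappa alpha.
  have p16 : 0 < 40 * 40 :> R by rewrite mulr_gt0.
  apply: (@le_trans _ _ (ln (40 * 40 * (X * Y * W)))).
    by rewrite ler_ln ?posrE// ?ltr0n// !mulr_gt0//; lra.
  have Xp : 0 < X by lra. have Yp : 0 < Y by lra. have Wp : 0 < W by lra.
  have -> : ln (40 * 40 * (X * Y * W)) = ln (40 * 40) + (ln X + ln Y + ln W).
    have XY0 : 0 < X * Y by exact: mulr_gt0.
    have XYW0 : 0 < X * Y * W by exact: mulr_gt0.
    by rewrite (lnM p16 XYW0) (lnM XY0 Wp) (lnM Xp Yp).
  have -> : ln X = ln (1 + r) + ln (1 + kappa) by rewrite /X lnM ?posrE//; lra.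
  have -> : ln Y = 3 * ln (1 + d%:R) by rewrite /Y lnXn ?mulr_natl//; lra.
  have l1 : 0 <= ln (1 + r) by rewrite ln_ge0//; lra.
  have l2 : 0 <= ln (1 + kappa) by rewrite ln_ge0//; lra.
  have l3 : 0 <= ln (1 + d%:R : R) by rewrite ln_ge0//; lra.
  have l4 : 0 <= ln W by rewrite ln_ge0.
  have l5 : 0 <= ln (40 * 40 : R) by rewrite ln_ge0//; lra.
  move: l5; set c40 := ln (40 * 40); move=> l5; clearbody c40.
  apply: (@le_trans _ _ (c40 + 3 * log_factor r d kappa alpha)).
    by rewrite /log_factor -/W; lra.
  by rewrite [leRHS]mulrDl lerD2r ler_peMr.
rewrite NE cT natrM !natrX -exprD lnXn ?ltr0n// -[leLHS]mulr_natl.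
have dd : (d * d + d)%:R <= 2 * d%:R ^+ 2 :> R.
  by rewrite natrD natrM expr2; nra.
have lK0 : 0 <= ln (K'.+1%:R : R) by rewrite ln_ge0// ler1n.
apply: le_trans (ler_wpM2r lK0 dd) _.
apply: (@le_trans _ _ (2 * d%:R ^+ 2 * ((ln (40 * 40) + 3) * log_factor r d kappa alpha))).
  by rewrite ler_wpM2l// mulr_ge0// sqr_ge0.
by rewrite /net_const le_eqVlt; apply/orP; left; apply/eqP; ring.
Qed.

End gauss_net.

(** * The two bounds combined *)

Section learn_from_net.
Context {R : realType} {dZ : measure_display} {Z : measurableType dZ}.

Lemma freq_setC m (B : set Z) (y : m.-tuple Z) : (0 < m)%N ->
  freq (R := R) (~` B) y = 1 - freq B y.
Proof.
move=> m0; have mN : (m%:R : R) != 0 by rewrite gt_eqF// ltr0n.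
rewrite /freq (eq_bigr (fun l => 1 - \1_B (tnth y l) : R)); last first.
  move=> l _; rewrite !indicE in_setC; case: (_ \in B); rewrite /= ?subrr ?subr0//.
by rewrite sumrB sumr_const card_ord mulrBl divff.
Qed.

Lemma net_achievable (t : @task R _ _ Z (pprobability Z R)) (m n N : nat)
    (Q : 'I_N.+1 -> probability Z R) (alpha eps tau lam : R) :
  (0 < m)%N -> 0 < alpha -> eps <= 1 ->
  (forall D, correct t D = [set P | (tv_dist P D <= alpha%:E)%E]) ->
  (forall D, valid t D -> exists i, forall B, measurable B ->
     `|fine (Q i B) - fine (D B)| <= alpha / 10) ->
  alpha <= tau -> 4 * expR (- (Num.sqrt m%:R * tau / 4)) <= alpha / 10 ->
  0 < lam -> 4 * lam * tau <= eps -> 8 * lam * tau ^+ 2 <= alpha / 5 ->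
  N.+1%:R ^+ 2 * expR (- (lam * alpha / 5)) ^+ n <= 3^-1 ->
  achievable t m eps 0 n.
Proof.
move=> m0 a0 e1 corr net at_ ht l0 l1 l2 hn.
have t0 : 0 < tau by lra.
have l1' : 4 * lam * tau <= 1 by lra.
pose gap i j (B : set Z) : R := fine (Q i B) - fine (Q j B).
(* The events are chosen from the net alone, before any data. If no event has gap above [8/10 alpha]
   the choice is arbitrary, and the vote of that pair is the constant [tau]. *)
have pickB (ij : 'I_N.+1 * 'I_N.+1) : exists B : set Z, measurable B /\
    forall B', measurable B' -> 8 / 10 * alpha < gap ij.1 ij.2 B' -> 8 / 10 * alpha < gap ij.1 ij.2 B.
  have [[B' [mB' hB']]|no] := pselect (exists B', measurable B' /\ 8 / 10 * alpha < gap ij.1 ij.2 B').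
    by exists B'; split => // B'' _ _.
  by exists set0; split => // B' mB' hB'; exfalso; apply: no; exists B'.
have [BB BBP] := choice pickB.
have mBB ij : measurable (BB ij) by have [] := BBP ij.
pose rival i j := 8 / 10 * alpha < gap i j (BB (i, j)).
pose mid i j := (fine (Q i (BB (i, j))) + fine (Q j (BB (i, j)))) / 2.
pose s i j (y : m.-tuple Z) : R :=
  if rival i j then clip tau (freq (BB (i, j)) y - mid i j) else tau.
pose rho := expR (- (lam * alpha / 5)).
apply: (@tournament_achievable _ _ _ _ _ t m n N eps tau lam rho Q s) => //.
- move=> i j; rewrite /s; case: (rival i j) => //; exact: measurable_clip.
- move=> i j y; rewrite /s; case: (rival i j); first by apply: clip_le; exact: ltW.
  by rewrite gtr0_norm.
- exact: ltW.
- exact: expR_ge0.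
move=> D /net [i' hi']; exists i'; split.
  move=> j; rewrite /s; case: (boolP (rival i' j)) => hr.
    apply: (clip_mgf m0 (mBB _) a0 at_ ht l0 l1' l2).
    (* The true probability exceeds the midpoint by at least half the gap minus the net error,
       [(4/10 - 1/10) alpha]. *)
    have := hi' _ (mBB (i', j)); rewrite ler_norml => /andP[h1 h2].
    by move: hr; rewrite /rival /gap /mid; lra.
  rewrite integral_cstr lee_fin ler_expR.
  have := ler_wpM2l (ltW l0) at_; have := mulr_gt0 l0 t0; lra.
move=> i; rewrite corr/= => bad.
(* A bad point differs from [D] by more than [alpha] on some event, hence from [Q i'] by more than
   [9/10 alpha]; when the sign is wrong the complement serves. *)
have hr : rival i i'.
  have [A [mA hA]] : exists A, measurable A /\ alpha < `|fine (Q i A) - fine (D A)|.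
    apply: contrapT => no; apply: bad; apply/tv_distP => A mA.
    by rewrite leNgt; apply/negP => hA; apply: no; exists A.
  have C (P : probability Z R) : fine (P (~` A)) = 1 - fine (P A).
    by rewrite probability_setC// fineB ?fin_num_measure.
  have [_ H] := BBP (i, i').
  have := hi' _ mA; rewrite ler_norml => /andP[h1 h2].
  move: hA; have [h|h] := leP 0 (fine (Q i A) - fine (D A)) => hA.
    by rewrite (ger0_norm h) in hA; apply: (H A mA); rewrite /gap/=; lra.
  by rewrite (ltr0_norm h) in hA; apply: (H (~` A) (measurableC mA)); rewrite /gap/= !C; lra.
rewrite /s hr.
(* Since clipping is odd, passing to the complement turns a vote that [i] should lose into one
   covered by [clip_mgf]. *)
have E (y : m.-tuple Z) : expR (2 * lam * clip tau (freq (BB (i, i')) y - mid i i')) =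
    expR (- (2 * lam) * clip tau (freq (~` BB (i, i')) y - (1 - mid i i'))).
  rewrite freq_setC// (_ : 1 - freq (BB (i, i')) y - (1 - mid i i') = - (freq (BB (i, i')) y - mid i i')); last by ring.
  by rewrite clipN ?(ltW t0)// mulrNN.
under eq_integral do rewrite E.
apply: (clip_mgf m0 (measurableC (mBB _)) a0 at_ ht l0 l1' l2).
have := hi' _ (mBB (i, i')); rewrite ler_norml => /andP[h1 h2].
rewrite probability_setC// fineB ?fin_num_measure//=.
by move: hr; rewrite /rival /gap /mid; lra.
Qed.

End learn_from_net.

(** * The upper bound *)

Section upper.
Context {R : realType}.

Lemma log_factor_ge1 (kappa r alpha : R) d : 0 < kappa -> 0 < r -> 0 < alpha ->
  1 <= log_factor r d kappa alpha.
Proof.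
move=> k0 r0 a0; have aV : 0 < alpha^-1 by rewrite invr_gt0.
have l1 : 0 <= ln (1 + r) by rewrite ln_ge0//; lra.
have l2 : 0 <= ln (1 + kappa) by rewrite ln_ge0//; lra.
have l3 : 0 <= ln (1 + d%:R : R) by rewrite ln_ge0// lerDl.
have l4 : 0 <= ln (1 + alpha^-1) by rewrite ln_ge0//; lra.
by rewrite /log_factor; lra.
Qed.

(** The left side bounds [5 / (lam alpha)] when [lam] is the smaller of its two limits. Expanding
    [tau], the privacy limit yields [1 / eps] and [L / (alpha eps q)]; the other yields
    [(1 + L / (alpha q))^2], whose constant part is absorbed by [1 / eps >= 1]. *)
Lemma tournament_rate (alpha eps q mm L G : R) : 0 < alpha -> 0 < eps -> eps <= 1 ->
  0 < q -> q ^+ 2 = mm -> 0 <= L -> L <= G -> 1 <= G ->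
  let tau := alpha + L / q in
  5 * (((eps / (4 * tau))^-1 + (alpha / (40 * tau ^+ 2))^-1) * alpha^-1) <=
  420 * G ^+ 2 * (eps^-1 + (alpha * eps * q)^-1 + (alpha ^+ 2 * mm)^-1).
Proof.
move=> a0 e0 e1 q0 q2 L0 LG G1 /=; set tau := alpha + L / q.
have aN : alpha != 0 by rewrite gt_eqF.
have eN : eps != 0 by rewrite gt_eqF.
have qN : q != 0 by rewrite gt_eqF.
have tN : alpha * q + L != 0 by rewrite gt_eqF// ltr_wpDr// mulr_gt0.
pose s2 := (alpha * eps * q)^-1; pose s3 := (alpha ^+ 2 * mm)^-1.
have s20 : 0 <= s2 by rewrite invr_ge0 !mulr_ge0 ?ltW.
have s30 : 0 <= s3 by rewrite invr_ge0 -q2 mulr_ge0 ?sqr_ge0.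
have -> : 5 * (((eps / (4 * tau))^-1 + (alpha / (40 * tau ^+ 2))^-1) * alpha^-1) =
    20 * eps^-1 + 20 * (L * s2) + 200 * (1 + (L / (alpha * q))) ^+ 2.
  by rewrite /s2 /tau; field; rewrite aN eN qN tN.
have sq : (1 + L / (alpha * q)) ^+ 2 <= 2 + 2 * (L ^+ 2 * s3).
  have -> : L ^+ 2 * s3 = (L / (alpha * q)) ^+ 2.
    by rewrite /s3 -q2; field; rewrite aN qN.
  have := sqr_ge0 (1 - L / (alpha * q)); lra.
have eV : 1 <= eps^-1 by rewrite invf_ge1.
rewrite -/s2 -/s3; clearbody s2 s3 tau; set z := _ ^+ 2 in sq *; clearbody z.
have GG : G <= G ^+ 2 by rewrite expr2 ler_peMr//; lra.
have LG2 : L <= G ^+ 2 by lra.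
have L2G : L ^+ 2 <= G ^+ 2 by rewrite lerXn2r ?nnegrE//; lra.
have p1 := ler_wpM2r s20 LG2; have p2 := ler_wpM2r s30 L2G.
have G21 : 1 <= G ^+ 2 by lra.
have eV0 : 0 <= eps^-1 by lra.
have p3 := ler_wpM2r eV0 G21.
have p4 : 0 <= G ^+ 2 * s2 by rewrite mulr_ge0// sqr_ge0.
have p5 : 0 <= G ^+ 2 * s3 by rewrite mulr_ge0// sqr_ge0.
lra.
Qed.

Lemma gauss_upper (kappa : R) : 1 < kappa -> exists2 C : R, 0 < C &
  forall (d : nat) (r alpha eps : R) (m : nat), (0 < d)%N -> 0 < r ->
    0 < alpha <= 1 -> 0 < eps <= 1 -> (0 < m)%N ->
    exists2 n : nat, achievable (Gauss r d kappa alpha) m eps 0 n &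
      n%:R <= C * gauss_rate d m alpha eps * log_factor r d kappa alpha ^+ 3.
Proof.
move=> kg.
pose c1 : R := 4 * (ln 40 + 1).
pose c2 : R := 2 * @net_const R + ln 3.
have ln40 : 0 <= ln (40 : R) by rewrite ln_ge0// ler1n.
have ln3 : 0 <= ln (3 : R) by rewrite ln_ge0//; lra.
have ln16 : 0 <= ln (40 * 40 : R) by rewrite ln_ge0// mulr_ege1// ler1n.
have c1_ge1 : 1 <= c1 by rewrite /c1; lra.
have nc0 : 0 <= @net_const R by rewrite /net_const; lra.
have c20 : 0 <= c2 by rewrite /c2; lra.
exists (c2 * (420 * c1 ^+ 2) + 1).
  exact: ltr_wpDl (mulr_ge0 c20 (mulr_ge0 (ler0n _ _) (sqr_ge0 c1))) ltr01.
move=> d r alpha eps m d0 r0 /andP[a0 a1] /andP[e0 e1] m0.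
set LF := log_factor r d kappa alpha.
have LF1 : 1 <= LF by apply: log_factor_ge1 => //; lra.
have a01 : 0 < alpha <= 1 by rewrite a0.
have [N [Q [net lnN]]] := gauss_net kg r0 a01 d0.
have mR : 0 < m%:R :> R by rewrite ltr0n.
pose q : R := Num.sqrt m%:R.
have q2 : q ^+ 2 = m%:R by rewrite sqr_sqrtr// ltW.
have q1 : 1 <= q by rewrite -sqrtr1 ler_wsqrtr// ler1n.
have q0 : 0 < q by lra.
have aV1 : 1 <= alpha^-1 by rewrite invf_ge1.
have aV0 : 0 < alpha^-1 by rewrite invr_gt0.
(* It makes [exp (- (q tau / 4))] at most [alpha / 40], the tail condition of [clip_mgf]. *)
pose L := 4 * ln (40 / alpha).
have L0 : 0 <= L by rewrite /L mulr_ge0// ln_ge0//; lra.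
have Lc : L <= c1 * LF.
  rewrite /L /c1 -mulrA ler_pM2l// lnM ?posrE// mulrDl mul1r.
  apply: lerD; first by rewrite ler_peMr.
  have l1 : 0 <= ln (1 + r) by rewrite ln_ge0//; lra.
  have l2 : 0 <= ln (1 + kappa) by rewrite ln_ge0//; lra.
  have l3 : 0 <= ln (1 + d%:R : R) by rewrite ln_ge0// lerDl.
  have l4 : ln (alpha^-1) <= ln (1 + alpha^-1) by rewrite ler_ln ?posrE//; lra.
  by rewrite /LF /log_factor; lra.
pose tau := alpha + L / q.
have Lq0 : 0 <= L / q by rewrite divr_ge0// ltW.
have ta : alpha <= tau by rewrite /tau; lra.
have t0 : 0 < tau by lra.
have ht : 4 * expR (- (Num.sqrt m%:R * tau / 4)) <= alpha / 10.
  have : L <= q * tau.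
    rewrite /tau mulrDr [q * (L / q)]mulrC divfK ?gt_eqF//.
    by have := mulr_gt0 q0 a0; lra.
  rewrite -/q => hL.
  have : expR (- (q * tau / 4)) <= expR (- ln (40 / alpha)).
    by rewrite ler_expR; move: hL; rewrite /L; lra.
  rewrite [X in _ <= X]expRN lnK ?posrE ?divr_gt0// invf_div => hE; lra.
pose l_a := eps / (4 * tau); pose l_b := alpha / (40 * tau ^+ 2).
have la0 : 0 < l_a by rewrite divr_gt0 ?mulr_gt0.
have lb0 : 0 < l_b by rewrite divr_gt0 ?mulr_gt0 ?exprn_gt0.
pose lam := Num.min l_a l_b.
have lam0 : 0 < lam by rewrite lt_min la0 lb0.
have lamV : lam^-1 <= l_a^-1 + l_b^-1.
  have [h|h] := leP l_a l_b; rewrite /lam.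
    by rewrite (min_l h) lerDl invr_ge0 ltW.
  by rewrite (min_r (ltW h)) lerDr invr_ge0 ltW.
have tN : tau != 0 by rewrite gt_eqF.
have aN : alpha != 0 by rewrite gt_eqF.
have eN : eps != 0 by rewrite gt_eqF.
have qN : q != 0 by rewrite gt_eqF.
have l1 : 4 * lam * tau <= eps.
  have h : lam <= l_a by rewrite ge_min lexx.
  have := ler_wpM2r (ltW t0) h; rewrite (_ : l_a * tau = eps / 4); last by rewrite /l_a; field.
  by lra.
have l2 : 8 * lam * tau ^+ 2 <= alpha / 5.
  have h : lam <= l_b by rewrite ge_min lexx orbT.
  have := ler_wpM2r (sqr_ge0 tau) h; rewrite (_ : l_b * tau ^+ 2 = alpha / 40); last by rewrite /l_b; field.
  by lra.
clearbody lam.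
have lN : lam != 0 by rewrite gt_eqF.
(* With [u], the logarithm of [3 (N + 1)^2], any [n >= u v] makes the failure bound
   [(N + 1)^2 exp (- (n lam alpha / 5))] at most 1/3. *)
pose v := 5 * (lam^-1 * alpha^-1).
have v0 : 0 <= v by rewrite /v !mulr_ge0 ?invr_ge0 ?ltW.
pose u : R := 2 * ln N.+1%:R + ln 3.
have lnN0 : 0 <= ln (N.+1%:R : R) by rewrite ln_ge0// ler1n.
have u0 : 0 <= u by rewrite /u; lra.
pose x := u * v; have x0 : 0 <= x by rewrite mulr_ge0.
have /andP[tr1 tr2] := truncn_itv x0.
exists (Num.truncn x).+1.
  apply: (@net_achievable _ _ _ _ m _ N Q alpha eps tau lam) => //.
  set n := (Num.truncn x).+1 in tr2 *.
  have hx : u <= n%:R * (lam * alpha / 5).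
    have -> : u = x * (lam * alpha / 5) by rewrite /x /v; field; rewrite ?lN ?aN.
    by rewrite ler_wpM2r ?(ltW tr2)// divr_ge0// mulr_ge0// ltW.
  have Np : 0 < N.+1%:R :> R by rewrite ltr0n.
  rewrite -{1}[N.+1%:R]lnK ?posrE// -!expRM_natl -expRD.
  have -> : 3^-1 = expR (- ln 3) :> R by rewrite expRN lnK// posrE.
  rewrite ler_expR.
  by move: hx; rewrite /u; lra.
pose S : R := eps^-1 + (alpha * eps * q)^-1 + (alpha ^+ 2 * m%:R)^-1.
have eV : 1 <= eps^-1 by rewrite invf_ge1.
pose s2 := (alpha * eps * q)^-1; pose s3 := (alpha ^+ 2 * m%:R)^-1.
have s20 : 0 <= s2 by rewrite invr_ge0 !mulr_ge0 ?ltW.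
have s30 : 0 <= s3 by rewrite invr_ge0 mulr_ge0 ?sqr_ge0 ?ltW.
pose G := c1 * LF.
have G1 : 1 <= G by rewrite /G -[1]mulr1; apply: ler_pM.
have vS : v <= 420 * G ^+ 2 * S.
  apply: (@le_trans _ _ (5 * ((l_a^-1 + l_b^-1) * alpha^-1))).
    by rewrite ler_pM2l// ler_pM2r.
  exact: (tournament_rate a0 e0 e1 q0 q2 L0 Lc G1).
have dR : 1 <= d%:R ^+ 2 :> R by rewrite exprn_ege1// ler1n.
have dL : 1 <= d%:R ^+ 2 * LF by exact: mulr_ege1.
have uB : u <= c2 * (d%:R ^+ 2 * LF).
  rewrite /u /c2 [leRHS]mulrDl; apply: lerD; last by rewrite ler_peMr.
  by rewrite -mulrA ler_pM2l// mulrA.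
have S1 : 1 <= S by rewrite /S -addrA ler_wpDr// addr_ge0.
have rE : gauss_rate d m alpha eps = d%:R ^+ 2 * S by rewrite /gauss_rate /S -/q; ring.
rewrite -natr1 rE.
have xB : x <= c2 * (d%:R ^+ 2 * LF) * (420 * G ^+ 2 * S) by apply: ler_pM.
have one : 1 <= d%:R ^+ 2 * S * LF ^+ 3.
  by apply: mulr_ege1; [exact: mulr_ege1|exact: exprn_ege1].
(* One power of [LF] comes from [u] and two from [G ^+ 2]; the 1 from rounding up is absorbed since
   every factor of the rate bound is at least 1. *)
apply: (@le_trans _ _ (c2 * (d%:R ^+ 2 * LF) * (420 * G ^+ 2 * S) + d%:R ^+ 2 * S * LF ^+ 3)).
  exact: lerD (le_trans tr1 xB) one.
by rewrite /G le_eqVlt; apply/orP; left; apply/eqP; ring.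
Qed.

End upper.

Theorem theoremE11 (R : realType) (kappa : R) (kappa_gt1 : 1 < kappa) :
  exists (alpha0 eps0 c C : R) (p : nat),
    [/\ 0 < alpha0, 0 < eps0, 0 < c & 0 < C] /\
    forall (d : nat) (r alpha eps : R) (m : nat),
      (0 < d)%N -> 0 < r -> 0 < alpha < alpha0 -> 0 < eps < eps0 ->
      (0 < m)%N ->
      exists2 n : nat,
        is_user_complexity (Gauss r d kappa alpha) m eps 0 n &
        c * gauss_rate d m alpha eps / log_factor r d kappa alpha ^+ p
          <= n%:R <=
        C * gauss_rate d m alpha eps * log_factor r d kappa alpha ^+ p.
Proof.
have [a1 [c [a10 c0 lower]]] := gauss_lower kappa_gt1.
have [C C0 upper] := gauss_upper kappa_gt1.
exists (Num.min a1 1), 2^-1, c, C, 3%N; split.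
  by split=> //; rewrite lt_min a10 ltr01.
move=> d r alpha eps m d0 r0 /andP[al0]; rewrite lt_min => /andP[al1 al2] /andP[e0 e1] m0.
have k0 : 0 < kappa by lra.
have alp : 0 < alpha <= 1 by rewrite al0 ltW.
have alp1 : 0 < alpha < a1 by rewrite al0.
have ep : 0 < eps <= 1 by rewrite e0; lra.
have ep2 : 0 < eps < 2^-1 by rewrite e0.
have [n0 ach n0_le] := upper d r alpha eps m d0 r0 alp ep m0.
(* The upper bound supplies an achievable number of users, so a least one exists. *)
have ex : exists n, `[< achievable (Gauss r d kappa alpha) m eps 0 n >] by exists n0; apply/asboolP.
case: (ex_minnP ex) => n /asboolP achn nmin; exists n.
  by split=> // k /asboolP; exact: nmin.
apply/andP; split; last first.
  by apply: le_trans n0_le; rewrite ler_nat; apply: nmin; apply/asboolP.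
apply: le_trans (lower _ _ _ _ _ _ d0 r0 alp1 ep2 m0 achn).
(* Dividing by a power of a quantity that is at least 1 only weakens the lower bound. *)
have LF1 := log_factor_ge1 d k0 r0 al0.
rewrite ler_pdivrMr; last by rewrite exprn_gt0//; lra.
rewrite ler_peMr//; last by rewrite exprn_ege1.
rewrite mulr_ge0 ?(ltW c0)// /gauss_rate !addr_ge0// divr_ge0 ?sqr_ge0//.
- exact: ltW.
- by rewrite !mulr_ge0 ?sqrtr_ge0 ?ltW.
- by rewrite mulr_ge0 ?sqr_ge0.
Qed.
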